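(* Let $n\ge1$ and $f(u)=|u|^{4/n}u\,e^{u^2}$. There exist positive constants $\delta=\delta(n)$ and $C=C(n)$ such that the following holds. Let $\varphi\in\exp L^2$ with $\varphi\ge0$, assume that there exists a unique positive solution $u$ of the Cauchy problem $\partial_tu=\Delta u+f(u)$, $u(0)=\varphi$, satisfying $\sup_{t>0}\|u(t)\|_{\exp L^2}\le2\|\varphi\|_{\exp L^2}$, and assume furthermore that $\varphi\in L^p$ for some $p\in[1,2)$. If $$\max\{\|\varphi\|_{\exp L^2},\|\varphi\|_{L^p}\}<\delta,$$ then for all $q\in[p,\infty]$, $$\|u(t)\|_{L^q}\le C\,t^{-\frac n2\left(\frac1p-\frac1q\right)}\|\varphi\|_{\exp L^2\cap L^p},\qquad t>0.$$ In particular, for all $q\in[p,\infty)$ there is a constant $C'>0$, independent of $\varphi$ and $t$, such that $$\|u(t)\|_{L^q}\le C'(1+t)^{-\frac n2\left(\frac1p-\frac1q\right)}\|\varphi\|_{\exp L^2\cap L^p},\qquad t>0.$$ Furthermore, if $p\in(1,2)$, then for all $q\in[p,\infty]$, $$\|u(t)\|_{L^q}=o\left(t^{-\frac n2\left(\frac1p-\frac1q\right)}\right),\qquad t\to\infty.$$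
   Context: Orlicz space: $\exp L^2=\exp L^2(\mathbb{R}^n)$ is the space of $u\in L^1_{loc}(\mathbb{R}^n)$ such that $\int_{\mathbb{R}^n}(\exp((|u(x)|/\lambda)^2)-1)\,dx<\infty$ for some $\lambda>0$, with the Luxemburg norm $\|u\|_{\exp L^2}=\inf\{\lambda>0:\int_{\mathbb{R}^n}(\exp((|u(x)|/\lambda)^2)-1)\,dx\le1\}$. The norm of the intersection is $\|\varphi\|_{\exp L^2\cap L^{p}}=\|\varphi\|_{\exp L^2}+\|\varphi\|_{L^{p}}$. Weak$^*$ convergence: the predual of $\exp L^2$ is the Orlicz space of the complementary function $\tilde A(t)=\sup_{s\ge0}(ts-A(s))$ of $A(s)=e^{s^2}-1$. ''$u(t)\to\varphi$ in the weak$^*$ topology as $t\to0$'' means $\lim_{t\to0}\int_{\mathbb{R}^n}(u(t,x)-\varphi(x))\psi(x)\,dx=0$ for every $\psi$ in this predual. Heat semigroup: $e^{t\Delta}\varphi=G_2(t,\cdot)*\varphi$ with $G_2(t,x)=(4\pi t)^{-n/2}e^{-|x|^2/(4t)}$. Solution: ''solution'' means mild solution in $(0,\infty)\times\mathbb{R}^n$: $u\in L^\infty(0,\infty;\exp L^2)\cap C((0,\infty);\exp L^2)$, $u(t)=e^{t\Delta}\varphi+\int_0^te^{(t-s)\Delta}f(u(s))\,ds$ for $t>0$, and $u(t)\to\varphi$ in the weak$^*$ topology as $t\to0$. $L^q=L^q(\mathbb{R}^n)$. *)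

(* Defs.v *)
From HB Require Import structures.
From mathcomp Require Import all_boot all_order all_algebra.
From mathcomp Require Import all_classical all_reals all_analysis.
Set Implicit Arguments.
Unset Strict Implicit.
Unset Printing Implicit Defensive.
Import Order.TTheory GRing.Theory Num.Theory.
Import numFieldNormedType.Exports.

Local Open Scope classical_set_scope.
Local Open Scope ring_scope.

(* [measurableTypeR R] is R with the Borel sigma-algebra on which
   [lebesgue_measure] lives; tuples over it carry the product sigma-algebra,
   that is, the Borel sets of R^n. *)
Notation euclidean R n := (n.-tuple (measurableTypeR R)).

Section lebesgue_measure_n.
Context {R : realType}.

Definition tuple_cons {n} (p : measurableTypeR R * euclidean R n) :
  euclidean R n.+1 := [the n.+1.-tuple _ of p.1 :: p.2].

Definition tuple_uncons {n} (x : euclidean R n.+1) :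
  measurableTypeR R * euclidean R n := (tnth x ord0, [tuple of behead x]).

Lemma measurable_tuple_cons n : measurable_fun [set: _] (@tuple_cons n).
Proof. by apply: measurable_cons; [exact: measurable_fst|exact: measurable_snd]. Qed.

Lemma measurable_tuple_uncons n : measurable_fun [set: _] (@tuple_uncons n).
Proof.
by apply/measurable_fun_pairP; split;
  [exact: measurable_tnth|exact: measurable_behead].
Qed.

Lemma tuple_consK n : cancel (@tuple_cons n) tuple_uncons.
Proof. by move=> [a x]; congr pair; exact/val_inj. Qed.

Section step.
Variables (n : nat) (mu : {sigma_finite_measure set (euclidean R n) -> \bar R}).

Definition lebesgue_step : set (euclidean R n.+1) -> \bar R :=
  pushforward (lebesgue_measure \x mu)%E (@tuple_cons n).

Let lebesgue_step_measure : {measure set (euclidean R n.+1) -> \bar R} :=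
  measure_function_pushforward__canonical__measure_function_Measure
    (lebesgue_measure \x mu)%E (@measurable_tuple_cons n).

HB.instance Definition _ := isMeasure.Build _ _ _ lebesgue_step
  (measure0 lebesgue_step_measure) (measure_ge0 lebesgue_step_measure)
  (@measure_semi_sigma_additive _ _ _ lebesgue_step_measure).

Let lebesgue_step_sigma_finite : sigma_finite setT lebesgue_step.
Proof.
have /sigma_finiteP[F [TF ndF Foo]] := sigma_finiteT (@lebesgue_measure R).
have /sigma_finiteP[G [TG ndG Goo]] := sigma_finiteT mu.
exists (fun i => tuple_uncons @^-1` (F i `*` G i)).
  rewrite -preimage_bigcup (_ : \bigcup_i (F i `*` G i) = setT)//.
  rewrite -setXTT TF TG predeqE => -[x y]; split.
    by move=> [i _ []/= ? ?]; split; exists i.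
  move=> [/= [i _ Fix] [j _ Gjy]]; exists (maxn i j) => //; split.
    by move: x Fix; exact/subsetPset/ndF/leq_maxl.
  by move: y Gjy; exact/subsetPset/ndG/leq_maxr.
move=> i; have [mF Fi] := Foo i; have [mG Gi] := Goo i; split.
  rewrite -[X in measurable X]setTI; apply: measurable_tuple_uncons => //.
  exact: measurableX.
rewrite /lebesgue_step /pushforward -comp_preimage.
rewrite (_ : tuple_uncons \o _ = id); last exact/funext/tuple_consK.
by rewrite preimage_id product_measure1E// lte_mul_pinfty// ge0_fin_numE.
Qed.

HB.instance Definition _ := Measure_isSigmaFinite.Build _ _ _ lebesgue_step
  lebesgue_step_sigma_finite.

End step.

(* Lebesgue measure on R^n: the n-fold product of the one-dimensional one; R^0
   is a single point of mass 1. *)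
Fixpoint lebesgue_measure_n (n : nat) :
    {sigma_finite_measure set (euclidean R n) -> \bar R} :=
  match n with
  | 0 => @dirac _ (euclidean R 0) [tuple] R
  | m.+1 => lebesgue_step (lebesgue_measure_n m)
  end.

End lebesgue_measure_n.

Section heat_equation.
Context {R : realType} {n : nat}.
Local Notation E := (euclidean R n).
Local Notation mu := (@lebesgue_measure_n R n).
Implicit Types (u phi psi g : E -> R) (A : R -> \bar R) (f : R -> R).

Definition subv (x y : E) : E :=
  [tuple (tnth x i : R) - (tnth y i : R) | i < n].

Definition sqnorm (x : E) : R := \sum_(i < n) (tnth x i : R) ^+ 2.

(* Integrability on every ball is integrability on every compact set. *)
Definition L1loc u :=
  measurable_fun [set: E] u /\
  forall r : R, mu.-integrable [set x | sqnorm x <= r ^+ 2] (EFin \o u).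

(* Orlicz spaces and Luxemburg norms for a Young function [A], of which only
   the values on [0, +oo[ matter. *)
Definition orlicz_modular A u (l : R) : \bar R :=
  (\int[mu]_x A (`|u x| / l)%R)%E.

Definition orlicz A : set (E -> R) :=
  [set u | L1loc u /\ exists2 l : R, 0 < l & (orlicz_modular A u l < +oo)%E].

Definition luxemburg_norm A u : \bar R :=
  ereal_inf [set l%:E | l in [set l : R | 0 < l /\ (orlicz_modular A u l <= 1)%E]].

Definition complementary A (t : R) : \bar R :=
  ereal_sup [set ((t * s)%:E - A s)%E | s in [set s : R | 0 <= s]].

Definition exp2_young (s : R) : \bar R := (expR (s ^+ 2) - 1)%:E.

Definition expL2 : set (E -> R) := orlicz exp2_young.
Definition expL2_norm u : \bar R := luxemburg_norm exp2_young u.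

Definition expL2_predual : set (E -> R) := orlicz (complementary exp2_young).

Definition weak_star_cvg0 (u : R -> E -> R) phi :=
  forall psi, expL2_predual psi ->
    (\int[mu]_x ((u t x - phi x) * psi x)%:E)%E @[t --> 0^'+] --> 0%E.

Definition heat_kernel (t : R) (x : E) : R :=
  (4 * pi * t) `^ (- (n%:R / 2)) * expR (- (sqnorm x / (4 * t))).

(* Extended real valued: +oo is possible for g >= 0. *)
Definition heat_semigroup (t : R) g (x : E) : \bar R :=
  (\int[mu]_y (heat_kernel t (subv x y) * g y)%:E)%E.

(* Mild solutions on ]0, +oo[ x R^n of du/dt = Delta u + f(u), u(0) = phi.
   - Strong measurability in time, part of membership in L^oo(0,oo; exp L^2), is
     implied by the continuity in time.
   - The left-hand side of the Duhamel formula is a real number, so that the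
     formula forces both terms on its right to be finite. *)
Record mild_solution f phi (u : R -> E -> R) : Prop := MildSolution {
  mild_expL2 : forall t : R, 0 < t -> expL2 (u t) ;
  mild_bounded : exists M : R,
    {ae lebesgue_measure, forall t : R, 0 < t -> (expL2_norm (u t) <= M%:E)%E} ;
  mild_continuous : forall t0 : R, 0 < t0 ->
    expL2_norm (u t \- u t0) @[t --> t0] --> 0%E ;
  mild_duhamel : forall t : R, 0 < t -> {ae mu, forall x,
    (u t x)%:E = (heat_semigroup t phi x +
      \int[lebesgue_measure]_(s in `]0%R, t[) heat_semigroup (t - s) (f \o u s) x)%E} ;
  mild_initial : weak_star_cvg0 u phi
}.

Definition nonlinearity (v : R) : R :=
  `|v| `^ (4 / n%:R) * v * expR (v ^+ 2).

Record bounded_positive_solution phi (u : R -> E -> R) : Prop :=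
  BoundedPositiveSolution {
  bps_mild : mild_solution nonlinearity phi u ;
  bps_positive : forall t : R, 0 < t -> {ae mu, forall x, 0 <= u t x} ;
  bps_bound : (ereal_sup [set expL2_norm (u t) | t in [set t : R | 0 < t]%R]
               <= 2%:E * expL2_norm phi)%E
}.

Definition unique_bounded_positive_solution phi (u : R -> E -> R) :=
  bounded_positive_solution phi u /\
  forall v, bounded_positive_solution phi v ->
    forall t : R, 0 < t -> v t = u t %[ae mu].

Record small_data (delta p : R) phi (u : R -> E -> R) : Prop := SmallData {
  small_expL2 : expL2 phi ;
  small_positive : {ae mu, forall x, 0 <= phi x} ;
  small_solution : unique_bounded_positive_solution phi u ;
  small_Lp : phi \in Lfun mu p%:E ;
  small_max : (maxe (expL2_norm phi) ('N[mu]_p%:E[EFin \o phi]) < delta%:E)%E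
}.

Definition cap_norm (p : R) phi : \bar R :=
  (expL2_norm phi + 'N[mu]_p%:E[EFin \o phi])%E.

(* n/2 (1/p - 1/q), where 1/q = 0 for q = +oo. *)
Definition decay_rate (p : R) (q : \bar R) : R :=
  n%:R / 2 * (p^-1 - fine (q^-1)%E).

End heat_equation.
Arguments decay_rate {R} n p q.

(* Main.v *)
(* The whole estimate follows from a pointwise domination
     |u(t)|^b <= 4 e^(t Delta) |phi|^b  a.e., for all t > 0,              (1)
   with some b in [1, p], b < p when p > 1.
   If |f(u(s))| is controlled by a potential so that
     |e^((t-s) Delta) f(u(s))| <= w_t(s) (e^((t-s) Delta) |u(s)|^b)^(1/b)
   with int_0^t w_t <= 1/8, then Jensen's inequality in s and the semigroup law
   give S <= 4 Q + S / 2, where S is the supremum over s in ]0, t] of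
   e^((A-s) Delta) |u(s)|^b (x0) and Q = e^(A Delta) |phi|^b (x0); S is finite
   because |u|^b <= 1 + u^2, and (1) follows.  Joint measurability in (s, x),
   which continuity into exp L^2 does not provide, is replaced by a measurable
   majorant, a lower limit along time grids.
   The potential is V = |u|^(4/n) e^(u^2).
   - For b = 4/3, Hoelder's inequality in space bounds w_t(s) by
     (t-s)^(-1/8) ||V(s)||_{L^(4n)}; that norm is small by the exponential
     integrability, and decays like s^(-7/8) where (1) is already known.  This
     proves (1) on ]0, N] by induction on N.
   - For p < 3/2, (1) with b = 4/3 and Jensen's inequality for exp give
     ||V(s)||_oo <= c s^(-1/4) for s <= 1, while (1) with b = 4/3 and phi in
     L^(3/2) give c s^(-4/3) for s >= 1; hence w = ||V||_oo is integrable and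
     (1) holds with b = 1.
   From (1), the L^p-L^q estimates of the heat semigroup give the decay.  For the
   o(.) statement, the part of phi above a small level lies in L^b, whose decay
   is faster, and the rest is small in L^p. *)
Require Import Defs.
From mathcomp Require Import all_boot all_order all_algebra.
From mathcomp Require Import all_classical all_reals all_analysis.
From mathcomp Require Import measurable_realfun ess_sup_inf.
From mathcomp Require Import ring lra.
Import Order.TTheory GRing.Theory Num.Theory.
Import numFieldNormedType.Exports.

Set Implicit Arguments.
Unset Strict Implicit.
Unset Printing Implicit Defensive.

Local Open Scope classical_set_scope.
Local Open Scope ring_scope.

(** * Powers and weighted integrals *)

(** Membership in exp L^2 gives no bound on sup |V|, only one on the L^(4n) norm of V; Hoelder's
    inequality in space is therefore needed first, and it costs b > 1. The exponent b = 1 requires V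
    bounded in x, which is available only once (1) holds with b = 4/3. Even then L^2 data are
    borderline at large times: u^2 <= c s^(-n/2) gives |u|^(4/n) <= c s^(-1), which just fails to be
    integrable; L^(3/2) data turn this into s^(-4/3). The exponents 1/8 and 7/8 express criticality.
    The heat flow maps L^n into L^oo at the cost tau^(-1/2), and the fourth root of this, for V^4,
    is tau^(-1/8); the decay s^(-7/8) is complementary, so that the Beta integral of the product
    does not depend on t. The number 8^-1 comes from (x + y)^b <= 4 (x^b + y^b) for b <= 2: the
    feedback is then 4 S / 8 = S / 2. *)

Lemma le_poweR (R : realType) (x y : \bar R) (r : R) :
  0 <= r -> (0 <= x)%E -> (x <= y)%E -> (x `^ r <= y `^ r)%E.
Proof.
move=> r0 x0 xy; apply: gt0_ler_poweR => //; rewrite in_itv/= leey andbT//.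
exact: le_trans xy.
Qed.

Lemma poweR_add_le (R : realType) (r : R) (c e : \bar R) : 0 <= r -> (0 <= c)%E -> (0 <= e)%E ->
  ((c + e) `^ r <= (2 `^ r)%:E * (c `^ r + e `^ r))%E.
Proof.
move=> r0; wlog ce : c e / (c <= e)%E.
  move=> H c0 e0; case/orP: (le_total c e) => ce; first exact: H.
  by rewrite addeC [X in (_ * X)%E]addeC; exact: H.
move=> c0 e0; apply: (@le_trans _ _ ((2%:E * e) `^ r)%E).
  apply: le_poweR => //; rewrite ?adde_ge0//.
  by rewrite (_ : 2%:E = (1 + 1)%:E :> \bar R)// EFinD ge0_muleDl// mul1e leeD2r.
rewrite poweRM ?lee_fin// poweR_EFin; apply: lee_wpmul2l.
  by rewrite lee_fin powR_ge0.
by rewrite leeDr// poweR_ge0.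
Qed.

Lemma measurable_powR_comp d (T : measurableType d) (R : realType) (g : T -> R)
    (r : R) :
  measurable_fun setT g -> measurable_fun setT (fun y => g y `^ r).
Proof. by move=> mg; exact: (@measurableT_comp _ _ _ _ _ _ (@powR R ^~ r)). Qed.

Section integral_inequalities.
Context d (T : measurableType d) (R : realType).
Variable mu : {measure set T -> \bar R}.
Import HBNNSimple.

(* The integral is a lower integral, hence monotone on non-measurable functions. *)
Lemma le_integral_nonmeasurable (D : set T) (f g : T -> \bar R) :
  (forall x, D x -> (f x <= g x)%E) ->
  (\int[mu]_(x in D) f x <= \int[mu]_(x in D) g x)%E.
Proof.
move=> fg; have mono (h k : T -> \bar R) : (forall x, D x -> (0 <= h x)%E) ->
    (forall x, D x -> (h x <= k x)%E) ->
    (\int[mu]_(x in D) h x <= \int[mu]_(x in D) k x)%E.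
  move=> h0 hk; rewrite !ge0_integralE//; last first.
    by move=> x Dx; exact: le_trans (h0 _ Dx) (hk _ Dx).
  apply: ge_ereal_sup => _ [s /= sh <-]; apply: ereal_sup_ubound; exists s => //=.
  move=> x; apply: le_trans (sh x) _; rewrite !patchE; case: ifPn => //.
  by move=> /set_mem; exact: hk.
rewrite integralE [leRHS]integralE; apply: leeB; apply: mono => x Dx //.
  by apply: (@funepos_le _ _ D) (mem_set Dx) => y /set_mem; exact: fg.
by apply: (@funeneg_le _ _ D) (mem_set Dx) => y /set_mem; exact: fg.
Qed.

(** Hoelder's inequality for the measure with density [k], obtained by distributing [k] as k^(1/p)
    k^(1/q) over the two factors. *)
Lemma weighted_hoelder (k f g : T -> R) (p q : R) :
  measurable_fun setT k -> measurable_fun setT f -> measurable_fun setT g ->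
  (forall x, 0 <= k x) -> (forall x, 0 <= f x) -> (forall x, 0 <= g x) ->
  0 < p -> 0 < q -> p^-1 + q^-1 = 1 ->
  (\int[mu]_x (k x * (f x * g x))%:E <=
   (\int[mu]_x (k x * f x `^ p)%:E) `^ p^-1 *
   (\int[mu]_x (k x * g x `^ q)%:E) `^ q^-1)%E.
Proof.
move=> mk mf mg k0 f0 g0 p0 q0 pq.
have mK (h : T -> R) r : measurable_fun setT h ->
    measurable_fun setT (fun x => k x `^ r^-1 * h x).
  by move=> mh; apply: measurable_funM => //; exact: measurable_powR_comp.
have NE (h : T -> R) r : 0 < r -> (forall x, 0 <= h x) ->
    ('N[mu]_(r%:E)[EFin \o (fun x => (k x `^ r^-1 * h x)%R)] =
    (\int[mu]_x (k x * h x `^ r)%:E) `^ r^-1)%E.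
  move=> r0 h0; rewrite unlock /=; congr (_ `^ _)%E.
  apply: eq_integral => x _; congr EFin.
  rewrite ger0_norm ?mulr_ge0 ?powR_ge0// powRM ?powR_ge0//.
  by rewrite -powRrM mulVf ?gt_eqF// powRr1.
have := hoelder mu (mK _ p mf) (mK _ q mg) p0 q0 pq.
rewrite !NE//; apply: le_trans; rewrite Lnorm1 le_eqVlt; apply/orP; left.
apply/eqP/eq_integral => x _ /=; congr EFin.
rewrite ger0_norm ?mulr_ge0 ?powR_ge0// mulrACA -powRD ?pq ?powRr1//.
by rewrite oner_eq0.
Qed.

(** Hoelder's inequality against the constant 1. Mass at most 1 is enough, so the inequality serves
    both for the heat kernel in space and for the weight in time. The case r = 1 is apart because
    its conjugate exponent is infinite. *)
Lemma weighted_jensen (k f : T -> R) (r : R) :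
  measurable_fun setT k -> measurable_fun setT f ->
  (forall x, 0 <= k x) -> (forall x, 0 <= f x) -> 1 <= r ->
  (\int[mu]_x (k x)%:E <= 1)%E ->
  (\int[mu]_x (k x * f x)%:E <= (\int[mu]_x (k x * f x `^ r)%:E) `^ r^-1)%E.
Proof.
move=> mk mf k0 f0; rewrite le_eqVlt => /predU1P[<- _|r1 k1].
  rewrite invr1 poweRe1; last first.
    by apply: integral_ge0 => x _; rewrite lee_fin mulr_ge0 ?powR_ge0.
  by apply: le_integral_nonmeasurable => x _; rewrite powRr1.
have r0 : 0 < r by rewrite (lt_trans ltr01).
have q0 : 0 < 1 - r^-1 by rewrite subr_gt0 invf_lt1.
have pq : r^-1 + ((1 - r^-1)^-1)^-1 = 1 by rewrite invrK subrKC.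
have q0' : 0 < (1 - r^-1)^-1 by rewrite invr_gt0.
have m1 : measurable_fun setT (cst 1 : T -> R) by exact: measurable_cst.
have := weighted_hoelder mk mf m1 k0 f0 (fun=> ler01) r0 q0' pq.
under eq_integral do rewrite mulr1.
move=> /le_trans; apply; rewrite -[leRHS]mule1; apply: lee_wpmul2l.
  exact: poweR_ge0.
under eq_integral do rewrite powR1 mulr1.
rewrite -[leRHS](@poweR1r _ (((1 - r^-1)^-1)^-1)).
apply: le_poweR k1; first by rewrite invr_ge0 ltW.
by apply: integral_ge0 => x _; rewrite lee_fin.
Qed.

Lemma weighted_jensen_pow (k f : T -> R) (r : R) :
  measurable_fun setT k -> measurable_fun setT f ->
  (forall x, 0 <= k x) -> (forall x, 0 <= f x) -> 1 <= r ->
  (\int[mu]_x (k x)%:E <= 1)%E ->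
  ((\int[mu]_x (k x * f x)%:E) `^ r <= \int[mu]_x (k x * f x `^ r)%:E)%E.
Proof.
move=> mk mf k0 f0 r1 k1; have r0 : 0 < r by rewrite (lt_le_trans ltr01).
have I0 : (0 <= \int[mu]_x (k x * f x `^ r)%:E)%E.
  by apply: integral_ge0 => x _; rewrite lee_fin mulr_ge0 ?powR_ge0.
rewrite -[leRHS]poweRe1// -(@mulVf _ r) ?gt_eqF// poweRrM.
apply: le_poweR (weighted_jensen _ _ _ _ _ _) => //; first exact: ltW.
by apply: integral_ge0 => x _; rewrite lee_fin mulr_ge0.
Qed.

End integral_inequalities.

(** * The heat kernel and the heat semigroup *)

Section lebesgue_measure_n_integral.
Context (R : realType).

Lemma integral_tuple_cons (n : nat) (f : euclidean R n.+1 -> \bar R) :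
  measurable_fun setT f -> (forall x, (0 <= f x)%E) ->
  (\int[lebesgue_measure_n n.+1]_x f x =
   \int[lebesgue_measure]_a \int[lebesgue_measure_n n]_y f (tuple_cons (a, y)))%E.
Proof.
move=> mf f0.
rewrite [LHS](@ge0_integral_pushforward _ _ _ _ R _ (@measurable_tuple_cons R n)
  (lebesgue_measure \x lebesgue_measure_n n)%E setT f)//; last first.
rewrite preimage_setT fubini_tonelli1//.
  exact: measurableT_comp mf (@measurable_tuple_cons R n).
by move=> x; exact: f0.
Qed.

Definition gaussian1 (t z : R) := (4 * pi * t) `^ (- (1 / 2)) * expR (- (z ^+ 2 / (4 * t))).

Lemma integral_gaussian1 (t m : R) : 0 < t ->
  (\int[lebesgue_measure]_z (gaussian1 t (m - z))%:E = 1)%E.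
Proof.
(* As a function of [z] this is the normal density of mean [m] and variance [2 * t]. *)
move=> t0; rewrite -(integral_normal_pdf m (Num.sqrt (2 * t))).
have s0 : Num.sqrt (2 * t) != 0 by rewrite sqrtr_eq0 -ltNge mulr_gt0.
apply: eq_integral => z _; rewrite normal_pdfE//; congr EFin.
rewrite /gaussian1 /normal_peak /normal_fun sqr_sqrtr ?mulr_ge0 ?ltW//.
congr (_ * expR _).
  rewrite powRN div1r powR12_sqrt; last by rewrite !mulr_ge0 ?pi_ge0 ?ltW.
  by congr ((Num.sqrt _)^-1); rewrite -mulr_natr; ring.
by rewrite -mulNr -sqrrN opprB; congr (- _ / _); rewrite -mulr_natr; ring.
Qed.

End lebesgue_measure_n_integral.

Section heat_kernel_properties.
Context (R : realType).
Local Notation mu n := (@lebesgue_measure_n R n).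

Lemma sqnorm_subv n (x y : euclidean R n) :
  sqnorm (subv x y) = \sum_(i < n) (tnth x i - tnth y i) ^+ 2.
Proof. by apply: eq_bigr => i _; rewrite tnth_mktuple. Qed.

Lemma sqnorm_subvC n (x y : euclidean R n) :
  sqnorm (subv x y) = sqnorm (subv y x).
Proof.
by rewrite !sqnorm_subv; apply: eq_bigr => i _; rewrite -sqrrN opprB.
Qed.

Lemma sqnorm_ge0 n (x : euclidean R n) : 0 <= sqnorm x.
Proof. by apply: sumr_ge0 => i _; exact: sqr_ge0. Qed.

Definition hker n (t : R) (x y : euclidean R n) : R := heat_kernel t (subv x y).

Lemma heat_kernelC n t (x y : euclidean R n) : hker t x y = hker t y x.
Proof. by rewrite /hker /heat_kernel sqnorm_subvC. Qed.

Lemma heat_kernel_ge0 n t (x y : euclidean R n) : 0 <= hker t x y.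
Proof. by rewrite mulr_ge0 ?powR_ge0 ?expR_ge0. Qed.

Lemma measurable_heat_kernel n (t : R) :
  measurable_fun setT (fun z : euclidean R n * euclidean R n => hker t z.1 z.2).
Proof.
apply: measurable_funM => //; apply: measurableT_comp => //.
apply: measurableT_comp => //; apply: measurable_funM => //.
under eq_fun do rewrite sqnorm_subv.
apply: measurable_sum => i; apply: measurable_funX; apply: measurable_funB.
  exact: measurableT_comp (measurable_tnth i) measurable_fst.
exact: measurableT_comp (measurable_tnth i) measurable_snd.
Qed.

Lemma measurable_heat_kernel2 n (t : R) (x : euclidean R n) :
  measurable_fun setT (hker t x).
Proof. exact: (measurable_fun_pair2 x (@measurable_heat_kernel n t)). Qed.

Lemma heat_kernel_cons n (t : R) (x : euclidean R n.+1) a (y : euclidean R n) :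
  0 < t -> hker t x (tuple_cons (a, y)) =
  gaussian1 t (tnth x ord0 - a) * hker t [tuple of behead x] y.
Proof.
move=> t0; rewrite /hker /heat_kernel /gaussian1 mulrACA -expRD -powRD; last first.
  by apply/implyP => _; rewrite gt_eqF// !mulr_gt0 ?pi_gt0.
congr (_ `^ _ * expR _); first by rewrite -natr1; field.
rewrite !sqnorm_subv big_ord_recl mulrDl opprD; congr (- (_ / _) - _ / _).
apply: eq_bigr => i _; rewrite !(tnth_nth 0)/=; congr ((_ - _) ^+ 2).
by rewrite nth_behead.
Qed.

(** Induction on the dimension, the kernel being a product of one-dimensional ones; on R^0 it is 1
    on a single point of mass 1. *)
Lemma integral_heat_kernel n t (x : euclidean R n) : 0 < t ->
  (\int[mu n]_y (hker t x y)%:E = 1)%E.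
Proof.
move=> t0; elim: n x => [x|n IH x].
  rewrite integral_dirac//; last first.
    by apply/measurable_EFinP; exact: measurable_heat_kernel2.
  rewrite diracT mul1e /hker /heat_kernel mul0r oppr0 powRr0 mul1r.
  by rewrite /sqnorm big_ord0 mul0r oppr0 expR0.
rewrite integral_tuple_cons; last 2 first.
- by apply/measurable_EFinP; exact: measurable_heat_kernel2.
- by move=> y; rewrite lee_fin heat_kernel_ge0.
rewrite -[RHS](integral_gaussian1 (tnth x ord0) t0).
apply: eq_integral => a _.
under eq_integral do rewrite heat_kernel_cons// EFinM.
rewrite ge0_integralZl_EFin ?IH ?mule1//.
- by move=> y _; rewrite lee_fin heat_kernel_ge0.
- by apply/measurable_EFinP; exact: measurable_heat_kernel2.
- by rewrite mulr_ge0 ?powR_ge0 ?expR_ge0.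
Qed.

Lemma heat_kernel_le n t (x y : euclidean R n) : 0 < t ->
  hker t x y <= t `^ (- (n%:R / 2)).
Proof.
move=> t0; rewrite /hker /heat_kernel -[leRHS]mulr1 ler_pM ?powR_ge0 ?expR_ge0//.
  rewrite !powRN lef_pV2 ?posrE ?powR_gt0 ?mulr_gt0 ?pi_gt0//.
  apply: ge0_ler_powR; rewrite ?nnegrE ?mulr_ge0 ?pi_ge0 ?divr_ge0 ?(ltW t0)//.
  by rewrite ler_peMl ?(ltW t0)//; have := @pi_ge2 R; lra.
by rewrite expR_le1 oppr_le0 divr_ge0 ?sqnorm_ge0// mulr_ge0// ltW.
Qed.

(** The Gaussian factor increases with time, so only the prefactors are compared. The ratio tends to
    1 as t' tends to t, which makes this a one-sided substitute for continuity in time. *)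
Lemma heat_kernel_mono n t t' (x y : euclidean R n) : 0 < t -> t <= t' ->
  hker t x y <= (t' / t) `^ (n%:R / 2) * hker t' x y.
Proof.
move=> t0 tt'; have t'0 := lt_le_trans t0 tt'.
rewrite /hker /heat_kernel mulrA ler_pM ?powR_ge0 ?expR_ge0//.
  rewrite !powRN.
  rewrite [(4 * pi * t') `^ _](_ : _ = (t' / t) `^ (n%:R / 2) * (4 * pi * t) `^ (n%:R / 2)).
    rewrite invfM mulrA mulfV ?mul1r// gt_eqF// powR_gt0// divr_gt0//.
  rewrite -powRM ?mulr_ge0 ?pi_ge0 ?invr_ge0 ?ltW//; congr (_ `^ _).
  by field; rewrite gt_eqF.
rewrite ler_expR lerN2 ler_wpM2l ?sqnorm_ge0//.
by rewrite lef_pV2 ?posrE ?mulr_gt0// ler_pM2l.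
Qed.

(* The product of two Gaussians centred at x and z is a Gaussian centred at the
   barycentre (b x + a z) / (a + b). *)
Lemma heat_kernel_mul n a b (x y z : euclidean R n) : 0 < a -> 0 < b ->
  hker a x y * hker b y z =
  hker (a + b) x z * hker (a * b / (a + b))
    [tuple (b * tnth x i + a * tnth z i) / (a + b) | i < n] y.
Proof.
move=> a0 b0; have ab0 : 0 < a + b by rewrite addr_gt0.
have p4 : 0 < 4 * pi :> R by rewrite mulr_gt0 ?pi_gt0.
rewrite /hker /heat_kernel mulrACA [RHS]mulrACA -!expRD.
rewrite -!powRM ?mulr_ge0 ?pi_ge0 ?invr_ge0 ?(ltW ab0) ?(ltW a0) ?(ltW b0)//.
congr (_ `^ _ * expR _); first by field; rewrite gt_eqF.
rewrite !sqnorm_subv !mulr_suml -!sumrN -!big_split/=; apply: eq_bigr => i _.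
by rewrite tnth_mktuple; field; rewrite !gt_eqF.
Qed.

Lemma heat_kernel_semigroup n a b (x z : euclidean R n) : 0 < a -> 0 < b ->
  (\int[mu n]_y (hker a x y * hker b y z)%:E = (hker (a + b) x z)%:E)%E.
Proof.
move=> a0 b0; under eq_integral do rewrite heat_kernel_mul// EFinM.
rewrite ge0_integralZl_EFin ?heat_kernel_ge0//; last 2 first.
- by move=> y _; rewrite lee_fin heat_kernel_ge0.
- by apply/measurable_EFinP; exact: measurable_heat_kernel2.
by rewrite integral_heat_kernel ?mule1// divr_gt0 ?mulr_gt0 ?addr_gt0.
Qed.

End heat_kernel_properties.

(** * Algebra and estimates of the heat semigroup on nonnegative functions *)

Section heat_semigroup_properties.
Context (R : realType) (n : nat).
Local Notation E := (euclidean R n).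
Local Notation mu := (@lebesgue_measure_n R n).
Implicit Types (g h : E -> R) (x y z : E) (t : R).

Lemma measurable_kernelM t x g : measurable_fun setT g ->
  measurable_fun setT (fun y => (hker t x y * g y)%:E).
Proof.
move=> mg; apply/measurable_EFinP; apply: measurable_funM => //.
exact: measurable_heat_kernel2.
Qed.

Lemma kernelM_ge0 t x g y : (forall y, 0 <= g y) -> (0 <= (hker t x y * g y)%:E)%E.
Proof. by move=> g0; rewrite lee_fin mulr_ge0// heat_kernel_ge0. Qed.

Lemma heat_ge0 t g x : (forall y, 0 <= g y) -> (0 <= heat_semigroup t g x)%E.
Proof. by move=> g0; apply: integral_ge0 => y _; exact: kernelM_ge0. Qed.

Lemma measurable_kernel_pair t g : measurable_fun setT g ->
  measurable_fun setT (fun z : E * E => (hker t z.1 z.2 * g z.2)%:E).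
Proof.
move=> mg; apply/measurable_EFinP; apply: measurable_funM.
  exact: measurable_heat_kernel.
exact: measurableT_comp mg measurable_snd.
Qed.

Lemma measurable_heat t g : measurable_fun setT g -> (forall y, 0 <= g y) ->
  measurable_fun setT (heat_semigroup t g).
Proof.
move=> mg g0.
apply: (measurable_fun_fubini_tonelli_F (m2 := mu) _ (measurable_kernel_pair t mg)).
by move=> z; exact: kernelM_ge0.
Qed.

Lemma le_heat t g h x : (forall y, g y <= h y) ->
  (heat_semigroup t g x <= heat_semigroup t h x)%E.
Proof.
move=> gh; apply: le_integral_nonmeasurable => y _.
by rewrite lee_fin ler_wpM2l// heat_kernel_ge0.
Qed.

Lemma eq_heat t g h x : g =1 h -> heat_semigroup t g x = heat_semigroup t h x.
Proof. by move=> gh; apply: eq_integral => y _; rewrite gh. Qed.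

Lemma ae_le_heat t g h x : measurable_fun setT g -> measurable_fun setT h ->
  (forall y, 0 <= g y) -> (forall y, 0 <= h y) ->
  {ae mu, forall y, g y <= h y} -> (heat_semigroup t g x <= heat_semigroup t h x)%E.
Proof.
move=> mg mh g0 h0 gh; apply: ae_ge0_le_integral => //.
- by move=> y _; exact: kernelM_ge0.
- exact: measurable_kernelM.
- by move=> y _; exact: kernelM_ge0.
- exact: measurable_kernelM.
by apply: filterS gh => y gh _; rewrite lee_fin ler_wpM2l// heat_kernel_ge0.
Qed.

Lemma heatD t g h x : measurable_fun setT g -> measurable_fun setT h ->
  (forall y, 0 <= g y) -> (forall y, 0 <= h y) ->
  heat_semigroup t (g \+ h) x = (heat_semigroup t g x + heat_semigroup t h x)%E.
Proof.
move=> mg mh g0 h0; rewrite /heat_semigroup -ge0_integralD//.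
- by apply: eq_integral => y _; rewrite /= mulrDr EFinD.
- by move=> y _; exact: kernelM_ge0.
- exact: measurable_kernelM.
- by move=> y _; exact: kernelM_ge0.
- exact: measurable_kernelM.
Qed.

Lemma heatZ t g x c : measurable_fun setT g -> (forall y, 0 <= g y) -> 0 <= c ->
  heat_semigroup t (fun y => c * g y) x = (c%:E * heat_semigroup t g x)%E.
Proof.
move=> mg g0 c0; rewrite /heat_semigroup -ge0_integralZl_EFin//.
- by apply: eq_integral => y _; rewrite mulrCA EFinM.
- by move=> y _; exact: kernelM_ge0.
- exact: measurable_kernelM.
Qed.

Lemma heat_cst t x c : 0 < t -> 0 <= c -> heat_semigroup t (cst c : E -> R) x = c%:E.
Proof.
move=> t0 c0; rewrite /heat_semigroup -[RHS]mule1 -(integral_heat_kernel x t0).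
rewrite -ge0_integralZl_EFin//.
- by apply: eq_integral => y _; rewrite /= mulrC EFinM.
- by move=> y _; rewrite lee_fin heat_kernel_ge0.
- by apply/measurable_EFinP; exact: measurable_heat_kernel2.
Qed.

Lemma heat_semigroupD a b g x : 0 < a -> 0 < b ->
  measurable_fun setT g -> (forall y, 0 <= g y) ->
  (\int[mu]_y ((hker a x y)%:E * heat_semigroup b g y) = heat_semigroup (a + b) g x)%E.
Proof.
move=> a0 b0 mg g0.
have pull y : ((hker a x y)%:E * heat_semigroup b g y =
    \int[mu]_z (hker a x y * (hker b y z * g z))%:E)%E.
  rewrite /heat_semigroup -ge0_integralZl_EFin//.
  - by move=> z _; exact: kernelM_ge0.
  - exact: measurable_kernelM.
  - exact: heat_kernel_ge0.
under eq_integral do rewrite pull.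
pose F (p : E * E) := (hker a x p.1 * (hker b p.1 p.2 * g p.2))%:E.
have mF : measurable_fun setT F.
  apply/measurable_EFinP; apply: measurable_funM.
    exact: (measurableT_comp (@measurable_heat_kernel2 R n a x) measurable_fst).
  by have /measurable_EFinP := measurable_kernel_pair b mg.
rewrite (fubini_tonelli F)//; last first.
  move=> p; rewrite /F lee_fin; apply: mulr_ge0; first exact: heat_kernel_ge0.
  by apply: mulr_ge0; first exact: heat_kernel_ge0.
apply: eq_integral => z _; rewrite /F/=.
under eq_integral do rewrite mulrA mulrC EFinM.
rewrite ge0_integralZl_EFin//.
- by rewrite heat_kernel_semigroup// -EFinM mulrC.
- by move=> y _; rewrite lee_fin mulr_ge0 ?heat_kernel_ge0.
- apply/measurable_EFinP; apply: measurable_funM.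
    exact: measurable_heat_kernel2.
  exact: (measurable_fun_pair1 z (@measurable_heat_kernel R n b)).
Qed.

Lemma integral_heat t g : 0 < t -> measurable_fun setT g -> (forall y, 0 <= g y) ->
  (\int[mu]_x heat_semigroup t g x = \int[mu]_x (g x)%:E)%E.
Proof.
move=> t0 mg g0.
rewrite (fubini_tonelli (fun p : E * E => (hker t p.1 p.2 * g p.2)%:E))/=; last 2 first.
- exact: measurable_kernel_pair.
- by move=> p; exact: kernelM_ge0.
apply: eq_integral => y _.
under eq_integral do rewrite mulrC EFinM.
rewrite ge0_integralZl_EFin//.
- under eq_integral do rewrite heat_kernelC.
  by rewrite integral_heat_kernel// mule1.
- by move=> x _; rewrite lee_fin heat_kernel_ge0.
- apply/measurable_EFinP.
  exact: (measurable_fun_pair1 y (@measurable_heat_kernel R n t)).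
Qed.

Lemma heat_le_integral t g x : 0 < t -> measurable_fun setT g -> (forall y, 0 <= g y) ->
  (heat_semigroup t g x <= (t `^ (- (n%:R / 2)))%:E * \int[mu]_y (g y)%:E)%E.
Proof.
move=> t0 mg g0; rewrite -ge0_integralZl_EFin ?powR_ge0//.
- apply: le_integral_nonmeasurable => y _.
  by rewrite -EFinM lee_fin ler_wpM2r// heat_kernel_le.
- by move=> y _; rewrite lee_fin.
- exact/measurable_EFinP.
Qed.

Lemma heat_mono_time t t' g x : 0 < t -> t <= t' ->
  measurable_fun setT g -> (forall y, 0 <= g y) ->
  (heat_semigroup t g x <= ((t' / t) `^ (n%:R / 2))%:E * heat_semigroup t' g x)%E.
Proof.
move=> t0 tt' mg g0; rewrite -ge0_integralZl_EFin ?powR_ge0//.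
- apply: le_integral_nonmeasurable => y _.
  by rewrite -EFinM lee_fin mulrA ler_wpM2r// heat_kernel_mono.
- by move=> y _; exact: kernelM_ge0.
- exact: measurable_kernelM.
Qed.

Lemma heat_jensen_pow t g x r : 0 < t -> measurable_fun setT g ->
  (forall y, 0 <= g y) -> 1 <= r ->
  ((heat_semigroup t g x) `^ r <= heat_semigroup t (fun y => g y `^ r)%R x)%E.
Proof.
move=> t0 mg g0 r1; apply: weighted_jensen_pow => //.
- exact: measurable_heat_kernel2.
- by move=> y; exact: heat_kernel_ge0.
- by rewrite integral_heat_kernel.
Qed.

Lemma heat_jensen t g x r : 0 < t -> measurable_fun setT g ->
  (forall y, 0 <= g y) -> 1 <= r ->
  (heat_semigroup t g x <= (heat_semigroup t (fun y => g y `^ r)%R x) `^ r^-1)%E.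
Proof.
move=> t0 mg g0 r1; apply: weighted_jensen => //.
- exact: measurable_heat_kernel2.
- by move=> y; exact: heat_kernel_ge0.
- by rewrite integral_heat_kernel.
Qed.

Lemma heat_hoelder t g h x p q : measurable_fun setT g -> measurable_fun setT h ->
  (forall y, 0 <= g y) -> (forall y, 0 <= h y) ->
  0 < p -> 0 < q -> p^-1 + q^-1 = 1 ->
  (heat_semigroup t (g \* h)%R x <=
   (heat_semigroup t (fun y => g y `^ p)%R x) `^ p^-1 *
   (heat_semigroup t (fun y => h y `^ q)%R x) `^ q^-1)%E.
Proof.
move=> mg mh g0 h0 p0 q0 pq; apply: weighted_hoelder => //.
- exact: measurable_heat_kernel2.
- by move=> y; exact: heat_kernel_ge0.
Qed.

End heat_semigroup_properties.

(** * Paths bounded in L^2 *)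

Section limn_einf_bounds.
Context (R : realType).
Implicit Types (v : (\bar R)^nat) (c : \bar R).

Lemma limn_einf_le v c : (\forall k \near \oo, v k <= c)%E -> (limn_einf v <= c)%E.
Proof.
move=> [K _ vc]; rewrite limn_einf_lim; apply: lime_le; first exact: is_cvg_einfs.
apply: nearW => m; apply: (@le_trans _ _ (v (maxn m K))).
  by apply: ereal_inf_lbound; exists (maxn m K) => //=; rewrite leq_maxl.
by apply: vc => /=; rewrite leq_maxr.
Qed.

Lemma limn_einf_ge v c : (\forall k \near \oo, c <= v k)%E -> (c <= limn_einf v)%E.
Proof.
move=> [K _ vc]; rewrite limn_einf_lim; apply: lime_ge; first exact: is_cvg_einfs.
exists K => // m /= Km; apply: le_ereal_inf_tmp => _ [k /= mk <-].
by apply: vc => /=; exact: leq_trans mk.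
Qed.

Lemma limn_einfZ_le v (c : R) : 0 <= c -> (forall k, 0 <= v k)%E ->
  (c%:E * limn_einf v <= limn_einf (fun k => c%:E * v k))%E.
Proof.
move=> c0 v0; rewrite !limn_einf_lim -limeMl//; last exact: is_cvg_einfs.
apply: lee_lim; [by apply: is_cvgeZl => //; exact: is_cvg_einfs|exact: is_cvg_einfs|].
apply: nearW => m; apply: le_ereal_inf_tmp => _ [k /= mk <-].
by apply: lee_wpmul2l; rewrite ?lee_fin//; apply: ereal_inf_lbound; exists k.
Qed.

Lemma measurable_fun_limn_einf d (T : measurableType d) (f : (T -> \bar R)^nat) :
  (forall k, measurable_fun setT (f k)) ->
  measurable_fun setT (fun x => limn_einf (f ^~ x)).
Proof.
move=> mf; rewrite /limn_einf; apply: (measurableT_comp (@oppe_measurable R setT)).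
apply: (@measurable_fun_limn_esup _ _ _ setT (fun k x => - f k x)%E) => k.
exact: measurableT_comp.
Qed.

End limn_einf_bounds.

Section power_inequalities.
Context (R : realType).
Implicit Types a b c t : R.

Lemma powR_gt1 a b : 1 < a -> 0 < b -> 1 < a `^ b.
Proof.
move=> a1 b0; rewrite -[ltLHS](powRr0 a) /powR gt_eqF ?(lt_trans ltr01)//.
by rewrite ltr_expR ltr_pM2r// ln_gt0.
Qed.

Lemma powR_le1Dsqr a b : 0 <= a -> 1 <= b <= 2 -> a `^ b <= 1 + a ^+ 2.
Proof.
move=> a0 /andP[b1 b2]; have b0 : 0 <= b by rewrite (le_trans _ b1).
have [a1|a1] := leP a 1.
  apply: (@le_trans _ _ 1); last by rewrite lerDl sqr_ge0.
  have -> : 1 = 1 `^ b :> R by rewrite powR1.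
  by rewrite ge0_ler_powR// nnegrE.
apply: (@le_trans _ _ (a ^+ 2)); last by rewrite lerDr.
by rewrite -powR_mulrn// ler_powR// ltW.
Qed.

(* Either a is at most (1 + t)^(1/b) c, or a is small, or a - c dominates a,
   hence a^b since b <= 2. *)
Lemma powR_perturb b t : 1 <= b <= 2 -> 0 < t ->
  exists2 C : R, 0 <= C & forall a c, 0 <= a -> 0 <= c ->
    a `^ b <= (1 + t) * c `^ b + (C * (a - c) ^+ 2 + t).
Proof.
move=> /andP[b1 b2] t0; have b0 : 0 < b by rewrite (lt_le_trans _ b1).
pose r := (1 + t) `^ b^-1; pose m := t `^ b^-1; pose k := 1 - r^-1.
have t1 : 1 < 1 + t by rewrite ltrDl.
have r1 : 1 < r by rewrite powR_gt1 ?invr_gt0 ?ltrDl.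
have r0 : 0 < r by rewrite (lt_trans _ r1).
have k0 : 0 < k by rewrite subr_gt0 invf_lt1.
have m0 : 0 < m by rewrite powR_gt0.
have mb : m `^ b = t by rewrite -powRrM mulVf ?gt_eqF// powRr1// ltW.
have rb : r `^ b = 1 + t by rewrite -powRrM mulVf ?gt_eqF// powRr1// addr_ge0 ?ltW.
(* In the last case a > m and a > r c, so a - c >= k a and a^b = t (a/m)^b <= t (a/m)^2 <= t ((a -
   c) / (m k))^2. *)
exists (t / (m * k) ^+ 2); first by rewrite divr_ge0 ?sqr_ge0 ?ltW.
move=> a c a0 c0.
have cb : 0 <= (1 + t) * c `^ b by rewrite mulr_ge0 ?powR_ge0 ?addr_ge0 ?ltW.
have sq : 0 <= t / (m * k) ^+ 2 * (a - c) ^+ 2.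
  by rewrite mulr_ge0 ?sqr_ge0// divr_ge0 ?sqr_ge0 ?ltW.
have [arc|rca] := leP a (r * c).
  apply: (@le_trans _ _ ((1 + t) * c `^ b)); last by rewrite lerDl addr_ge0// ltW.
  by rewrite -rb -powRM ?(ltW r0)// ge0_ler_powR ?nnegrE ?mulr_ge0 ?(ltW r0) ?(ltW b0).
have [am|ma] := leP a m.
  apply: (@le_trans _ _ t); last by rewrite addrA lerDr addr_ge0.
  by rewrite -mb ge0_ler_powR ?nnegrE ?(ltW b0) ?(ltW m0).
apply: (@le_trans _ _ (t / (m * k) ^+ 2 * (a - c) ^+ 2)); last first.
  by rewrite addrCA lerDl addr_ge0// ltW.
have am1 : 1 <= a / m by rewrite ler_pdivlMr// mul1r ltW.
have -> : a `^ b = t * (a / m) `^ b.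
  by rewrite -{1}mb -powRM ?divr_ge0 ?(ltW m0)// mulrC divfK ?gt_eqF.
rewrite -mulrA ler_pM2l//.
apply: (@le_trans _ _ ((a / m) ^+ 2)).
  by rewrite -powR_mulrn ?divr_ge0 ?(ltW m0)// ler_powR.
have ak : a * k <= a - c.
  by rewrite mulrBr mulr1 lerB// ler_pdivlMr// mulrC ltW.
rewrite [leRHS]mulrC -exprVn -exprMn ler_sqr ?nnegrE ?(le_trans ler01 am1)//; last first.
  rewrite mulr_ge0 ?invr_ge0 ?mulr_ge0 ?(ltW m0) ?(ltW k0)//.
  by rewrite (le_trans _ ak)// mulr_ge0 ?(ltW k0).
by rewrite ler_pdivlMr ?mulr_gt0// mulrA divfK ?gt_eqF.
Qed.

End power_inequalities.

(** Squares suffice for all exponents b in [1, 2]: |u|^b <= 1 + u^2 gives finiteness, and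
    [powR_perturb] controls the variation of |u|^b by a squared difference. *)
Record bounded_L2_path (R : realType) (n : nat) (u : R -> euclidean R n -> R)
    (L : R) : Prop := BoundedL2Path {
  path_measurable : forall t, 0 < t -> measurable_fun setT (u t) ;
  path_bound : forall t, 0 < t ->
    (\int[lebesgue_measure_n n]_x ((u t x) ^+ 2)%:E <= L%:E)%E ;
  path_continuous : forall t : R, 0 < t -> forall e, 0 < e ->
    \forall s \near t,
      (\int[lebesgue_measure_n n]_x ((u s x - u t x) ^+ 2)%:E <= e%:E)%E }.

Section path_powers.
Context (R : realType) (n : nat).
Local Notation E := (euclidean R n).
Local Notation mu := (@lebesgue_measure_n R n).
Implicit Types (s t tau e : R) (x y : E).
Variables (u : R -> E -> R) (L b : R).
Hypothesis n0 : (0 < n)%N.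
Hypothesis b12 : 1 <= b <= 2.
Hypothesis up : bounded_L2_path u L.

Let mu_u := path_measurable up.
Let u_L2 := path_bound up.
Let u_cont := path_continuous up.
Let ub t x := `|u t x| `^ b.
Let b0 : 0 < b. Proof. by case/andP: b12 => b1 _; rewrite (lt_le_trans _ b1). Qed.
Let b1 : 1 <= b. Proof. by case/andP: b12. Qed.

Let L0 : 0 <= L.
Proof.
rewrite -lee_fin; apply: le_trans (u_L2 ltr01).
by apply: integral_ge0 => x _; rewrite lee_fin sqr_ge0.
Qed.

Let mub t : 0 < t -> measurable_fun setT (ub t).
Proof.
by move=> t0; apply: measurable_powR_comp; apply: measurableT_comp => //; exact: mu_u.
Qed.

Let ub0 t x : 0 <= ub t x. Proof. exact: powR_ge0. Qed.

Lemma heat_pow_bound tau s x : 0 < tau -> 0 < s ->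
  (heat_semigroup tau (ub s) x <= (1 + tau `^ (- (n%:R / 2)) * L)%:E)%E.
Proof.
move=> tau0 s0.
have ms : measurable_fun setT (fun y => u s y ^+ 2).
  by apply: measurable_funX; exact: mu_u.
apply: (@le_trans _ _ (heat_semigroup tau ((cst 1 : E -> R) \+ (fun y => u s y ^+ 2)) x)).
  apply: le_heat => y /=; rewrite -[u s y ^+ 2]real_normK ?num_real//.
  exact: powR_le1Dsqr.
rewrite heatD//; last by move=> y; exact: sqr_ge0.
rewrite heat_cst// EFinD leeD2l//.
apply: le_trans (heat_le_integral _ tau0 ms _) _; first by move=> y; exact: sqr_ge0.
by rewrite EFinM lee_wpmul2l ?lee_fin ?powR_ge0//; exact: u_L2.
Qed.

(** Lower semicontinuity from the left. [heat_kernel_mono] replaces [t - s] by the larger [t - s']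
    at the cost of a factor close to 1, and [powR_perturb] replaces [u s] by [u s']: the squared
    difference is small in L^1, hence pointwise small after the heat flow. *)
Lemma heat_pow_lsc t s x e : 0 < s < t -> 0 < e ->
  \forall s' \near s, s' <= s -> 0 < s' ->
    (heat_semigroup (t - s) (ub s) x <= heat_semigroup (t - s') (ub s') x + e%:E)%E.
Proof.
move=> /andP[s0 st] e0; have ts : 0 < t - s by rewrite subr_gt0.
pose B := 1 + (t - s) `^ (- (n%:R / 2)) * L.
have B0 : 0 < B by rewrite ltr_wpDr// mulr_ge0// powR_ge0.
(* With [h <= B] the value at [s'], the final bound is (1 + th) ((1 + th) h + 2 th), which exceeds h
   by at most th (3 B + 4) since th <= 1. *)
pose th := Num.min 1 (e / (3 * B + 4)).
have th0 : 0 < th by rewrite lt_min ltr01 divr_gt0// addr_gt0// mulr_gt0.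
have th1 : th <= 1 by rewrite ge_min lexx.
have the : th * (3 * B + 4) <= e.
  by rewrite -ler_pdivlMr ?ge_min ?lexx ?orbT// addr_gt0// mulr_gt0.
have [C C0 HC] := powR_perturb b12 th0.
pose c := C * (t - s) `^ (- (n%:R / 2)).
have c0 : 0 <= c by rewrite mulr_ge0// powR_ge0.
have d0 : 0 < th / (c + 1) by rewrite divr_gt0// ltr_wpDl.
(* Solves ((t - s + r) / (t - s))^(n/2) = 1 + th, the largest admissible ratio in
   [heat_kernel_mono]. *)
pose r := (t - s) * ((1 + th) `^ (2 / n%:R) - 1).
have r0 : 0 < r.
  by rewrite mulr_gt0// subr_gt0 powR_gt1 ?divr_gt0 ?ltr0n ?ltrDl.
have near_r : \forall s' \near s, s - r < s'.
  by apply: lt_nbhsr; rewrite ltrBlDr ltrDl.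
near=> s' => s's s'0.
have rs' : s - r < s' by near: s'.
have ds' : (\int[mu]_x ((u s' x - u s x) ^+ 2)%:E <= (th / (c + 1))%:E)%E.
  by near: s'; exact: u_cont.
have ts' : 0 < t - s' by rewrite subr_gt0 (le_lt_trans s's).
have tss' : t - s <= t - s' by rewrite lerB.
pose d y := (u s' y - u s y) ^+ 2.
have md : measurable_fun setT d.
  by apply: measurable_funX; apply: measurable_funB; exact: mu_u.
have dd0 y : 0 <= d y by exact: sqr_ge0.
have h0 : (0 <= heat_semigroup (t - s') (ub s') x)%E by exact: heat_ge0.
have hB : (heat_semigroup (t - s') (ub s') x <= B%:E)%E.
  apply: le_trans (heat_pow_bound x ts' s'0) _.
  rewrite lee_fin lerD2l ler_wpM2r// !powRN lef_pV2 ?posrE ?powR_gt0//.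
  by apply: ge0_ler_powR; rewrite ?nnegrE ?divr_ge0 ?ler0n ?(ltW ts) ?(ltW ts').
have ratio : ((t - s') / (t - s)) `^ (n%:R / 2) <= 1 + th.
  have -> : 1 + th = ((1 + th) `^ (2 / n%:R)) `^ (n%:R / 2).
    rewrite -powRrM (_ : 2 / n%:R * (n%:R / 2) = 1).
      by rewrite powRr1// addr_ge0 ?ltW.
    by field; rewrite pnatr_eq0 -lt0n.
  apply: ge0_ler_powR; rewrite ?nnegrE ?powR_ge0 ?divr_ge0 ?ler0n ?(ltW ts) ?(ltW ts')//.
  rewrite ler_pdivrMr//; move: rs'; rewrite /r; lra.
have hd : (heat_semigroup (t - s') d x <=
    ((t - s) `^ (- (n%:R / 2)) * (th / (c + 1)))%:E)%E.
  apply: le_trans (heat_le_integral x ts' md dd0) _.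
  rewrite EFinM; apply: lee_pmul => //.
  - by rewrite lee_fin powR_ge0.
  - by apply: integral_ge0 => y _; rewrite lee_fin.
  rewrite lee_fin !powRN lef_pV2 ?posrE ?powR_gt0//.
  by apply: ge0_ler_powR; rewrite ?nnegrE ?divr_ge0 ?ler0n ?(ltW ts) ?(ltW ts').
have step1 := heat_mono_time x ts tss' (mub s0) (ub0 s).
have step2 : (heat_semigroup (t - s') (ub s) x <=
    (1 + th)%:E * heat_semigroup (t - s') (ub s') x +
    (C%:E * heat_semigroup (t - s') d x + th%:E))%E.
  have th1_0 : 0 <= 1 + th by rewrite addr_ge0// ltW.
  have mub' := mub s'0.
  have m1 : measurable_fun setT (fun y => (1 + th) * ub s' y) by exact: measurable_funM.
  have m2 : measurable_fun setT (fun y => C * d y) by exact: measurable_funM.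
  have m3 : measurable_fun setT ((fun y => C * d y) \+ cst th) by exact: measurable_funD.
  have p1 y : 0 <= (1 + th) * ub s' y by rewrite mulr_ge0.
  have p2 y : 0 <= C * d y by rewrite mulr_ge0.
  have p3 y : 0 <= ((fun y => C * d y) \+ cst th) y by rewrite /= addr_ge0// ltW.
  have p4 y : 0 <= (cst th : E -> R) y by exact: ltW.
  rewrite -(heatZ _ _ mub')// -(heatZ _ _ md)// -(heat_cst x ts' (ltW th0)) -!heatD//.
  apply: le_heat => y /=; apply: le_trans (HC `|u s y| `|u s' y| _ _) _ => //.
    rewrite lerD2l lerD2r ler_wpM2l// /d -[leLHS]real_normK ?num_real//.
    rewrite -[leRHS]real_normK ?num_real// ler_sqr ?nnegrE//.
    by rewrite -(normrN (u s' y - _)) opprB; exact: ler_dist_dist.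
have [h hE] : exists h : R, heat_semigroup (t - s') (ub s') x = h%:E.
  exists (fine (heat_semigroup (t - s') (ub s') x)); rewrite fineK//.
  by rewrite ge0_fin_numE// (le_lt_trans hB)// ltry.
rewrite hE in h0 hB step2 *; rewrite !lee_fin in h0 hB.
have step3 : (heat_semigroup (t - s') (ub s) x <= ((1 + th) * h + (th + th))%:E)%E.
  apply: le_trans step2 _; rewrite -EFinM EFinD leeD2l// EFinD leeD2r//.
  apply: le_trans (lee_wpmul2l _ hd) _; rewrite ?lee_fin// mulrA -/c.
  by rewrite mulrCA ger_pMr// ler_pdivrMr ?mul1r ?lerDl// ltr_wpDl.
apply: le_trans step1 _.
apply: le_trans (lee_wpmul2l _ step3) _; first by rewrite lee_fin powR_ge0.
rewrite -EFinM -EFinD lee_fin.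
apply: (@le_trans _ _ ((1 + th) * ((1 + th) * h + (th + th)))).
  apply: ler_wpM2r => //; have th0' := ltW th0.
  by rewrite addr_ge0 ?mulr_ge0 ?addr_ge0.
have -> : (1 + th) * ((1 + th) * h + (th + th)) =
  h + th * (2 * h + th * h + 2 + 2 * th) by ring.
rewrite lerD2l; apply: le_trans the; rewrite ler_pM2l//.
have : th * h <= B by rewrite (le_trans _ hB)// ler_piMl.
lra.
Unshelve. all: by end_near. Qed.

End path_powers.

(** * A jointly measurable majorant by sampling in time *)

Section time_discretization.
Context (R : realType) (n : nat).
Local Notation E := (euclidean R n).
Local Notation mu := (@lebesgue_measure_n R n).
Implicit Types (s t tau e : R) (x y : E).
Variables (u : R -> E -> R) (L b : R).
Hypothesis n0 : (0 < n)%N.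
Hypothesis b12 : 1 <= b <= 2.
Hypothesis up : bounded_L2_path u L.

Let ub t x := `|u t x| `^ b.

Let mub t : 0 < t -> measurable_fun setT (ub t).
Proof.
move=> t0; apply: measurable_powR_comp; apply: measurableT_comp => //.
exact: path_measurable up _ t0.
Qed.

Let ub0 t x : 0 <= ub t x. Proof. exact: powR_ge0. Qed.

Let L0 : 0 <= L.
Proof.
rewrite -lee_fin; apply: le_trans (path_bound up ltr01).
by apply: integral_ge0 => x _; rewrite lee_fin sqr_ge0.
Qed.

(** Rounding down makes the grid points approach [s] from the left, the side on which [heat_pow_lsc]
    applies. *)
Definition grid (k : nat) s : R := (Num.truncn (s * k.+1%:R))%:R / k.+1%:R.

Lemma grid_le k s : 0 <= s -> grid k s <= s.
Proof.
by move=> s0; rewrite /grid ler_pdivrMr// truncn_le mulr_ge0.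
Qed.

Lemma grid_gt k s : 0 <= s -> s - k.+1%:R^-1 < grid k s.
Proof.
move=> s0; rewrite /grid ltr_pdivlMr// mulrBl mulVf// ltrBlDr natr1.
exact: truncnS_gt.
Qed.

Lemma cvg_grid s : 0 < s -> grid k s @[k --> \oo] --> s.
Proof.
move=> s0; apply: (@squeeze_cvgr _ _ _ _ (fun k => s - k.+1%:R^-1) (fun=> s)).
- by apply: nearW => k; rewrite grid_le ?ltW// grid_gt// ltW.
- rewrite -[X in _ --> X]subr0; apply: cvgB; first exact: cvg_cst.
  exact: cvg_harmonic.
- exact: cvg_cst.
Qed.

(* Sampling at grid points makes the function jointly measurable in (s, x),
   although s |-> u s is only continuous into L^2. *)
Definition sampled_heat t k (z : measurableTypeR R * E) : \bar R :=
  if Num.truncn (z.1 * k.+1%:R) is j.+1 then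
    heat_semigroup (t - j.+1%:R / k.+1%:R) (ub (j.+1%:R / k.+1%:R)) z.2
  else 0%E.

Lemma sampled_heat_ge0 t k z : (0 <= sampled_heat t k z)%E.
Proof. by rewrite /sampled_heat; case: Num.truncn => // j; exact: heat_ge0. Qed.

(** On each of the countably many strips where the truncation equals [j] the sampling time is
    frozen, and only measurability in [x] is at stake. *)
Lemma measurable_sampled_heat t k : measurable_fun setT (sampled_heat t k).
Proof.
pose D j : set (measurableTypeR R * E) := [set z | Num.truncn (z.1 * k.+1%:R) = j].
have DT : \bigcup_j D j = setT.
  by apply/seteqP; split => // z _; exists (Num.truncn (z.1 * k.+1%:R)).
have mT : measurable_fun setT (fun s : measurableTypeR R => (Num.truncn (s * k.+1%:R))%:R : R).
  apply: nondecreasing_measurable => // s s' ss'.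
  by rewrite ler_nat le_truncn// ler_wpM2r.
have mD j : measurable (D j).
  rewrite (_ : D j = (fun z => (Num.truncn (z.1 * k.+1%:R))%:R : R) @^-1` [set j%:R]).
    rewrite -[X in measurable X]setTI.
    by apply: (measurableT_comp mT measurable_fst) => //; exact: measurable_set1.
  apply/seteqP; split => z /=; first by move=> ->.
  by move/eqP; rewrite eqr_nat => /eqP.
rewrite -DT; apply/measurable_fun_bigcup => // -[|j].
  apply: (@eq_measurable_fun _ _ _ _ _ (cst 0%E)); last exact: measurable_cst.
  by move=> z; rewrite inE /D /sampled_heat /= => ->.
apply: (@eq_measurable_fun _ _ _ _ _
    (heat_semigroup (t - j.+1%:R / k.+1%:R) (ub (j.+1%:R / k.+1%:R)) \o snd)).
  by move=> z; rewrite inE /D /sampled_heat /= => ->.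
apply: measurable_funTS; apply: measurableT_comp => //.
by apply: measurable_heat => //; apply: mub; rewrite divr_gt0.
Qed.

Lemma sampled_heatE t k s x : 0 < grid k s ->
  sampled_heat t k (s, x) = heat_semigroup (t - grid k s) (ub (grid k s)) x.
Proof.
by rewrite /sampled_heat /grid /=; case: Num.truncn => //; rewrite mul0r ltxx.
Qed.

(** Nothing is known of [u] at time 0, so the grid point 0 receives the default value 0. This is
    harmless in upper bounds, and for fixed s > 0 it happens for finitely many [k] only. *)
Lemma sampled_heat_eq0 t k s x : grid k s <= 0 -> sampled_heat t k (s, x) = 0%E.
Proof.
rewrite /sampled_heat /grid /=; case: Num.truncn => // j.
by rewrite leNgt divr_gt0.
Qed.

Lemma sampled_heat_bound t k s x : 0 < s < t ->
  (sampled_heat t k (s, x) <= (1 + (t - s) `^ (- (n%:R / 2)) * L)%:E)%E.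
Proof.
move=> /andP[s0 st]; have ts : 0 < t - s by rewrite subr_gt0.
have [g0|g0] := leP (grid k s) 0.
  by rewrite sampled_heat_eq0// lee_fin addr_ge0// mulr_ge0// powR_ge0.
have gs := grid_le k (ltW s0).
have ts' : 0 < t - grid k s by rewrite subr_gt0 (le_lt_trans gs).
rewrite sampled_heatE//; apply: le_trans (heat_pow_bound b12 up x ts' g0) _.
rewrite lee_fin lerD2l ler_wpM2r// !powRN lef_pV2 ?posrE ?powR_gt0//.
by apply: ge0_ler_powR; rewrite ?nnegrE ?divr_ge0 ?ler0n ?(ltW ts) ?(ltW ts')// lerB.
Qed.

(** Of the possible limits the lower one is right twice: lower semicontinuity makes it a majorant,
    and Fatou's lemma passes to it the bounds that hold at grid points. [fine] loses nothing for 0 <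
    s < t, where it is finite. *)
Definition majorant t s x : R := fine (limn_einf (fun k => sampled_heat t k (s, x))).

Lemma majorantE t s x : 0 < s < t ->
  (majorant t s x)%:E = limn_einf (fun k => sampled_heat t k (s, x)).
Proof.
move=> st; rewrite /majorant fineK// ge0_fin_numE.
  apply: (@le_lt_trans _ _ (1 + (t - s) `^ (- (n%:R / 2)) * L)%:E); last exact: ltry.
  by apply: limn_einf_le; apply: nearW => k; exact: sampled_heat_bound.
by apply: limn_einf_ge; apply: nearW => k; exact: sampled_heat_ge0.
Qed.

Lemma majorant_ge0 t s x : 0 <= majorant t s x.
Proof.
apply: fine_ge0; apply: limn_einf_ge; apply: nearW => k; exact: sampled_heat_ge0.
Qed.

Lemma measurable_majorant t :
  measurable_fun setT (fun z : measurableTypeR R * E => majorant t z.1 z.2).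
Proof.
apply: measurableT_comp => //.
rewrite (_ : (fun _ => _) = fun z => limn_einf (fun k => sampled_heat t k z)).
  by apply: measurable_fun_limn_einf => k; exact: measurable_sampled_heat.
by apply/funext => -[].
Qed.

Lemma heat_pow_le_majorant t s x : 0 < s < t ->
  (heat_semigroup (t - s) (ub s) x <= (majorant t s x)%:E)%E.
Proof.
move=> st; have /andP[s0 _] := st; rewrite majorantE//.
apply/lee_addgt0Pr => e e0; rewrite -leeBlDr//.
apply: limn_einf_ge; near=> k; rewrite leeBlDr//.
have g0 : 0 < grid k s.
  by near: k; exact: (cvgr_gt _ (cvg_grid s0)).
rewrite sampled_heatE//.
move: (grid_le k (ltW s0)) g0; near: k.
have lsc := cvg_grid s0 (heat_pow_lsc n0 b12 up x st e0); exact: lsc.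
Unshelve. all: by end_near. Qed.

(** By Fatou's lemma it is enough to bound the samples; at a grid point g <= s < t the semigroup law
    combines the times A - t and t - g into A - g. *)
Lemma integral_majorant t s x0 A (S : \bar R) : 0 < s < t -> t < A -> (0 <= S)%E ->
  (forall s', 0 < s' <= t -> (heat_semigroup (A - s') (ub s') x0 <= S)%E) ->
  (\int[mu]_x (hker (A - t) x0 x * majorant t s x)%:E <= S)%E.
Proof.
move=> st tA S0 HS; have /andP[s0 st'] := st.
have At : 0 < A - t by rewrite subr_gt0.
have mF k : measurable_fun setT (fun x => ((hker (A - t) x0 x)%:E * sampled_heat t k (s, x))%E).
  apply: emeasurable_funM.
    by apply/measurable_EFinP; exact: measurable_heat_kernel2.
  exact: (measurable_fun_pair2 _ (measurable_sampled_heat t k)).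
have F0 k x : (0 <= (hker (A - t) x0 x)%:E * sampled_heat t k (s, x))%E.
  by rewrite mule_ge0 ?lee_fin ?heat_kernel_ge0 ?sampled_heat_ge0.
apply: (@le_trans _ _ (\int[mu]_x
    limn_einf (fun k => (hker (A - t) x0 x)%:E * sampled_heat t k (s, x)))%E).
  apply: le_integral_nonmeasurable => x _; rewrite EFinM majorantE//.
  apply: limn_einfZ_le; first exact: heat_kernel_ge0.
  by move=> k; exact: sampled_heat_ge0.
apply: le_trans (fatou _ _ _ _) _ => //.
apply: limn_einf_le; apply: nearW => k.
have [g0|g0] := leP (grid k s) 0.
  by under eq_integral do rewrite sampled_heat_eq0// mule0; rewrite integral0.
under eq_integral do rewrite sampled_heatE//.
have gs := grid_le k (ltW s0); have gt := le_lt_trans gs st'.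
rewrite heat_semigroupD//; [|by rewrite subr_gt0|exact: mub].
by rewrite addrA subrK HS// g0 ltW.
Qed.

End time_discretization.

(** * The pointwise bound *)

Section pointwise_bound.
Context (R : realType) (n : nat).
Local Notation E := (euclidean R n).
Local Notation mu := (@lebesgue_measure_n R n).
Local Notation leb := (@lebesgue_measure R).
Implicit Types (s t tau e : R) (x y : E).
Variables (u : R -> E -> R) (phi : E -> R) (L b T : R) (w : R -> R -> R).
Hypothesis n0 : (0 < n)%N.
Hypothesis b12 : 1 <= b <= 2.
Hypothesis up : bounded_L2_path u L.
Hypothesis mphi : measurable_fun setT phi.
Hypothesis mw : forall t, 0 < t <= T -> measurable_fun setT (w t).
Hypothesis w0 : forall t s, 0 <= w t s.
Hypothesis w_supp : forall t s, ~~ (0 < s < t) -> w t s = 0.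
Hypothesis w_int : forall t, 0 < t <= T -> (\int[leb]_s (w t s)%:E <= (8^-1)%:E)%E.
Hypothesis duhamel : forall t, 0 < t <= T -> {ae mu, forall x,
  (`|u t x|%:E <= heat_semigroup t (fun y => `|phi y|%R) x +
    \int[leb]_(s in `]0%R, t[) ((w t s)%:E *
      (heat_semigroup (t - s) (fun y => (`|u s y| `^ b)%R) x) `^ b^-1))%E}.

Let ub t x := `|u t x| `^ b.
Let phib x := `|phi x| `^ b.

Let b0 : 0 < b. Proof. by case/andP: b12 => b1 _; rewrite (lt_le_trans _ b1). Qed.
Let b1 : 1 <= b. Proof. by case/andP: b12. Qed.
Let b2 : b <= 2. Proof. by case/andP: b12. Qed.

Let mub t : 0 < t -> measurable_fun setT (ub t).
Proof.
move=> t0; apply: measurable_powR_comp; apply: measurableT_comp => //.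
exact: path_measurable up _ t0.
Qed.

Let mphib : measurable_fun setT phib.
Proof. by apply: measurable_powR_comp; exact: measurableT_comp. Qed.

Let mnphi : measurable_fun setT (fun y => `|phi y|).
Proof. exact: measurableT_comp. Qed.

Let L0 : 0 <= L.
Proof.
rewrite -lee_fin; apply: le_trans (path_bound up ltr01).
by apply: integral_ge0 => x _; rewrite lee_fin sqr_ge0.
Qed.

Let heat_phi t x : 0 < t ->
  (heat_semigroup t (fun y => `|phi y|%R) x <= (heat_semigroup t phib x) `^ b^-1)%E.
Proof. by move=> t0; exact: heat_jensen. Qed.

Let tail_ge0 t x : (0 <= \int[leb]_s (w t s * majorant u b t s x)%:E)%E.
Proof.
by apply: integral_ge0 => s _; rewrite lee_fin mulr_ge0// majorant_ge0.
Qed.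

Let measurable_wmajorant t : 0 < t <= T ->
  measurable_fun setT (fun z : measurableTypeR R * E =>
    (w t z.1 * majorant u b t z.1 z.2)%:E).
Proof.
move=> tT; apply/measurable_EFinP; apply: measurable_funM.
  exact: measurableT_comp (mw tT) measurable_fst.
exact: measurable_majorant up _.
Qed.

(** Jensen's inequality in time for the weight [w t] moves the power b^-1 outside the integral;
    raising the sum of the two terms to the power b then costs 2^b <= 4. *)
Let pow_le t : 0 < t <= T -> {ae mu, forall x, ((ub t x)%:E <=
  4%:E * (heat_semigroup t phib x + \int[leb]_s (w t s * majorant u b t s x)%:E))%E}.
Proof.
move=> tT; have /andP[t0 _] := tT.
apply: filterS (duhamel tT) => x ux.
apply: (@le_trans _ _ (((heat_semigroup t phib x) `^ b^-1 +
    (\int[leb]_s (w t s * majorant u b t s x)%:E) `^ b^-1) `^ b)%E).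
  rewrite -poweR_EFin; apply: le_poweR; rewrite ?(ltW b0)// ?lee_fin//.
  apply: le_trans ux _; apply: leeD; first exact: heat_phi.
  rewrite integral_mkcond.
  apply: (@le_trans _ _ (\int[leb]_s (w t s * (majorant u b t s x) `^ b^-1)%:E)%E).
    apply: le_integral_nonmeasurable => s _; rewrite patchE; case: ifPn; last first.
      by move=> _; rewrite lee_fin mulr_ge0 ?powR_ge0.
    rewrite inE /= in_itv/= => st; rewrite EFinM lee_wpmul2l ?lee_fin//.
    rewrite -poweR_EFin; apply: le_poweR; rewrite ?invr_ge0 ?(ltW b0)//.
      by apply: heat_ge0 => y; exact: powR_ge0.
    exact: (heat_pow_le_majorant n0 b12 up x st).
  have mm : measurable_fun setT (fun s : measurableTypeR R => majorant u b t s x).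
    exact: (measurable_fun_pair1 x (measurable_majorant b up t)).
  apply: le_trans (weighted_jensen _ _ _ _ b1 _) _ => //.
  - exact: mw.
  - exact: measurable_powR_comp.
  - by move=> s; exact: powR_ge0.
  - by apply: le_trans (w_int tT) _; rewrite lee_fin invf_le1// ler1n.
  rewrite le_eqVlt; apply/orP; left; apply/eqP; congr (_ `^ _)%E.
  apply: eq_integral => s _; rewrite -powRrM mulVf ?gt_eqF// powRr1//.
  exact: majorant_ge0.
have b4 : 2 `^ b <= 4 :> R.
  apply: (@le_trans _ _ (2 `^ 2)); last by rewrite powR_mulrn// expr2 -natrM.
  by rewrite ler_powR ?ler1n//; case/andP: b12.
apply: le_trans (poweR_add_le (ltW b0) _ _) _; rewrite ?poweR_ge0//.
apply: le_trans (lee_wpmul2r _ (_ : (2 `^ b)%:E <= 4%:E)%E) _;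
  rewrite ?lee_fin ?adde_ge0 ?poweR_ge0//.
rewrite -!poweRrM mulVf ?gt_eqF// !poweRe1//.
by apply: heat_ge0 => y; exact: powR_ge0.
Qed.

(** The flow over time A - t is applied to [pow_le]: the semigroup law treats the data term,
    Tonelli's theorem and [integral_majorant] bound the other one by S times the mass of [w t]. *)
Let heat_step t x0 A (S : R) : 0 < t <= T -> t < A -> 0 <= S ->
  (forall s, 0 < s <= t -> (heat_semigroup (A - s) (ub s) x0 <= S%:E)%E) ->
  (heat_semigroup (A - t) (ub t) x0 <=
    4%:E * (heat_semigroup A phib x0 + (8^-1 * S)%:E))%E.
Proof.
move=> tT tA S0 HS; have /andP[t0 _] := tT.
have At : 0 < A - t by rewrite subr_gt0.
have mk : measurable_fun setT (fun x => (hker (A - t) x0 x)%:E).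
  by apply/measurable_EFinP; exact: measurable_heat_kernel2.
have mh : measurable_fun setT (heat_semigroup t phib).
  by apply: measurable_heat => // y; exact: powR_ge0.
pose J x := (\int[leb]_s (w t s * majorant u b t s x)%:E)%E.
have mJ : measurable_fun setT J.
  apply: (measurable_fun_fubini_tonelli_G (m1 := leb) _ (measurable_wmajorant tT)).
  by move=> z; rewrite lee_fin mulr_ge0// majorant_ge0.
have h0 x : (0 <= heat_semigroup t phib x)%E by apply: heat_ge0 => y; exact: powR_ge0.
have hJ0 x : (0 <= heat_semigroup t phib x + J x)%E by rewrite adde_ge0// tail_ge0.
have mhJ : measurable_fun setT (heat_semigroup t phib \+ J)%E by exact: emeasurable_funD.
have k0 x : (0 <= (hker (A - t) x0 x)%:E)%E by rewrite lee_fin heat_kernel_ge0.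
apply: (@le_trans _ _ (\int[mu]_x (4%:E * ((hker (A - t) x0 x)%:E *
    (heat_semigroup t phib x + J x))))%E).
  apply: ae_ge0_le_integral => //.
  - by move=> x _; rewrite lee_fin mulr_ge0 ?heat_kernel_ge0 ?powR_ge0.
  - by apply: measurable_kernelM; exact: mub.
  - by move=> x _; rewrite mule_ge0 ?lee_fin// mule_ge0.
  - by apply: emeasurable_funM => //; exact: emeasurable_funM.
  apply: filterS (pow_le tT) => x ux _.
  rewrite EFinM muleCA; apply: lee_wpmul2l; first exact: k0.
  exact: ux.
rewrite ge0_integralZl//; last 2 first.
- exact: emeasurable_funM.
- by move=> x _; rewrite mule_ge0.
apply: lee_wpmul2l => //.
under eq_integral do rewrite ge0_muleDr ?tail_ge0//.
rewrite ge0_integralD//; last 4 first.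
- by move=> x _; rewrite mule_ge0.
- exact: emeasurable_funM.
- by move=> x _; rewrite mule_ge0// tail_ge0.
- exact: emeasurable_funM.
rewrite heat_semigroupD//; last by move=> y; exact: powR_ge0.
rewrite subrK leeD2l//.
pose F (z : measurableTypeR R * E) := ((hker (A - t) x0 z.2)%:E *
  (w t z.1 * majorant u b t z.1 z.2)%:E)%E.
have mF : measurable_fun setT F.
  apply: emeasurable_funM; last exact: measurable_wmajorant.
  exact: measurableT_comp mk measurable_snd.
have F0 z : (0 <= F z)%E by rewrite mule_ge0// lee_fin mulr_ge0// majorant_ge0.
rewrite (_ : (\int[mu]_x _)%E = (\int[mu]_x \int[leb]_s F (s, x))%E); last first.
  apply: eq_integral => x _; rewrite /F/= ge0_integralZl//.
  - exact: (measurable_fun_pair1 x (measurable_wmajorant tT)).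
  - by move=> s _; rewrite lee_fin mulr_ge0// majorant_ge0.
rewrite -(fubini_tonelli F)//.
apply: (@le_trans _ _ (\int[leb]_s ((w t s)%:E * S%:E))%E).
  apply: le_integral_nonmeasurable => s _; rewrite /F/=.
  have [st|st] := boolP (0 < s < t); last first.
    by under eq_integral do rewrite w_supp// mul0r mule0; rewrite integral0 w_supp// mul0e.
  under eq_integral do rewrite -EFinM mulrCA EFinM.
  rewrite ge0_integralZl ?lee_fin//; last 2 first.
  - apply/measurable_EFinP; apply: measurable_funM; first exact: measurable_heat_kernel2.
    exact: (measurable_fun_pair2 s (measurable_majorant b up t)).
  - by move=> x _; rewrite lee_fin mulr_ge0 ?heat_kernel_ge0 ?majorant_ge0.
  apply: lee_wpmul2l; rewrite ?lee_fin//.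
  exact: (integral_majorant b12 up st tA).
rewrite ge0_integralZr ?lee_fin//; last 2 first.
- by apply/measurable_EFinP; exact: mw.
- by move=> s _; rewrite lee_fin.
by rewrite EFinM lee_wpmul2r ?lee_fin// w_int.
Qed.

(* The supremum S of s |-> e^((A - s)Delta)|u(s)|^b(x0) over ]0, t] is finite
   and satisfies S <= 4 Q + S / 2. *)
Let heat_path_le t x0 A : 0 < t <= T -> t < A ->
  (heat_semigroup (A - t) (ub t) x0 <= 8%:E * heat_semigroup A phib x0)%E.
Proof.
move=> tT tA; have /andP[t0 tT'] := tT.
pose P := [set heat_semigroup (A - s) (ub s) x0 | s in [set s | 0 < s <= t]].
have Q0 : (0 <= heat_semigroup A phib x0)%E by apply: heat_ge0 => y; exact: powR_ge0.
have Pt : P (heat_semigroup (A - t) (ub t) x0) by exists t => //=; rewrite t0 lexx.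
have [Qy|Qfin] := eqVneq (heat_semigroup A phib x0) +oo%E.
  by rewrite Qy gt0_muley ?lte_fin// leey.
(* Since t < A, the flow times A - s stay at least A - t > 0, so the smoothing bound is uniform in
   [s]; this finiteness permits absorbing S / 2. *)
have supB : (ereal_sup P <= (1 + (A - t) `^ (- (n%:R / 2)) * L)%:E)%E.
  apply: ge_ereal_sup => _ [s /andP[s0 st] <-].
  have As : 0 < A - s by rewrite subr_gt0 (le_lt_trans st).
  have At : 0 < A - t by rewrite subr_gt0.
  apply: le_trans (heat_pow_bound b12 up x0 As s0) _.
  rewrite lee_fin lerD2l ler_wpM2r// !powRN lef_pV2 ?posrE ?powR_gt0//.
  apply: ge0_ler_powR; rewrite ?nnegrE ?divr_ge0 ?ler0n ?(ltW As) ?(ltW At)//.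
  by rewrite lerB.
have sup0 : (0 <= ereal_sup P)%E.
  by apply: le_trans (ereal_sup_ubound Pt); apply: heat_ge0 => y; exact: powR_ge0.
have [S SE] : exists S : R, ereal_sup P = S%:E.
  exists (fine (ereal_sup P)); rewrite fineK// ge0_fin_numE//.
  by rewrite (le_lt_trans supB)// ltry.
have [Q QE] : exists Q : R, heat_semigroup A phib x0 = Q%:E.
  by exists (fine (heat_semigroup A phib x0)); rewrite fineK// ge0_fin_numE// ltey.
rewrite SE lee_fin in sup0; apply: le_trans (ereal_sup_ubound Pt) _.
have : (ereal_sup P <= 4%:E * (Q%:E + (8^-1 * S)%:E))%E.
  apply: ge_ereal_sup => _ [s /andP[s0 st] <-]; rewrite -QE.
  apply: heat_step => //; first by rewrite s0 (le_trans st).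
    exact: le_lt_trans tA.
  move=> s' /andP[s'0 s's]; rewrite -SE; apply: ereal_sup_ubound; exists s' => //=.
  by rewrite s'0 (le_trans s's).
rewrite SE QE -EFinD -!EFinM !lee_fin; lra.
Qed.

(** [heat_path_le] requires A > t and so misses A = t at time [t] itself. The Duhamel inequality is
    used once more, where only s < t occurs and A = t is allowed: the integral is at most 8^-1 (8
    Q)^(1/b) <= Q^(1/b), so |u| <= 2 Q^(1/b) and |u|^b <= 4 Q. *)
Lemma pointwise_bound t : 0 < t <= T -> {ae mu, forall x,
  ((`|u t x| `^ b)%:E <= 4%:E * heat_semigroup t (fun y => (`|phi y| `^ b)%R) x)%E}.
Proof.
move=> tT; have /andP[t0 _] := tT.
apply: filterS (duhamel tT) => x ux; set Q := heat_semigroup t phib x.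
have Q0 : (0 <= Q)%E by apply: heat_ge0 => y; exact: powR_ge0.
rewrite -poweR_EFin; apply: (@le_trans _ _ ((2%:E * Q `^ b^-1) `^ b)%E); last first.
  rewrite poweRM ?poweR_ge0 ?lee_fin// -poweRrM mulVf ?gt_eqF// poweRe1//.
  apply: lee_wpmul2r => //; rewrite poweR_EFin lee_fin.
  apply: (@le_trans _ _ (2 `^ 2)); first by rewrite ler_powR// ler1n.
  by rewrite powR_mulrn// expr2 -natrM.
apply: le_poweR; rewrite ?(ltW b0) ?lee_fin//; apply: le_trans ux _.
rewrite (_ : 2%:E = (1 + 1)%:E :> \bar R)// EFinD ge0_muleDl// mul1e.
apply: leeD; first exact: heat_phi.
rewrite integral_mkcond.
apply: (@le_trans _ _ (\int[leb]_s ((w t s)%:E * (8%:E * Q `^ b^-1)))%E).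
  apply: le_integral_nonmeasurable => s _; rewrite patchE; case: ifPn; last first.
    by move=> _; rewrite mule_ge0 ?lee_fin// mule_ge0 ?lee_fin// poweR_ge0.
  rewrite inE /= in_itv/= => /andP[s0 st]; apply: lee_wpmul2l; rewrite ?lee_fin//.
  apply: (@le_trans _ _ ((8%:E * Q) `^ b^-1)%E).
    apply: le_poweR; rewrite ?invr_ge0 ?(ltW b0)//.
      by apply: heat_ge0 => y; exact: powR_ge0.
    apply: heat_path_le => //; rewrite s0 (le_trans (ltW st))//.
    by case/andP: tT.
  rewrite poweRM ?lee_fin//; apply: lee_wpmul2r; rewrite ?poweR_ge0//.
  by rewrite poweR_EFin lee_fin ler1_powR ?ler1n// invf_le1.
rewrite ge0_integralZr//.
- rewrite muleA -[leRHS]mul1e lee_wpmul2r ?poweR_ge0//.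
  apply: le_trans (lee_wpmul2r _ (w_int tT)) _; rewrite ?lee_fin//.
  by rewrite mulVf ?pnatr_eq0.
- by apply/measurable_EFinP; exact: mw.
- by move=> s _; rewrite lee_fin.
- by rewrite mule_ge0 ?lee_fin// poweR_ge0.
Qed.

End pointwise_bound.

(** * Exponential integrability *)

Section time_integrals.
Context (R : realType).
Local Notation leb := (@lebesgue_measure R).
Implicit Types (f F : R -> R) (p q s t r c C : R).

(** The integrand may be singular at both endpoints: the fundamental theorem is applied on compact
    subintervals, and monotone convergence exhausts the open one. *)
Lemma integral_oo_le f F p q C : 0 <= C ->
  (forall s, p < s < q -> 0 <= f s) ->
  (forall s, p < s < q -> {for s, continuous f}) ->
  (forall s, p < s < q -> is_derive s 1 F (f s)) ->
  (forall c d, p < c -> c < d -> d < q -> F d - F c <= C) ->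
  (\int[leb]_(s in `]p, q[) (f s)%:E <= C%:E)%E.
Proof.
move=> C0 f0 fc dF FC.
have [qp|pq] := leP q p; first by rewrite set_itv_ge ?integral_set0 ?lee_fin// bnd_simp -leNgt.
(* A denominator of at least 3 gives [c k < d k] from the first index on. *)
pose e k := (q - p) / k.+3%:R; pose c k := p + e k; pose d k := q - e k.
have e0 k : 0 < e k by rewrite divr_gt0 ?subr_gt0.
have cd k : c k < d k.
  suff : e k * 2 < q - p by rewrite /c /d; lra.
  by rewrite /e mulrAC ltr_pdivrMr// ltr_pM2l ?subr_gt0// ltr_nat.
pose D k := [set` `[c k, d k]].
have DE : \bigcup_k D k = `]p, q[%classic.
  apply/seteqP; split => [s [k _]|s]; rewrite /D /= !in_itv/=.
    move=> /andP[cs sd]; apply/andP; split.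
      by apply: lt_le_trans cs; rewrite ltrDl.
    by apply: le_lt_trans sd _; rewrite ltrBlDr ltrDl.
  move=> /andP[ps sq].
  pose m := Num.min (s - p) (q - s).
  have m0 : 0 < m by rewrite lt_min !subr_gt0 ps.
  pose k := Num.truncn ((q - p) / m).
  have ek : e k <= m.
    rewrite /e ler_pdivrMr// mulrC -ler_pdivrMr// ltW//.
    apply: lt_le_trans (truncnS_gt _) _; rewrite ler_nat/= -/k.
    by rewrite !ltnS leqW// leqW.
  have mp : m <= s - p by rewrite ge_min lexx.
  have mq : m <= q - s by rewrite ge_min lexx orbT.
  exists k => //=; rewrite in_itv/= /c /d; apply/andP; split; lra.
have inD k s : D k s -> p < s < q.
  by move=> Ds; have : (\bigcup_k D k) s by [exists k]; rewrite DE/= in_itv.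
have fm : measurable_fun `]p, q[ f.
  apply: open_continuous_measurable_fun => //.
  by move=> s; rewrite inE/= in_itv/=; exact: fc.
have cvg : (\int[leb]_(x in D i) (f x)%:E)%E @[i --> \oo] -->
    (\int[leb]_(x in `]p, q[) (f x)%:E)%E.
  rewrite -DE; apply: ge0_nondecreasing_set_cvg_integral.
  - apply/nondecreasing_seqP => k; rewrite subsetEset => s; rewrite /D/= !in_itv/=.
    have ee : e k.+1 <= e k.
      by rewrite /e ler_pM2l ?subr_gt0// lef_pV2 ?posrE// ler_nat.
    by rewrite /c /d => /andP[cs sd]; apply/andP; split; lra.
  - by move=> k; exact: measurable_itv.
  - move=> k; apply/measurable_EFinP; apply: measurable_funS fm => //.
    by move=> s /inD; rewrite /= in_itv.
  - by move=> k s /inD; rewrite lee_fin; exact: f0.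
rewrite -(cvg_lim _ cvg)//; apply: lime_le; first by apply/cvg_ex; eexists; exact: cvg.
apply: nearW => k.
have pc : p < c k by rewrite ltrDl.
have dq : d k < q by rewrite ltrBlDr ltrDl.
have cont s : p < s < q -> {for s, continuous F}.
  by move=> /dF [ds _]; apply/differentiable_continuous/derivable1_diffP.
rewrite (@continuous_FTC2 _ f F)//.
- by rewrite -EFinB lee_fin; exact: FC.
- apply: continuous_in_subspaceT => s /set_mem /inD; exact: fc.
- split.
  + move=> s; rewrite in_itv/= => /andP[cs sd].
    have st : p < s < q by rewrite (lt_trans pc cs) (lt_trans sd dq).
    by have [] := dF _ st.
  + by apply: cvg_at_right_filter; apply: cont; rewrite pc (lt_trans (cd k)).
  + by apply: cvg_at_left_filter; apply: cont; rewrite dq (lt_trans pc).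
- move=> s; rewrite in_itv/= => /andP[cs sd]; rewrite derive1E.
  have st : p < s < q by rewrite (lt_trans pc cs) (lt_trans sd dq).
  by have [_ ->] := dF _ st.
Qed.

Lemma integral_powR_le p q r C : 0 <= p -> 0 <= C -> r != 0 ->
  (forall c d, p < c -> c < d -> d < q -> (d `^ r - c `^ r) / r <= C) ->
  (\int[leb]_(s in `]p, q[) (s `^ (r - 1))%:E <= C%:E)%E.
Proof.
move=> p0 C0 r0 HC; apply: (@integral_oo_le _ (fun s => r^-1 * s `^ r)) => //.
- by move=> s _; exact: powR_ge0.
- move=> s /andP[ps _]; have s0 := le_lt_trans p0 ps.
  apply/differentiable_continuous/derivable1_diffP.
  by have [] := is_derive1_powR (r - 1) s0.
- move=> s /andP[ps _]; have s0 := le_lt_trans p0 ps.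
  have := is_deriveZ r^-1 (is_derive1_powR r s0).
  by rewrite /GRing.scale/= mulrA mulVf// mul1r.
- by move=> c d pc cd dq; rewrite -mulrBr mulrC; exact: HC.
Qed.

Lemma integral_powR_sub_le p q r : 0 < r ->
  (\int[leb]_(s in `]p, q[) ((q - s) `^ (r - 1))%:E <= ((q - p) `^ r / r)%:E)%E.
Proof.
move=> r0.
have dq s : s < q -> is_derive s 1 (fun x => q - x) (-1).
  by move=> _; rewrite -[-1]add0r; exact: is_deriveD.
apply: (@integral_oo_le _ (fun s => - (r^-1 * (q - s) `^ r))) => //.
- by rewrite divr_ge0 ?powR_ge0// ltW.
- by move=> s _; exact: powR_ge0.
- move=> s /andP[_ sq]; have s0 : 0 < q - s by rewrite subr_gt0.
  apply: (@continuous_comp _ _ _ (fun x => q - x) (fun x => x `^ (r - 1))).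
    apply/differentiable_continuous/derivable1_diffP.
    by have [] := dq s sq.
  apply/differentiable_continuous/derivable1_diffP.
  by have [] := is_derive1_powR (r - 1) s0.
- move=> s /andP[_ sq]; have s0 : 0 < q - s by rewrite subr_gt0.
  have := @is_derive1_comp R (fun x : R => x `^ r) (fun x : R => q - x) s _ _
    (is_derive1_powR r s0) (dq s sq).
  move=> /(is_deriveZ r^-1) /is_deriveN; rewrite /GRing.scale/=.
  by rewrite mulrN1 mulrN opprK mulrA mulVf ?gt_eqF// mul1r.
- move=> c d pc cd dq'; rewrite (_ : _ - _ = ((q - c) `^ r - (q - d) `^ r) / r); last by ring.
  rewrite ler_wpM2r ?invr_ge0 ?(ltW r0)//.
  apply: (@le_trans _ _ ((q - c) `^ r)); first by rewrite gerBl powR_ge0.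
  by apply: ge0_ler_powR; rewrite ?nnegrE; lra.
Qed.

End time_integrals.

Section exponential_inequalities.
Context (R : realType).
Implicit Types x y v l : R.

Lemma exprS_le_expR_sub1 y k : 0 <= y -> y ^+ k.+1 <= k.+1`!%:R * (expR y - 1).
Proof.
move=> y0; have := @expR_ge1Dxn _ y k y0.
by rewrite -lerBrDl ler_pdivrMr ?ltr0n ?fact_gt0// mulrC.
Qed.

(** With e = exp(y/2) and y/2 <= e - 1, one has y e <= 2 e (e - 1) <= 2 (e^2 - 1). *)
Lemma expR_half_le y : 0 <= y -> y * expR (y / 2) <= 2 * (expR y - 1).
Proof.
move=> y0; have e1 : 1 <= expR (y / 2) by rewrite -expR0 ler_expR divr_ge0.
have e2 : y / 2 <= expR (y / 2) - 1 by rewrite lerBrDl expR_ge1Dx.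
have -> : expR y = expR (y / 2) * expR (y / 2) by rewrite -expRD -splitr.
by move: e1 e2; set e := expR _ => e1 e2; nra.
Qed.

(* With y = (v / l)^2 the left-hand side is l^16 y^8 e^(4 n l^2 y), and
   y^8 e^(y/4) <= C y e^(y/2) <= C' (e^y - 1). *)
Lemma critical_potential_le : exists2 C : R, 0 < C & forall (n : nat) l v,
  0 < l -> 16 * n%:R * l ^+ 2 <= 1 ->
  `|v| ^+ 16 * expR (4 * n%:R * v ^+ 2) <=
  l ^+ 16 * C * (expR ((`|v| / l) ^+ 2) - 1).
Proof.
have [C C0 C7] : exists2 C : R, 0 < C & forall y, 0 <= y -> y ^+ 7 <= C * expR (y / 4).
  have a0 : 0 < 4 ^+ 7 :> R by rewrite exprn_gt0.
  have f0 : 0 < 7`!%:R :> R by rewrite ltr0n fact_gt0.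
  exists (4 ^+ 7 * 7`!%:R); first exact: mulr_gt0.
  move=> y y0; have := @exprS_le_expR_sub1 (y / 4) 6; rewrite divr_ge0// => /(_ isT).
  rewrite expr_div_n ler_pdivrMr// mulrC mulrA => /le_trans; apply.
  by rewrite ler_pM2l ?mulr_gt0// lerBlDr lerDl.
exists (2 * C); first exact: mulr_gt0.
move=> n l v l0 nl; set y := (`|v| / l) ^+ 2.
have y0 : 0 <= y by exact: sqr_ge0.
have v2 : v ^+ 2 = l ^+ 2 * y.
  by rewrite /y expr_div_n real_normK ?num_real// mulrCA divff ?mulr1// sqrf_eq0 gt_eqF.
have -> : `|v| ^+ 16 = l ^+ 16 * y ^+ 8.
  by rewrite -[16%N]/(2 * 8)%N !exprM real_normK ?num_real// v2 exprMn.
clearbody y; rewrite -[leLHS]mulrA -[leRHS]mulrA ler_pM2l ?exprn_gt0//.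
have e4 : expR (4 * n%:R * v ^+ 2) <= expR (y / 4).
  rewrite ler_expR v2; have -> : y / 4 = 4^-1 * y by rewrite mulrC.
  have -> : 4 * n%:R * (l ^+ 2 * y) = 4 * (n%:R * l ^+ 2) * y by ring.
  apply: ler_wpM2r => //.
  by move: nl; rewrite -mulrA; set X := n%:R * _; lra.
apply: (@le_trans _ _ (y * (C * expR (y / 4)) * expR (y / 4))).
  by rewrite exprS ler_pM ?mulr_ge0 ?exprn_ge0 ?expR_ge0// ler_wpM2l// C7.
have -> : y * (C * expR (y / 4)) * expR (y / 4) = C * (y * expR (y / 2)).
  have -> : expR (y / 2) = expR (y / 4) * expR (y / 4) by rewrite -expRD; congr expR; field.
  by ring.
rewrite -[leRHS]mulrA [leRHS]mulrCA ler_pM2l//.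
exact: expR_half_le.
Qed.

End exponential_inequalities.

Section luxemburg.
Context (R : realType) (n : nat).
Local Notation E := (euclidean R n).
Local Notation mu := (@lebesgue_measure_n R n).
Implicit Types (g : E -> R) (l : R).

(** The strict inequality avoids the question whether the infimum is attained: some smaller [l'] is
    admissible, and the modular decreases in [l]. *)
Lemma modular_le1 g l : (expL2_norm g < l%:E)%E ->
  0 < l /\ (orlicz_modular exp2_young g l <= 1)%E.
Proof.
move=> /ereal_inf_lt [_ [l' [l'0 gl'] <-]]; rewrite lte_fin => l'l.
have l0 := lt_trans l'0 l'l; split => //; apply: le_trans gl'.
apply: le_integral_nonmeasurable => x _; rewrite lee_fin lerD2r ler_expR.
rewrite ler_sqr ?nnegrE ?divr_ge0 ?(ltW l0) ?(ltW l'0)//.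
by rewrite ler_wpM2l// lef_pV2 ?posrE// ltW.
Qed.

Lemma modular_sqr g l : measurable_fun setT g -> 0 < l ->
  (orlicz_modular exp2_young g l <= 1)%E ->
  (\int[mu]_x ((g x) ^+ 2)%:E <= (l ^+ 2)%:E)%E.
Proof.
move=> mg l0 gl; apply: (@le_trans _ _ ((l ^+ 2)%:E * orlicz_modular exp2_young g l)%E).
  rewrite /orlicz_modular -ge0_integralZl ?lee_fin ?sqr_ge0//.
  - apply: le_integral_nonmeasurable => x _; rewrite -EFinM lee_fin.
    have := expR_ge1Dx ((`|g x| / l) ^+ 2); rewrite -lerBrDl => h.
    apply: le_trans (ler_wpM2l (sqr_ge0 l) h).
    by rewrite expr_div_n real_normK ?num_real// mulrCA divff ?mulr1// sqrf_eq0 gt_eqF.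
  - apply/measurable_EFinP; apply: measurable_funB => //.
    apply: measurableT_comp => //; apply: measurable_funX; apply: measurable_funM => //.
    exact: measurableT_comp.
  - by move=> x _; rewrite lee_fin subr_ge0 -expR0 ler_expR sqr_ge0.
by rewrite -[leRHS]mule1; apply: lee_wpmul2l => //; rewrite lee_fin sqr_ge0.
Qed.

Lemma mild_bounded_L2_path phi (u : R -> E -> R) l :
  mild_solution (@nonlinearity R n) phi u ->
  (forall t, 0 < t -> (expL2_norm (u t) < l%:E)%E) ->
  bounded_L2_path u (l ^+ 2).
Proof.
move=> mu_u ul.
have mu t : 0 < t -> measurable_fun setT (u t).
  by move=> t0; have [[]] := mild_expL2 mu_u t0.
split => // [t t0|t t0 e e0].
  by have [l0 ?] := modular_le1 (ul _ t0); apply: modular_sqr => //; exact: mu.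
pose r := Num.sqrt e; have r0 : 0 < r by rewrite sqrtr_gt0.
have tpos : \forall s \near t, 0 < (s : R) by exact: lt_nbhsr.
have cr : \forall s \near t, (expL2_norm (u s \- u t)%R < r%:E)%E.
  have r0' : (0 < r%:E)%E by rewrite lte_fin.
  exact: (mild_continuous mu_u t0 (open_ereal_lt' r0')).
near=> s; rewrite -(sqr_sqrtr (ltW e0)).
have s0 : 0 < s by near: s.
have [_ sr] : 0 < r /\ (orlicz_modular exp2_young (u s \- u t)%R r <= 1)%E.
  by apply: modular_le1; near: s.
by apply: (modular_sqr _ r0 sr); apply: measurable_funB; exact: mu.
Unshelve. all: by end_near. Qed.

End luxemburg.

(** * The nonlinearity as a potential times the solution *)

Section critical_bound.
Context (R : realType) (n : nat).
Local Notation E := (euclidean R n).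
Local Notation mu := (@lebesgue_measure_n R n).
Local Notation leb := (@lebesgue_measure R).
Local Notation f := (@nonlinearity R n).
Implicit Types (s t tau k d r b v : R) (x y : E) (g phi : E -> R) (u : R -> E -> R).
Hypothesis n0 : (0 < n)%N.

Let nR0 : 0 < n%:R :> R. Proof. by rewrite ltr0n. Qed.
Let nR1 : 1 <= n%:R :> R. Proof. by rewrite ler1n. Qed.

(** The data have size [d] and the solution [2 * d], by the a priori bound with factor 2. The
    Duhamel formula is kept as an inequality between absolute values, the form used by
    [pointwise_bound]. *)
Record small_mild_path d phi u : Prop := SmallMildPath {
  smp_path : bounded_L2_path u ((2 * d) ^+ 2) ;
  smp_modular : forall t, 0 < t -> (orlicz_modular exp2_young (u t) (2 * d) <= 1)%E ;
  smp_data_measurable : measurable_fun setT phi ;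
  smp_data_modular : (orlicz_modular exp2_young phi d <= 1)%E ;
  smp_duhamel : forall t, 0 < t -> {ae mu, forall x,
    (`|u t x|%:E <= heat_semigroup t (fun y => `|phi y|%R) x +
      \int[leb]_(s in `]0%R, t[) heat_semigroup (t - s) (fun y => `|f (u s y)|%R) x)%E} }.

Definition potential v : R := `|v| `^ (4 / n%:R) * expR (v ^+ 2).

Lemma potential_ge0 v : 0 <= potential v.
Proof. by rewrite mulr_ge0 ?powR_ge0 ?expR_ge0. Qed.

Lemma norm_nonlinearity v : `|f v| = potential v * `|v|.
Proof.
rewrite /nonlinearity !normrM (ger0_norm (powR_ge0 _ _)) (ger0_norm (expR_ge0 _)).
by rewrite mulrAC.
Qed.

Lemma measurable_potential g : measurable_fun setT g ->
  measurable_fun setT (fun y => potential (g y)).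
Proof.
move=> mg; apply: measurable_funM.
  by apply: measurable_powR_comp; exact: measurableT_comp.
by apply: measurableT_comp => //; exact: measurable_funX.
Qed.

(** The power 4n of [potential]; the exponent 4n * 4/n = 16 of |v| no longer depends on the
    dimension. *)
Definition critical_potential v : R := `|v| ^+ 16 * expR (4 * n%:R * v ^+ 2).

Lemma potential_powR v : (potential v `^ 4) `^ n%:R = critical_potential v.
Proof.
rewrite -powRrM /potential powRM ?powR_ge0 ?expR_ge0// -powRrM -expRM.
rewrite /critical_potential -(@powR_mulrn _ `|v| 16)//; congr (_ `^ _ * expR _); last exact: mulrC.
by field; rewrite gt_eqF.
Qed.

(** Jensen's inequality with exponent r / b carries a pointwise bound to a power of the data whose
    integral is controlled; it is used with r = 2 and r = 3/2. *)
Lemma pow_bound_raise b r t phi x v : 0 < b -> b <= r -> 0 < t ->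
  measurable_fun setT phi ->
  ((`|v| `^ b)%:E <= 4%:E * heat_semigroup t (fun y => (`|phi y| `^ b)%R) x)%E ->
  ((`|v| `^ r)%:E <=
    (4 `^ (r / b))%:E * heat_semigroup t (fun y => (`|phi y| `^ r)%R) x)%E.
Proof.
move=> b0 br t0 mphi vb.
have rb : 1 <= r / b by rewrite ler_pdivlMr// mul1r.
have rb0 : 0 <= r / b by rewrite (le_trans _ rb).
have brb c : (c `^ b) `^ (r / b) = c `^ r :> R.
  by rewrite -powRrM mulrCA divff ?gt_eqF// mulr1.
have mb : measurable_fun setT (fun y => `|phi y| `^ b).
  by apply: measurable_powR_comp; exact: measurableT_comp.
have p0 y : 0 <= `|phi y| `^ b by exact: powR_ge0.
rewrite -brb -poweR_EFin; apply: le_trans (le_poweR rb0 _ vb) _.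
  by rewrite lee_fin powR_ge0.
rewrite poweRM ?heat_ge0//; apply: lee_wpmul2l; first exact: poweR_ge0.
apply: le_trans (heat_jensen_pow x t0 mb p0 rb) _.
by rewrite le_eqVlt; apply/orP; left; apply/eqP/eq_heat => y.
Qed.

(** Hoelder's inequality with exponents 4 and 4/3, then Jensen's from V^4 to V^(4n), whose integral
    is at most k^(4n). The smoothing factor tau^(-n/2) is raised to 1/(4n), hence tau^(-1/8). *)
Lemma heat_nonlinearity_critical tau k g x : 0 < tau -> 0 <= k ->
  measurable_fun setT g ->
  (\int[mu]_y (critical_potential (g y))%:E <= ((k `^ 4) `^ n%:R)%:E)%E ->
  (heat_semigroup tau (fun y => `|f (g y)|%R) x <= (tau `^ (- (1 / 8)) * k)%:E *
    (heat_semigroup tau (fun y => (`|g y| `^ (4 / 3))%R) x) `^ (4 / 3)^-1)%E.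
Proof.
move=> tau0 k0 mg gk.
have mV := measurable_potential mg.
have mV4 : measurable_fun setT (fun y => potential (g y) `^ 4).
  exact: measurable_powR_comp.
have mng : measurable_fun setT (fun y => `|g y|) by exact: measurableT_comp.
apply: (@le_trans _ _ (heat_semigroup tau
    ((fun y => potential (g y)) \* (fun y => `|g y|)) x)).
  by apply: le_heat => y; rewrite norm_nonlinearity.
have four_third : 4^-1 + (4 / 3)^-1 = 1 :> R by field.
apply: le_trans (heat_hoelder tau x mV mng _ _ _ _ four_third) _ => //.
  by move=> y; exact: potential_ge0.
apply: lee_wpmul2r; first exact: poweR_ge0.
have V40 y : 0 <= potential (g y) `^ 4 by exact: powR_ge0.
have h4 := heat_jensen x tau0 mV4 V40 nR1.
have hI : (heat_semigroup tau (fun y => ((potential (g y) `^ 4) `^ n%:R)%R) x <=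
    (tau `^ (- (n%:R / 2)) * (k `^ 4) `^ n%:R)%:E)%E.
  apply: le_trans (heat_le_integral _ tau0 _ _) _.
  - exact: measurable_powR_comp.
  - by move=> y; exact: powR_ge0.
  rewrite EFinM; apply: lee_wpmul2l; first by rewrite lee_fin powR_ge0.
  by under eq_integral do rewrite potential_powR.
have e4 : 0 <= 4^-1 :> R by [].
apply: le_trans (le_poweR e4 _ h4) _; first by rewrite heat_ge0.
have en : 0 <= n%:R^-1 :> R by rewrite invr_ge0 ltW.
apply: le_trans (le_poweR e4 (poweR_ge0 _ _) (le_poweR en _ hI)) _.
  by apply: heat_ge0 => y; exact: powR_ge0.
rewrite !poweR_EFin lee_fin -powRrM powRM ?powR_ge0// -!powRrM le_eqVlt.
apply/orP; left; apply/eqP; congr (_ `^ _ * _).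
  by field; rewrite gt_eqF.
rewrite (_ : 4 * _ = 1) ?powRr1//.
by field; rewrite gt_eqF.
Qed.

Lemma data_sqr_bound d phi u t x : 0 < d -> 0 < t -> small_mild_path d phi u ->
  (heat_semigroup t (fun y => (`|phi y| `^ 2)%R) x <= (t `^ (- (n%:R / 2)) * d ^+ 2)%:E)%E.
Proof.
move=> d0 t0 [_ _ mphi phid _].
apply: le_trans (heat_le_integral _ t0 _ _) _.
- by apply: measurable_powR_comp; exact: measurableT_comp.
- by move=> y; exact: powR_ge0.
rewrite EFinM; apply: lee_wpmul2l; first by rewrite lee_fin powR_ge0.
apply: le_trans (modular_sqr mphi d0 phid).
apply: le_integral_nonmeasurable => y _.
by rewrite powR_mulrn// real_normK ?num_real.
Qed.

Lemma sqr_le_heat t phi x v : 0 < t -> measurable_fun setT phi ->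
  ((`|v| `^ (4 / 3))%:E <= 4%:E * heat_semigroup t (fun y => (`|phi y| `^ (4 / 3))%R) x)%E ->
  ((v ^+ 2)%:E <= 16%:E * heat_semigroup t (fun y => (`|phi y| `^ 2)%R) x)%E.
Proof.
move=> t0 mphi /(@pow_bound_raise _ 2 _ _ _ _ _ _ t0 mphi).
rewrite divr_gt0// ler_pdivrMr// -natrM ler_nat => /(_ isT isT).
rewrite powR_mulrn// real_normK ?num_real// => /le_trans; apply.
apply: lee_wpmul2r; first by apply: heat_ge0 => y; exact: powR_ge0.
(* The exponent of 4 is 2 / (4/3) = 3/2, rounded up to 2. *)
rewrite lee_fin; apply: (@le_trans _ _ (4 `^ 2)); last first.
  by rewrite powR_mulrn// expr2 -natrM.
apply: ler_powR; first by rewrite ler1n.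
by rewrite invf_div mulrA ler_pdivrMr//; lra.
Qed.

End critical_bound.

(** * The critical exponent b = 4/3 *)

Section beta_integrals.
Context (R : realType).
Local Notation leb := (@lebesgue_measure R).
Implicit Types (s t r : R).

Lemma measurable_powR_sub (D : set R) t r :
  measurable_fun D (fun s => ((t - s) `^ r)%:E).
Proof.
apply: measurable_funTS; apply/measurable_EFinP; apply: measurable_powR_comp.
exact: measurable_funB.
Qed.

Lemma measurable_powR_id (D : set R) r : measurable_fun D (fun s => (s `^ r)%:E).
Proof.
apply: measurable_funTS; apply/measurable_EFinP.
by apply: (@measurable_powR_comp _ (measurableTypeR R) R id); exact: measurable_id.
Qed.

Lemma integral_powR0_le t r : 0 < t -> 0 < r ->
  (\int[leb]_(s in `]0%R, t[) (s `^ (r - 1))%:E <= (t `^ r / r)%:E)%E.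
Proof.
move=> t0 r0; apply: integral_powR_le => //; last 2 first.
- by rewrite gt_eqF.
- move=> c d c0 cd dt; rewrite ler_wpM2r ?invr_ge0 ?(ltW r0)//.
  apply: (@le_trans _ _ (d `^ r)); first by rewrite gerBl powR_ge0.
  by apply: ge0_ler_powR; rewrite ?nnegrE; lra.
by rewrite divr_ge0 ?powR_ge0 ?ltW.
Qed.

Lemma powR_half t r : 0 < t -> 0 <= r <= 1 -> (t / 2) `^ (- r) * t `^ r <= 2.
Proof.
move=> t0 /andP[r0 r1]; have t20 : 0 < t / 2 by rewrite divr_gt0.
have tr : t `^ r = 2 `^ r * (t / 2) `^ r.
  by rewrite -powRM ?(ltW t20)//; congr (_ `^ _); rewrite mulrC divfK.
rewrite powRN tr mulrCA mulVf ?gt_eqF ?powR_gt0// mulr1.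
by rewrite ler1_powR// ler1n.
Qed.

(** The exponents add up to -1, so the bound is free of t. On each half of the interval the
    nonsingular factor is at most its value at t/2; the two halves contribute at most 16 and 4. *)
Lemma beta_integral_le t : 0 < t ->
  (\int[leb]_(s in `]0%R, t[) ((t - s) `^ (- (1 / 8)) * s `^ (- (7 / 8)))%:E <= 20%:E)%E.
Proof.
move=> t0; have t20 : 0 < t / 2 by rewrite divr_gt0.
have e7 : - (7 / 8) = 1 / 8 - 1 :> R by field.
have e1 : - (1 / 8) = 7 / 8 - 1 :> R by field.
pose A := (t / 2) `^ (- (1 / 8)); pose B := (t / 2) `^ (- (7 / 8)).
have A0 : 0 <= A by exact: powR_ge0.
have B0 : 0 <= B by exact: powR_ge0.
apply: (@le_trans _ _ (\int[leb]_(s in `]0%R, t[)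
    (A%:E * (s `^ (- (7 / 8)))%:E + B%:E * ((t - s) `^ (- (1 / 8)))%:E))%E).
  apply: le_integral_nonmeasurable => s; rewrite /= in_itv/= => /andP[s0 st].
  have ts0 : 0 < t - s by rewrite subr_gt0.
  have mono r c : 0 <= r -> t / 2 <= c -> c `^ (- r) <= (t / 2) `^ (- r).
    move=> r0 tc; have c0 := lt_le_trans t20 tc.
    rewrite !powRN lef_pV2 ?posrE ?powR_gt0//.
    by apply: ge0_ler_powR; rewrite ?nnegrE ?(ltW c0) ?(ltW t20).
  rewrite -!EFinM -EFinD lee_fin.
  have [sh|sh] := leP s (t / 2).
    apply: (@le_trans _ _ (A * s `^ (- (7 / 8)))); last by rewrite lerDl mulr_ge0// powR_ge0.
    by rewrite ler_wpM2r ?powR_ge0//; apply: mono; lra.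
  apply: (@le_trans _ _ (B * (t - s) `^ (- (1 / 8)))); last first.
    by rewrite lerDr mulr_ge0// powR_ge0.
  by rewrite mulrC ler_wpM2r ?powR_ge0//; apply: mono; lra.
rewrite ge0_integralD//; last 4 first.
- by move=> s _; rewrite -EFinM lee_fin mulr_ge0 ?powR_ge0.
- by apply: emeasurable_funM; [exact: measurable_cst|exact: measurable_powR_id].
- by move=> s _; rewrite -EFinM lee_fin mulr_ge0 ?powR_ge0.
- by apply: emeasurable_funM; [exact: measurable_cst|exact: measurable_powR_sub].
rewrite !ge0_integralZl ?lee_fin//; last 4 first.
- exact: measurable_powR_sub.
- by move=> s _; rewrite lee_fin powR_ge0.
- exact: measurable_powR_id.
- by move=> s _; rewrite lee_fin powR_ge0.
rewrite e1 e7.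
have I1 : (A%:E * \int[leb]_(s in `]0%R, t[) (s `^ (1 / 8 - 1))%:E <= 16%:E)%E.
  apply: le_trans (lee_wpmul2l _ (integral_powR0_le t0 _)) _; rewrite ?lee_fin//.
  have := @powR_half t (1 / 8) t0; rewrite /A => h.
  by rewrite mulrA ler_pdivrMr//; apply: le_trans (h _) _; lra.
have I2 : (B%:E * \int[leb]_(s in `]0%R, t[) ((t - s) `^ (7 / 8 - 1))%:E <= 4%:E)%E.
  apply: le_trans (lee_wpmul2l _ (integral_powR_sub_le _ _ _)) _; rewrite ?lee_fin//.
  have := @powR_half t (7 / 8) t0; rewrite /B subr0 => h.
  by rewrite mulrA ler_pdivrMr//; apply: le_trans (h _) _; lra.
by apply: le_trans (leeD I1 I2) _; rewrite lee_fin; lra.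
Qed.

(** The term in s^(-7/8) uses the decay of V on times already treated by the induction; the
    indicator covers the last unit of time, where only smallness of V is known. *)
Definition critical_weight (eta t : R) : R -> R :=
  (fun s => (t - s) `^ (- (1 / 8)) * (eta * s `^ (- (7 / 8)) + eta * (t - 1 < s)%R%:R))
    \_ `]0, t[.

Lemma measurable_critical_weight eta t : measurable_fun setT (critical_weight eta t).
Proof.
have mD : measurable (`]0, t[%classic : set (measurableTypeR R)) by [].
apply/(measurable_restrictT _ mD); apply: measurable_funTS.
apply: measurable_funM; first by apply: measurable_powR_comp; exact: measurable_funB.
apply: measurable_funD; apply: measurable_funM => //.
rewrite (_ : (fun _ => _) = \1_(`]t - 1, +oo[%classic : set R)) //.
apply/funext => s; rewrite indicE; congr (_%:R).
by rewrite mem_setE in_itv/= andbT.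
Qed.

Lemma critical_weight_ge0 eta t s : 0 <= eta -> 0 <= critical_weight eta t s.
Proof.
move=> eta0; rewrite /critical_weight patchE; case: ifPn => // _.
by rewrite mulr_ge0 ?powR_ge0// addr_ge0 ?mulr_ge0 ?powR_ge0.
Qed.

Lemma critical_weight_supp eta t s : ~~ (0 < s < t) -> critical_weight eta t s = 0.
Proof.
move=> st; rewrite /critical_weight patchE memNset//= in_itv/=.
exact/negP.
Qed.

Lemma critical_weightE eta t s : 0 < s < t -> critical_weight eta t s =
  (t - s) `^ (- (1 / 8)) * (eta * s `^ (- (7 / 8)) + eta * (t - 1 < s)%R%:R).
Proof. by move=> st; rewrite /critical_weight patchE mem_set//= in_itv/=. Qed.

(** Uniform in t: the Beta integral contributes 20, and the indicator confines the other singularity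
    to a unit interval, with integral at most 8/7 <= 2. *)
Lemma integral_critical_weight eta t : 0 < t -> 0 <= eta ->
  (\int[leb]_s (critical_weight eta t s)%:E <= (eta * 22)%:E)%E.
Proof.
move=> t0 eta0.
pose a : R -> \bar R :=
  (fun s => ((t - s) `^ (- (1 / 8)) * s `^ (- (7 / 8)))%:E) \_ `]0, t[.
pose c : R -> \bar R := (fun s => ((t - s) `^ (- (1 / 8)))%:E) \_ `](t - 1), t[.
have a0 s : (0 <= a s)%E.
  by rewrite /a patchE; case: ifPn => // _; rewrite lee_fin mulr_ge0 ?powR_ge0.
have c0 s : (0 <= c s)%E.
  by rewrite /c patchE; case: ifPn => // _; rewrite lee_fin powR_ge0.
have ma : measurable_fun setT a.
  have mD : measurable (`]0, t[%classic : set (measurableTypeR R)) by [].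
  apply/(measurable_restrictT _ mD).
  apply: measurable_funTS; apply/measurable_EFinP; apply: measurable_funM => //.
  by apply: measurable_powR_comp; exact: measurable_funB.
have mc : measurable_fun setT c.
  have mD : measurable (`]t - 1, t[%classic : set (measurableTypeR R)) by [].
  by apply/(measurable_restrictT _ mD); exact: measurable_powR_sub.
apply: (@le_trans _ _ (\int[leb]_s (eta%:E * (a s + c s)))%E).
  apply: le_integral_nonmeasurable => s _.
  have [st|st] := boolP (0 < s < t); last first.
    by rewrite critical_weight_supp// mule_ge0 ?lee_fin// adde_ge0.
  have as_ : a s = ((t - s) `^ (- (1 / 8)) * s `^ (- (7 / 8)))%:E.
    by rewrite /a patchE mem_set//= in_itv.
  rewrite critical_weightE// as_.
  set P := (t - s) `^ _; set X := s `^ _.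
  have -> : P * (eta * X + eta * (t - 1 < s)%R%:R) =
    eta * (P * X + P * (t - 1 < s)%R%:R) by ring.
  rewrite EFinM; apply: lee_wpmul2l; rewrite ?lee_fin// EFinD; apply: leeD2l.
  rewrite /P; case: (boolP (t - 1 < s)) => [s1|_]; last by rewrite mulr0.
  by rewrite mulr1 /c patchE mem_set//= in_itv/= s1; case/andP: st.
rewrite ge0_integralZl ?lee_fin//; last 2 first.
- exact: emeasurable_funD.
- by move=> s _; rewrite adde_ge0.
rewrite EFinM; apply: lee_wpmul2l; rewrite ?lee_fin// ge0_integralD//.
rewrite -!integral_mkcond.
have e1 : - (1 / 8) = 7 / 8 - 1 :> R by field.
have I1 : (\int[leb]_(s in `](t - 1)%R, t[) ((t - s) `^ (- (1 / 8)))%:E <= 2%:E)%E.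
  rewrite e1; apply: le_trans (integral_powR_sub_le _ _ _) _ => //.
  rewrite (_ : t - (t - 1) = 1); last by ring.
  by rewrite powR1 lee_fin ler_pdivrMr//; lra.
by apply: le_trans (leeD (beta_integral_le t0) I1) _; rewrite lee_fin; lra.
Qed.

End beta_integrals.

Section critical_step.
Context (R : realType) (n : nat).
Local Notation E := (euclidean R n).
Local Notation mu := (@lebesgue_measure_n R n).
Local Notation leb := (@lebesgue_measure R).
Local Notation f := (@nonlinearity R n).
Implicit Types (s t tau k d r b v : R) (x y : E) (g phi : E -> R) (u : R -> E -> R).
Hypothesis n0 : (0 < n)%N.

Let nR0 : 0 < n%:R :> R. Proof. by rewrite ltr0n. Qed.
Let nR1 : 1 <= n%:R :> R. Proof. by rewrite ler1n. Qed.

Lemma integral_critical_potential_le : exists2 C : R, 0 < C & forall g l,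
  0 < l -> 16 * n%:R * l ^+ 2 <= 1 ->
  measurable_fun setT g -> (orlicz_modular exp2_young g l <= 1)%E ->
  (\int[mu]_x (critical_potential n (g x))%:E <= (l ^+ 16 * C)%:E)%E.
Proof.
have [C C0 HC] := critical_potential_le R; exists C => // g l l0 nl mg gl.
have lC0 : 0 <= l ^+ 16 * C by rewrite mulr_ge0 ?exprn_ge0 ?(ltW l0) ?(ltW C0).
apply: (@le_trans _ _ ((l ^+ 16 * C)%:E * orlicz_modular exp2_young g l)%E).
  rewrite /orlicz_modular -ge0_integralZl ?lee_fin//.
  - apply: le_integral_nonmeasurable => x _; rewrite -EFinM lee_fin.
    exact: HC.
  - apply/measurable_EFinP; apply: measurable_funB => //.
    apply: measurableT_comp => //; apply: measurable_funX; apply: measurable_funM => //.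
    exact: measurableT_comp.
  - by move=> x _; rewrite lee_fin subr_ge0 -expR0 ler_expR sqr_ge0.
by rewrite -[leRHS]mule1; apply: lee_wpmul2l; rewrite ?lee_fin.
Qed.

(** The pointwise bound raised to the power 2 gives u^2 <= m with m = 16 d^2 s^(-n/2) <= 1. Writing
    u^16 as (u^2)^7 u^2 bounds the integral by m^7 e^(4n) times that of u^2; the factor s^(-7n/2) is
    the power 4n of s^(-7/8). *)
Lemma integral_critical_potential_decay d phi u s K : 0 < d -> d <= 1 / (64 * n%:R) ->
  16 * d * expR (4 * n%:R) <= K -> 1 <= s ->
  small_mild_path d phi u ->
  {ae mu, forall x, ((`|u s x| `^ (4 / 3))%:E <=
    4%:E * heat_semigroup s (fun y => (`|phi y| `^ (4 / 3))%R) x)%E} ->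
  (\int[mu]_x (critical_potential n (u s x))%:E <= (s `^ (- (7 / 2 * n%:R)) * K)%:E)%E.
Proof.
move=> d0 dn dK s1 sm us; have s0 : 0 < s by rewrite (lt_le_trans ltr01).
have d64 : d <= 1 / 64.
  apply: le_trans dn _; rewrite ler_pM2l// lef_pV2 ?posrE ?mulr_gt0//.
  by rewrite ler_peMr.
have dd : d ^+ 2 <= d by rewrite expr2 ger_pMl//; lra.
have [up _ mphi phid _] := sm; have mus := path_measurable up s0.
pose m := s `^ (- (n%:R / 2)) * (16 * d ^+ 2).
have d20 : 0 <= 16 * d ^+ 2 by rewrite mulr_ge0 ?sqr_ge0.
have d21 : 16 * d ^+ 2 <= 1 by lra.
have sn1 : s `^ (- (n%:R / 2)) <= 1.
  by rewrite -[leRHS](powRr0 s) ler_powR// oppr_le0 divr_ge0.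
have m0 : 0 <= m by rewrite mulr_ge0 ?powR_ge0.
have m1 : m <= 1 by rewrite -[leRHS]mulr1 ler_pM ?powR_ge0.
have um : {ae mu, forall x, (u s x) ^+ 2 <= m}.
  apply: filterS us => x /(sqr_le_heat s0 mphi) ux.
  rewrite -lee_fin; apply: le_trans ux _.
  apply: le_trans (lee_wpmul2l _ (data_sqr_bound x d0 s0 sm)) _; first by rewrite lee_fin.
  by rewrite -EFinM lee_fin /m mulrCA.
have C0 : 0 <= m ^+ 7 * expR (4 * n%:R) by rewrite mulr_ge0 ?exprn_ge0 ?expR_ge0.
apply: (@le_trans _ _ ((m ^+ 7 * expR (4 * n%:R))%:E * \int[mu]_x ((u s x) ^+ 2)%:E)%E).
  rewrite -ge0_integralZl ?lee_fin//; last 2 first.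
  - by apply/measurable_EFinP; exact: measurable_funX.
  - by move=> x _; rewrite lee_fin sqr_ge0.
  apply: ae_ge0_le_integral => //.
  - by move=> x _; rewrite lee_fin mulr_ge0 ?exprn_ge0 ?expR_ge0.
  - apply/measurable_EFinP; apply: measurable_funM.
      by apply: measurable_funX; exact: measurableT_comp.
    by apply: measurableT_comp => //; apply: measurable_funM => //; exact: measurable_funX.
  - by move=> x _; rewrite mule_ge0 ?lee_fin ?sqr_ge0.
  - by apply: emeasurable_funM => //; apply/measurable_EFinP; exact: measurable_funX.
  apply: filterS um => x ux _; rewrite -EFinM lee_fin /critical_potential.
  have -> : `|u s x| ^+ 16 = (u s x ^+ 2) ^+ 7 * u s x ^+ 2.
    by rewrite -[16%N]/(2 * 8)%N exprM real_normK ?num_real// exprSr.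
  rewrite mulrAC; apply: ler_wpM2r; first exact: sqr_ge0.
  apply: ler_pM; rewrite ?expR_ge0//.
  - by apply: exprn_ge0; exact: sqr_ge0.
  - by apply: lerXn2r; rewrite ?nnegrE ?sqr_ge0.
  - by rewrite ler_expR ler_piMr ?mulr_ge0// (le_trans ux).
apply: le_trans (lee_wpmul2l _ (path_bound up s0)) _; rewrite ?lee_fin//.
have -> : m ^+ 7 = s `^ (- (7 / 2 * n%:R)) * (16 * d ^+ 2) ^+ 7.
  rewrite /m exprMn -(@powR_mulrn _ (s `^ _)) ?powR_ge0// -powRrM.
  by congr (_ `^ _ * _); field.
set A := s `^ _; set B := (16 * d ^+ 2) ^+ 7; set C := expR _; set D := (2 * d) ^+ 2.
rewrite (_ : A * B * C * D = A * (B * D * C)); last by ring.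
apply: ler_wpM2l; first exact: powR_ge0.
apply: le_trans dK; apply: ler_wpM2r; first exact: expR_ge0.
rewrite -[leRHS]mul1r; apply: ler_pM.
- exact: exprn_ge0.
- exact: sqr_ge0.
- exact: exprn_ile1.
- by rewrite /D exprMn; lra.
Qed.

Lemma critical_bound : exists2 d0 : R, 0 < d0 & forall d phi u, 0 < d -> d <= d0 ->
  small_mild_path d phi u -> forall t, 0 < t -> {ae mu, forall x,
    ((`|u t x| `^ (4 / 3))%:E <=
      4%:E * heat_semigroup t (fun y => (`|phi y| `^ (4 / 3))%R) x)%E}.
Proof.
have [eta eta0 eta8] : exists2 eta : R, 0 < eta & eta * 22 <= 8^-1.
  by exists (200^-1); [rewrite invr_gt0|lra].
have [Y Y0 HY] := integral_critical_potential_le.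
pose K := (eta `^ 4) `^ n%:R.
have K0 : 0 < K by rewrite !powR_gt0.
(* The first bound makes l = 2 d admissible in the exponential estimate; the second and third make
   the integral of V^(4n) at most K = eta^(4n) at all times and at most K s^(-7n/2) where it
   decays. *)
pose d0 := Num.min (1 / (64 * n%:R))
  (Num.min (K / (2 * Y)) (K / (16 * expR (4 * n%:R)))).
exists d0.
  by rewrite !lt_min; apply/and3P; split; apply: divr_gt0; rewrite ?mulr_gt0 ?expR_gt0.
move=> d phi u d_gt0; rewrite !le_min => /and3P[d1 d2 d3] sm.
have d64 : d <= 1 / 64.
  apply: le_trans d1 _; rewrite ler_pM2l// lef_pV2 ?posrE ?mulr_gt0//.
  by rewrite ler_peMr.
have dn : n%:R * d <= 1 / 64.
  move: d1; rewrite ler_pdivlMr ?mulr_gt0// => d1.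
  by rewrite ler_pdivlMr// mulrC; move: d1; set X := n%:R; lra.
have d16 : 16 * d * expR (4 * n%:R) <= K.
  by move: d3; rewrite ler_pdivlMr ?mulr_gt0 ?expR_gt0// mulrA (mulrC d).
have base s : 0 < s -> (\int[mu]_x (critical_potential n (u s x))%:E <= K%:E)%E.
  move=> s0; have mus := path_measurable (smp_path sm) s0.
  apply: le_trans (HY _ _ _ _ mus (smp_modular sm s0)) _.
  - by rewrite mulr_gt0.
  - rewrite exprMn; have : 16 * n%:R * (2 ^+ 2 * d ^+ 2) = 64 * (n%:R * d) * d by ring.
    move=> ->; have : 0 <= n%:R * d by rewrite mulr_ge0 ?(ltW d_gt0).
    by move: dn d64 d_gt0; set X := n%:R * d; nra.
  rewrite lee_fin; move: d2; rewrite ler_pdivlMr ?mulr_gt0//; apply: le_trans.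
  rewrite (_ : d * (2 * Y) = 2 * d * Y); last by ring.
  apply: ler_wpM2r; first exact: ltW.
  rewrite exprS ler_piMr ?mulr_ge0 ?(ltW d_gt0)//.
  by rewrite exprn_ile1 ?mulr_ge0 ?(ltW d_gt0)//; lra.
suff step (N : nat) t : 0 < t <= N%:R -> {ae mu, forall x,
    ((`|u t x| `^ (4 / 3))%:E <=
      4%:E * heat_semigroup t (fun y => (`|phi y| `^ (4 / 3))%R) x)%E}.
  by move=> t t0; apply: (step (Num.truncn t).+1); rewrite t0 ltW// truncnS_gt.
(* The case N = 0 is void. In the inductive step [pointwise_bound] returns the constant 4 again,
   whatever the time horizon, so nothing deteriorates with N. *)
elim: N t => [t /andP[t0]|N IH t tN]; first by rewrite leNgt t0.
have up := smp_path sm.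
apply: (@pointwise_bound R n u phi ((2 * d) ^+ 2) (4 / 3) N.+1%:R
  (critical_weight eta)) (tN) => //.
- by apply/andP; split; lra.
- exact: smp_data_measurable sm.
- by move=> t' _; exact: measurable_critical_weight.
- by move=> t' s; apply: critical_weight_ge0; exact: ltW.
- by move=> t' s; exact: critical_weight_supp.
- move=> t' /andP[t'0 _]; apply: le_trans (integral_critical_weight t'0 (ltW eta0)) _.
  by rewrite lee_fin.
move=> {tN} {}t /andP[t0 tN]; apply: filterS (smp_duhamel sm t0) => x.
move=> /le_trans; apply; apply: leeD2l.
apply: le_integral_nonmeasurable => s; rewrite /= in_itv/= => /andP[s0 st].
have ts : 0 < t - s by rewrite subr_gt0.
have mus := path_measurable up s0.
rewrite critical_weightE ?s0// mulrDr.
have [sN|Ns] := leP s N%:R.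
  have k0 : 0 <= eta * s `^ (- (7 / 8)) by rewrite mulr_ge0 ?powR_ge0 ?(ltW eta0).
  apply: le_trans (heat_nonlinearity_critical n0 x ts k0 mus _) _; last first.
    apply: lee_wpmul2r; first exact: poweR_ge0.
    by rewrite lee_fin lerDl mulr_ge0 ?powR_ge0// mulr_ge0// ltW.
  have sK : ((eta * s `^ (- (7 / 8))) `^ 4) `^ n%:R = s `^ (- (7 / 2 * n%:R)) * K.
    rewrite (powRM 4 (ltW eta0) (powR_ge0 s _)).
    rewrite (powRM n%:R (powR_ge0 _ _) (powR_ge0 _ _)) mulrC; congr (_ * _).
    by rewrite -!powRrM; congr (_ `^ _); field.
  (* For s < 1 the factor s^(-7n/2) is at least 1 and the uniform bound suffices; the induction
     hypothesis is needed only for s >= 1. *)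
  rewrite sK; have [s1|s1] := leP 1 s.
    apply: (integral_critical_potential_decay d_gt0 d1 d16 s1 sm).
    by apply: IH; rewrite s0.
  apply: le_trans (base _ s0) _; rewrite lee_fin ler_peMl ?(ltW K0)//.
  rewrite powRN invf_ge1 ?powR_gt0//.
  apply: (@le_trans _ _ (1 `^ (7 / 2 * n%:R))); last by rewrite powR1.
  by apply: ge0_ler_powR; rewrite ?nnegrE ?mulr_ge0 ?(ltW s0) ?(ltW s1).
apply: le_trans (heat_nonlinearity_critical n0 x ts (ltW eta0) mus _) _.
  exact: base.
apply: lee_wpmul2r; first exact: poweR_ge0.
(* Here s > N >= t - 1, so the indicator in the weight equals 1. *)
have -> : t - 1 < s.
  by apply: le_lt_trans Ns; rewrite lerBlDr natr1.
by rewrite mulr1 lee_fin lerDr !mulr_ge0 ?powR_ge0// ltW.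
Qed.

End critical_step.

(** * The exponent b = 1 *)

Section subcritical_step.
Context (R : realType) (n : nat).
Local Notation E := (euclidean R n).
Local Notation mu := (@lebesgue_measure_n R n).
Local Notation leb := (@lebesgue_measure R).
Local Notation f := (@nonlinearity R n).
Implicit Types (s t tau k d r b v z : R) (x y : E) (g phi : E -> R) (u : R -> E -> R).
Hypothesis n0 : (0 < n)%N.

Let nR0 : 0 < n%:R :> R. Proof. by rewrite ltr0n. Qed.
Let nR1 : 1 <= n%:R :> R. Proof. by rewrite ler1n. Qed.

(** The open intervals ]0, 2[ and ]1, t[ overlap so that s = 1 is covered. Each of the two powers
    has integral at most 3 on its interval. *)
Definition subcritical_weight (eta t : R) : R -> R :=
  (fun s => eta * (((fun s => s `^ (- (1 / 4))) \_ `]0, 2[) s +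
                   ((fun s => s `^ (- (4 / 3))) \_ `]1, t[) s)) \_ `]0, t[.

Let patch_ge0 (D : set R) (h : R -> R) s : (forall s, 0 <= h s) -> 0 <= (h \_ D) s.
Proof. by move=> h0; rewrite patchE; case: ifPn. Qed.

Let measurable_patch_powR (p q r : R) :
  measurable_fun setT ((fun s : measurableTypeR R => s `^ r) \_ `]p, q[).
Proof.
have mD : measurable (`]p, q[%classic : set (measurableTypeR R)) by [].
by apply/(measurable_restrictT _ mD); exact: measurable_funTS.
Qed.

Lemma measurable_subcritical_weight eta t :
  measurable_fun setT (subcritical_weight eta t).
Proof.
have mD : measurable (`]0, t[%classic : set (measurableTypeR R)) by [].
apply/(measurable_restrictT _ mD); apply: measurable_funTS.
by apply: measurable_funM => //; apply: measurable_funD; exact: measurable_patch_powR.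
Qed.

Lemma subcritical_weight_ge0 eta t s : 0 <= eta -> 0 <= subcritical_weight eta t s.
Proof.
move=> eta0; apply: patch_ge0 => {}s; rewrite mulr_ge0// addr_ge0//;
  by apply: patch_ge0 => ?; exact: powR_ge0.
Qed.

Lemma subcritical_weight_supp eta t s : ~~ (0 < s < t) -> subcritical_weight eta t s = 0.
Proof.
by move=> st; rewrite /subcritical_weight patchE memNset//= in_itv/=; exact/negP.
Qed.

Lemma subcritical_weight_le1 eta t s : 0 < s < t -> s <= 1 -> 0 <= eta ->
  eta * s `^ (- (1 / 4)) <= subcritical_weight eta t s.
Proof.
move=> st s1 eta0; rewrite /subcritical_weight patchE mem_set/= ?in_itv//=.
apply: ler_wpM2l => //; rewrite [X in _ <= X + _]patchE mem_set/=; last first.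
  by rewrite in_itv/=; case/andP: st => -> _; rewrite (le_lt_trans s1)// ltr1n.
by rewrite lerDl; apply: patch_ge0 => ?; exact: powR_ge0.
Qed.

Lemma subcritical_weight_gt1 eta t s : 0 < s < t -> 1 < s -> 0 <= eta ->
  eta * s `^ (- (4 / 3)) <= subcritical_weight eta t s.
Proof.
move=> st s1 eta0; rewrite /subcritical_weight patchE mem_set/= ?in_itv//=.
apply: ler_wpM2l => //; rewrite [X in _ <= _ + X]patchE mem_set/=; last first.
  by rewrite in_itv/= s1; case/andP: st.
by rewrite lerDr; apply: patch_ge0 => ?; exact: powR_ge0.
Qed.

Lemma integral_subcritical_weight eta t : 0 < t -> 0 <= eta ->
  (\int[leb]_s (subcritical_weight eta t s)%:E <= (eta * 6)%:E)%E.
Proof.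
move=> t0 eta0.
pose g1 : R -> R := (fun s => s `^ (- (1 / 4))) \_ `]0, 2[.
pose g2 : R -> R := (fun s => s `^ (- (4 / 3))) \_ `]1, t[.
have g10 s : 0 <= g1 s by apply: patch_ge0 => ?; exact: powR_ge0.
have g20 s : 0 <= g2 s by apply: patch_ge0 => ?; exact: powR_ge0.
have m1 : measurable_fun setT (fun s => (g1 s)%:E).
  by apply/measurable_EFinP; exact: measurable_patch_powR.
have m2 : measurable_fun setT (fun s => (g2 s)%:E).
  by apply/measurable_EFinP; exact: measurable_patch_powR.
apply: (@le_trans _ _ (\int[leb]_s (eta%:E * ((g1 s)%:E + (g2 s)%:E)))%E).
  apply: le_integral_nonmeasurable => s _; rewrite -EFinD -EFinM lee_fin.
  rewrite /subcritical_weight patchE; case: ifPn => // _.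
  by rewrite mulr_ge0// addr_ge0.
rewrite ge0_integralZl ?lee_fin//; last 2 first.
- exact: emeasurable_funD.
- by move=> s _; rewrite adde_ge0 ?lee_fin.
rewrite EFinM; apply: lee_wpmul2l; rewrite ?lee_fin// ge0_integralD//; last 2 first.
- by move=> s _; rewrite lee_fin.
- by move=> s _; rewrite lee_fin.
have I1 : (\int[leb]_s (g1 s)%:E <= 3%:E)%E.
  rewrite -[X in integral _ _ X]/(EFin \o g1) /g1 -restrict_EFin -integral_mkcond.
  have -> : - (1 / 4) = 3 / 4 - 1 :> R by field.
  apply: le_trans (integral_powR0_le _ _) _ => //.
  rewrite lee_fin ler_pdivrMr//; apply: (@le_trans _ _ 2); last by lra.
  by rewrite ler1_powR ?ler1n//; lra.
have I2 : (\int[leb]_s (g2 s)%:E <= 3%:E)%E.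
  rewrite -[X in integral _ _ X]/(EFin \o g2) /g2 -restrict_EFin -integral_mkcond.
  have -> : - (4 / 3) = - (1 / 3) - 1 :> R by field.
  apply: integral_powR_le => //.
  move=> c e c1 ce et; have r0 : - (1 / 3) < 0 :> R by lra.
  rewrite ler_ndivrMr//.
  have c0 : c `^ (- (1 / 3)) <= 1.
    by rewrite -[leRHS](powRr0 c) ler_powR ?(ltW c1)//; lra.
  have := powR_ge0 e (- (1 / 3)); lra.
by apply: le_trans (leeD I1 I2) _; rewrite lee_fin; lra.
Qed.

(** The tangent line of exp at [z], integrated against the kernel of mass 1. The inequality is
    arranged as e^z + e^z g <= e^g + e^z z, with nonnegative terms only, so the mean of [g] may be
    infinite. *)
Lemma heat_jensen_exp t g x z : 0 < t -> measurable_fun setT g ->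
  (forall y, 0 <= g y) -> (z%:E <= heat_semigroup t g x)%E -> 0 <= z ->
  ((expR z)%:E <= heat_semigroup t (fun y => expR (g y)) x)%E.
Proof.
move=> t0 mg g0 zg z0.
have ez0 : 0 <= expR z by exact: expR_ge0.
have mZg : measurable_fun setT (fun y => expR z * g y) by exact: measurable_funM.
have Zg0 y : 0 <= expR z * g y by rewrite mulr_ge0.
have meg : measurable_fun setT (fun y => expR (g y)) by exact: measurableT_comp.
have Zz0 : 0 <= expR z * z by rewrite mulr_ge0.
rewrite -(leeD2rE _ _ (_ : (expR z * z)%:E \is a fin_num))//.
rewrite -[in leRHS](heat_cst x t0 Zz0) -heatD//.
apply: (@le_trans _ _ ((expR z)%:E + (expR z)%:E * heat_semigroup t g x)%E).
  by rewrite leeD2l// EFinM; apply: lee_wpmul2l; rewrite ?lee_fin.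
rewrite -heatZ// -[X in (X + _ <= _)%E](heat_cst x t0 ez0) -heatD//.
apply: le_heat => y /=.
have := expR_ge1Dx (g y - z); rewrite expRB ler_pdivlMr ?expR_gt0//.
set e := expR z; set e' := expR (g y); lra.
Qed.

(** With z = v^2 / (16 d^2), Jensen's inequality for exp and the modular of the data give e^z <= 1 +
    s^(-n/2) <= 2 s^(-n/2). Both factors of V are bounded through e^(z/(4n)), the exponential one
    because d is small; their product is (e^z)^(1/(2n)), of order s^(-1/4). *)
Lemma potential_small_time d phi u s x v : 0 < d -> 64 * n%:R * d ^+ 2 <= 1 ->
  0 < s <= 1 -> small_mild_path d phi u ->
  ((`|v| `^ (4 / 3))%:E <= 4%:E * heat_semigroup s (fun y => (`|phi y| `^ (4 / 3))%R) x)%E ->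
  potential n v <= 2 * (128 * d ^+ 2) `^ (2 / n%:R) * s `^ (- (1 / 4)).
Proof.
move=> d0 nd /andP[s0 s1] sm vphi; have [_ _ mphi phid _] := sm.
have d20 : 0 < d ^+ 2 by rewrite exprn_gt0.
have d2 : 0 < 16 * d ^+ 2 by rewrite mulr_gt0.
pose z := v ^+ 2 / (16 * d ^+ 2).
have z0 : 0 <= z by rewrite divr_ge0 ?sqr_ge0 ?(ltW d2).
have vz : v ^+ 2 = 16 * d ^+ 2 * z by rewrite /z mulrC divfK ?gt_eqF.
have mg : measurable_fun setT (fun y => (`|phi y| / d) ^+ 2).
  by apply: measurable_funX; apply: measurable_funM => //; exact: measurableT_comp.
have g0 y : 0 <= (`|phi y| / d) ^+ 2 by exact: sqr_ge0.
have zg : (z%:E <= heat_semigroup s (fun y => ((`|phi y| / d) ^+ 2)%R) x)%E.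
  have := sqr_le_heat s0 mphi vphi.
  rewrite (@eq_heat _ _ _ _ (fun y => d ^+ 2 * (`|phi y| / d) ^+ 2)); last first.
    by move=> y; rewrite powR_mulrn// expr_div_n mulrCA divff ?gt_eqF// mulr1.
  rewrite heatZ// ?(ltW d20)// muleA -EFinM => h.
  rewrite -(@lee_pmul2l _ (16 * d ^+ 2)%:E) ?fin_numE// ?lte_fin//.
  by apply: le_trans h; rewrite -EFinM lee_fin vz.
clearbody z; have ez : expR z <= 2 * s `^ (- (n%:R / 2)).
  rewrite -lee_fin; apply: le_trans (heat_jensen_exp s0 mg g0 zg z0) _.
  have mh : measurable_fun setT (fun y => expR ((`|phi y| / d) ^+ 2) - 1).
    by apply: measurable_funB => //; exact: measurableT_comp.
  have h0 y : 0 <= expR ((`|phi y| / d) ^+ 2) - 1.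
    by rewrite subr_ge0 -expR0 ler_expR sqr_ge0.
  rewrite (@eq_heat _ _ _ _ ((cst 1 : E -> R) \+ (fun y => expR ((`|phi y| / d) ^+ 2) - 1))).
    rewrite heatD// heat_cst//.
    apply: (@le_trans _ _ (1 + (s `^ (- (n%:R / 2)))%:E * 1)%E).
      rewrite leeD2l//; apply: le_trans (heat_le_integral _ s0 mh h0) _.
      by apply: lee_wpmul2l => //; rewrite lee_fin powR_ge0.
    rewrite mule1 -EFinD lee_fin; suff : 1 <= s `^ (- (n%:R / 2)) by lra.
    rewrite powRN invf_ge1 ?powR_gt0//.
    apply: (@le_trans _ _ (1 `^ (n%:R / 2))); last by rewrite powR1.
    by apply: ge0_ler_powR; rewrite ?nnegrE ?divr_ge0 ?(ltW s0).
  by move=> y /=; rewrite addrC subrK.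
have n20 : 0 <= 2 / n%:R :> R by rewrite divr_ge0.
have zexp : z `^ (2 / n%:R) <= 8 `^ (2 / n%:R) * expR (z / (4 * n%:R)).
  have -> : expR (z / (4 * n%:R)) = expR (z / 8) `^ (2 / n%:R).
    by rewrite -expRM; congr expR; field; rewrite gt_eqF.
  rewrite -powRM ?expR_ge0//; apply: ge0_ler_powR; rewrite ?nnegrE ?mulr_ge0 ?expR_ge0//.
  by have := expR_ge1Dx (z / 8); set e := expR _; lra.
have vexp : expR (v ^+ 2) <= expR (z / (4 * n%:R)).
  rewrite ler_expR vz ler_pdivlMr ?mulr_gt0//.
  rewrite (_ : 16 * d ^+ 2 * z * (4 * n%:R) = 64 * n%:R * d ^+ 2 * z); last by ring.
  by rewrite ler_piMl.
have vpow : `|v| `^ (4 / n%:R) = (16 * d ^+ 2) `^ (2 / n%:R) * z `^ (2 / n%:R).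
  rewrite -powRM ?(ltW d2)// -vz -[v ^+ 2]real_normK ?num_real//.
  rewrite -(@powR_mulrn _ `|v| 2)// -powRrM; congr (_ `^ _).
  by field; rewrite gt_eqF.
rewrite /potential vpow.
apply: (@le_trans _ _ ((16 * d ^+ 2) `^ (2 / n%:R) *
    (8 `^ (2 / n%:R) * expR (z / (4 * n%:R))) * expR (z / (4 * n%:R)))).
  apply: ler_pM; rewrite ?mulr_ge0 ?powR_ge0 ?expR_ge0//.
  by rewrite ler_wpM2l ?powR_ge0.
rewrite mulrA -powRM ?(ltW d2)// -mulrA -expRD.
rewrite (_ : 16 * d ^+ 2 * 8 = 128 * d ^+ 2); last by ring.
rewrite -[leRHS]mulrA [leRHS]mulrCA; apply: ler_wpM2l; first exact: powR_ge0.
have -> : expR (z / (4 * n%:R) + z / (4 * n%:R)) = expR z `^ (1 / (2 * n%:R)).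
  by rewrite -expRM; congr expR; field; rewrite gt_eqF.
have e0 : 0 <= 1 / (2 * n%:R) :> R by rewrite divr_ge0// mulr_ge0.
apply: (@le_trans _ _ ((2 * s `^ (- (n%:R / 2))) `^ (1 / (2 * n%:R)))).
  by apply: ge0_ler_powR; rewrite ?nnegrE ?mulr_ge0 ?expR_ge0 ?powR_ge0.
rewrite powRM ?powR_ge0// -powRrM; apply: ler_pM; rewrite ?powR_ge0//.
  by rewrite ler1_powR ?ler1n// ler_pdivrMr ?mulr_gt0// !mul1r; move: nR1; set X := n%:R; lra.
rewrite le_eqVlt; apply/orP; left; apply/eqP; congr (_ `^ _).
by field; rewrite gt_eqF.
Qed.

(** Raising the pointwise bound to the power 3/2 gives |v|^(3/2) <= 32 d s^(-n/2) <= 1, so the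
    exponential is at most e, and the power 8/(3n) of this bound gives s^(-4/3). *)
Lemma potential_large_time d phi s x v : 0 < d -> 32 * d <= 1 -> 1 <= s ->
  measurable_fun setT phi -> (\int[mu]_y (`|phi y| `^ (3 / 2))%:E <= (2 * d)%:E)%E ->
  ((`|v| `^ (4 / 3))%:E <= 4%:E * heat_semigroup s (fun y => (`|phi y| `^ (4 / 3))%R) x)%E ->
  potential n v <= (32 * d) `^ (8 / (3 * n%:R)) * expR 1 * s `^ (- (4 / 3)).
Proof.
move=> d0 d1 s1 mphi phid; have s0 : 0 < s by rewrite (lt_le_trans ltr01).
move=> /(@pow_bound_raise _ n (4 / 3) (3 / 2) s phi x v) h.
have v32 : `|v| `^ (3 / 2) <= 32 * d * s `^ (- (n%:R / 2)).
  rewrite -lee_fin; apply: le_trans (h _ _ s0 mphi) _; [by lra|by lra|].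
  have mp : measurable_fun setT (fun y => `|phi y| `^ (3 / 2)).
    by apply: measurable_powR_comp; exact: measurableT_comp.
  have p0 y : 0 <= `|phi y| `^ (3 / 2) by exact: powR_ge0.
  apply: (@le_trans _ _ (16%:E * ((s `^ (- (n%:R / 2)))%:E * (2 * d)%:E))%E).
    apply: lee_pmul => //.
    - exact: heat_ge0.
    - rewrite lee_fin; apply: (@le_trans _ _ (4 `^ 2)).
        by apply: ler_powR; rewrite ?ler1n//; lra.
      by rewrite powR_mulrn// expr2 -natrM.
    apply: le_trans (heat_le_integral _ s0 mp p0) _.
    by apply: lee_wpmul2l => //; rewrite lee_fin powR_ge0.
  by rewrite -!EFinM lee_fin; set S := _ `^ _; lra.
have sn1 : s `^ (- (n%:R / 2)) <= 1.
  by rewrite -[leRHS](powRr0 s) ler_powR// oppr_le0 divr_ge0.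
have v1 : `|v| <= 1.
  rewrite leNgt; apply/negP => v1.
  have : 1 < `|v| `^ (3 / 2) by rewrite powR_gt1//; lra.
  have := powR_ge0 s (- (n%:R / 2)).
  move: v32 sn1; set S := s `^ _; set V := _ `^ _; nra.
rewrite /potential mulrAC; apply: ler_pM; rewrite ?powR_ge0 ?expR_ge0//; last first.
  by rewrite ler_expR -[v ^+ 2]real_normK ?num_real// exprn_ile1.
have -> : `|v| `^ (4 / n%:R) = (`|v| `^ (3 / 2)) `^ (8 / (3 * n%:R)).
  by rewrite -powRrM; congr (_ `^ _); field; rewrite gt_eqF.
have -> : s `^ (- (4 / 3)) = (s `^ (- (n%:R / 2))) `^ (8 / (3 * n%:R)).
  by rewrite -powRrM; congr (_ `^ _); field; rewrite gt_eqF.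
rewrite -powRM ?powR_ge0 ?mulr_ge0 ?(ltW d0)//; apply: ge0_ler_powR;
  rewrite ?nnegrE ?divr_ge0 ?mulr_ge0 ?powR_ge0 ?(ltW d0)//.
Qed.

End subcritical_step.

Section subcritical_bound.
Context (R : realType) (n : nat).
Local Notation E := (euclidean R n).
Local Notation mu := (@lebesgue_measure_n R n).
Local Notation f := (@nonlinearity R n).
Implicit Types (s t d v : R) (x y : E) (g phi : E -> R) (u : R -> E -> R).
Hypothesis n0 : (0 < n)%N.

Let nR0 : 0 < n%:R :> R. Proof. by rewrite ltr0n. Qed.
Let nR1 : 1 <= n%:R :> R. Proof. by rewrite ler1n. Qed.

Lemma heat_nonlinearity_le t k g x : 0 <= k -> measurable_fun setT g ->
  {ae mu, forall y, potential n (g y) <= k} ->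
  (heat_semigroup t (fun y => `|f (g y)|%R) x <=
   k%:E * heat_semigroup t (fun y => `|g y|%R) x)%E.
Proof.
move=> k0 mg gk.
have mng : measurable_fun setT (fun y => `|g y|) by exact: measurableT_comp.
rewrite -heatZ//; apply: ae_le_heat => //.
- rewrite (_ : (fun y => _) = fun y => potential n (g y) * `|g y|).
    by apply: measurable_funM => //; exact: measurable_potential.
  by apply/funext => y; exact: norm_nonlinearity.
- exact: measurable_funM.
- by move=> y; rewrite mulr_ge0.
by apply: filterS gk => y yk; rewrite norm_nonlinearity ler_wpM2r.
Qed.

Lemma subcritical_bound : exists2 d0 : R, 0 < d0 & forall d phi u, 0 < d -> d <= d0 ->
  small_mild_path d phi u -> (\int[mu]_y (`|phi y| `^ (3 / 2))%:E <= (2 * d)%:E)%E ->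
  forall t, 0 < t -> {ae mu, forall x,
    ((`|u t x| `^ 1)%:E <= 4%:E * heat_semigroup t (fun y => (`|phi y| `^ 1)%R) x)%E}.
Proof.
have [dA dA0 HA] := critical_bound R n0.
have [eta eta0 eta8] : exists2 eta : R, 0 < eta & eta * 6 <= 8^-1.
  by exists (48^-1); [rewrite invr_gt0|lra].
(* [K1] and [K2] are the values of 128 d^2 and 32 d at which the constants of the small-time and
   large-time bounds equal [eta]. *)
pose K1 := (eta / 2) `^ (n%:R / 2).
pose K2 := (eta / expR 1) `^ (3 * n%:R / 8).
have K10 : 0 < K1 by rewrite powR_gt0 ?divr_gt0.
have K20 : 0 < K2 by rewrite powR_gt0 ?divr_gt0 ?expR_gt0.
pose d0 := Num.min (Num.min dA (1 / (64 * n%:R))) (Num.min (K1 / 128) (K2 / 32)).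
exists d0.
  rewrite !lt_min dA0 !divr_gt0//; exact: mulr_gt0.
move=> d phi u d_gt0; rewrite !le_min => /andP[/andP[d1 d2] /andP[d3 d4]] sm phid t t0.
have d64 : d <= 1 / 64.
  apply: le_trans d2 _; rewrite ler_pM2l// lef_pV2 ?posrE ?mulr_gt0//.
  by rewrite ler_peMr.
have dd : d ^+ 2 <= d by rewrite expr2 ger_pMl//; lra.
have dn : 64 * n%:R * d ^+ 2 <= 1.
  apply: le_trans (ler_wpM2l _ dd) _; first by rewrite mulr_ge0.
  by move: d2; rewrite ler_pdivlMr ?mulr_gt0// mulrC.
have mphi := smp_data_measurable sm; have up := smp_path sm.
have small : 2 * (128 * d ^+ 2) `^ (2 / n%:R) <= eta.
  have -> : eta = 2 * K1 `^ (2 / n%:R).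
    rewrite /K1 -powRrM (_ : n%:R / 2 * (2 / n%:R) = 1).
      by rewrite powRr1 ?divr_ge0 ?(ltW eta0)// mulrC divfK.
    by field; rewrite gt_eqF.
  apply: ler_wpM2l => //; apply: ge0_ler_powR; rewrite ?divr_ge0 ?nnegrE ?(ltW K10)//.
    by rewrite mulr_ge0 ?sqr_ge0.
  by move: d3; rewrite ler_pdivlMr// => d3; lra.
have large : (32 * d) `^ (8 / (3 * n%:R)) * expR 1 <= eta.
  rewrite -ler_pdivlMr ?expR_gt0//.
  have -> : eta / expR 1 = K2 `^ (8 / (3 * n%:R)).
    rewrite /K2 -powRrM (_ : 3 * n%:R / 8 * (8 / (3 * n%:R)) = 1).
      by rewrite powRr1 ?divr_ge0 ?(ltW eta0) ?expR_ge0.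
    by field; rewrite gt_eqF.
  apply: ge0_ler_powR; rewrite ?divr_ge0 ?nnegrE ?mulr_ge0 ?(ltW K20) ?(ltW d_gt0)//.
  by move: d4; rewrite ler_pdivlMr// mulrC.
apply: (@pointwise_bound R n u phi ((2 * d) ^+ 2) 1 t (subcritical_weight eta)) => //.
- by rewrite lexx ler1n.
- by move=> t' _; exact: measurable_subcritical_weight.
- by move=> t' s; apply: subcritical_weight_ge0; exact: ltW.
- by move=> t' s; exact: subcritical_weight_supp.
- move=> t' /andP[t'0 _]; apply: le_trans (integral_subcritical_weight t'0 (ltW eta0)) _.
  by rewrite lee_fin.
- move=> {t0} {}t /andP[t0 _]; apply: filterS (smp_duhamel sm t0) => x.
  move=> /le_trans; apply; apply: leeD2l.
  apply: le_integral_nonmeasurable => s; rewrite /= in_itv/= => /andP[s0 st].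
  have ts : 0 < t - s by rewrite subr_gt0.
  have mus := path_measurable up s0.
  have w0 : 0 <= subcritical_weight eta t s by apply: subcritical_weight_ge0; exact: ltW.
  rewrite invr1 poweRe1; last by apply: heat_ge0 => y; exact: powR_ge0.
  rewrite (@eq_heat _ _ _ (fun y => `|u s y| `^ 1) (fun y => `|u s y|)); last first.
    by move=> y; rewrite powRr1.
  apply: heat_nonlinearity_le => //.
  apply: filterS (HA _ _ _ d_gt0 d1 sm _ s0) => y uy.
  have st' : 0 < s < t by rewrite s0.
  have [s1|s1] := leP s 1.
    apply: le_trans (subcritical_weight_le1 st' s1 (ltW eta0)).
    have s01 : 0 < s <= 1 by rewrite s0.
    apply: le_trans (potential_small_time n0 d_gt0 dn s01 sm uy) _.
    by rewrite ler_wpM2r ?powR_ge0.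
  apply: le_trans (subcritical_weight_gt1 st' s1 (ltW eta0)).
  have d32 : 32 * d <= 1 by lra.
  apply: le_trans (potential_large_time n0 d_gt0 d32 (ltW s1) mphi phid uy) _.
  by rewrite ler_wpM2r ?powR_ge0.
by rewrite t0 lexx.
Qed.

End subcritical_bound.

(** * Decay of Lebesgue norms *)

Section decay.
Context (R : realType) (n : nat).
Local Notation E := (euclidean R n).
Local Notation mu := (@lebesgue_measure_n R n).
Implicit Types (s t b p r A : R) (x y : E) (g phi v : E -> R).

(** Combines bounds on two integrals of r-th powers into one r-th power. It holds because X^r = X
    X^(r-1) <= X (X + Y)^(r-1), and likewise for Y. *)
Lemma powR_superadd r (X Y : R) : 1 <= r -> 0 <= X -> 0 <= Y ->
  X `^ r + Y `^ r <= (X + Y) `^ r.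
Proof.
move=> r1 X0 Y0; have r0 : 0 < r by rewrite (lt_le_trans ltr01).
have XY0 : 0 <= X + Y by rewrite addr_ge0.
rewrite -(mulr_powRB1 X0 r0) -(mulr_powRB1 Y0 r0) -(mulr_powRB1 XY0 r0) mulrDl.
apply: lerD; apply: ler_wpM2l => //;
  apply: ge0_ler_powR; rewrite ?nnegrE ?subr_ge0 ?lerDl ?lerDr//.
Qed.

Lemma heat_pow_fin t p x phi A : 0 < t -> measurable_fun setT phi ->
  (\int[mu]_y (`|phi y| `^ p)%:E <= (A `^ p)%:E)%E ->
  (heat_semigroup t (fun y => (`|phi y| `^ p)%R) x <=
    (t `^ (- (n%:R / 2)) * A `^ p)%:E)%E.
Proof.
move=> t0 mphi phiA; apply: le_trans (heat_le_integral _ t0 _ _) _.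
- by apply: measurable_powR_comp; exact: measurableT_comp.
- by move=> y; exact: powR_ge0.
by rewrite EFinM; apply: lee_wpmul2l => //; rewrite lee_fin powR_ge0.
Qed.

(** With h the evolved p-th power, h^(r/p) is at most (sup h)^(r/p - 1) h; the supremum is
    controlled by smoothing, and the heat flow preserves the integral of h. *)
Lemma integral_heat_poweR t p r phi A : 0 < t -> 0 < p -> p <= r -> 0 <= A ->
  measurable_fun setT phi ->
  (\int[mu]_y (`|phi y| `^ p)%:E <= (A `^ p)%:E)%E ->
  (\int[mu]_x (heat_semigroup t (fun y => (`|phi y| `^ p)%R) x) `^ (r / p) <=
    ((t `^ (- (n%:R / 2 * (p^-1 - r^-1))) * A) `^ r)%:E)%E.
Proof.
move=> t0 p0 pr A0 mphi phiA; have r0 : 0 < r by rewrite (lt_le_trans p0).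
have s1 : 1 <= r / p by rewrite ler_pdivlMr// mul1r.
have s0 : 0 < r / p by rewrite divr_gt0.
have mp : measurable_fun setT (fun y => `|phi y| `^ p).
  by apply: measurable_powR_comp; exact: measurableT_comp.
have p_ge0 y : 0 <= `|phi y| `^ p by exact: powR_ge0.
pose M := t `^ (- (n%:R / 2)) * A `^ p.
have M0 : 0 <= M by rewrite mulr_ge0 ?powR_ge0.
apply: (@le_trans _ _ (\int[mu]_x ((M `^ (r / p - 1))%:E *
    heat_semigroup t (fun y => (`|phi y| `^ p)%R) x))%E).
  apply: le_integral_nonmeasurable => x _.
  have hM := heat_pow_fin x t0 mphi phiA; have h0 := heat_ge0 t x p_ge0.
  have [c hc] : exists c : R, heat_semigroup t (fun y => (`|phi y| `^ p)%R) x = c%:E.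
    exists (fine (heat_semigroup t (fun y => (`|phi y| `^ p)%R) x)).
    by rewrite fineK// ge0_fin_numE// (le_lt_trans hM)// ltry.
  rewrite hc in hM h0 *; rewrite !lee_fin -/M in hM h0; rename hM into cM; rename h0 into c0.
  rewrite poweR_EFin -EFinM lee_fin -(mulr_powRB1 c0 s0) mulrC; apply: ler_wpM2r => //.
  by apply: ge0_ler_powR; rewrite ?nnegrE ?subr_ge0.
rewrite ge0_integralZl ?lee_fin ?powR_ge0//; last 2 first.
- exact: measurable_heat.
- by move=> x _; exact: heat_ge0.
rewrite integral_heat//; apply: le_trans (lee_wpmul2l _ phiA) _.
  by rewrite lee_fin powR_ge0.
rewrite -EFinM lee_fin /M [in leRHS]powRM ?powR_ge0// [in leLHS]powRM ?powR_ge0//.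
rewrite -[leLHS]mulrA -!powRrM le_eqVlt; apply/orP; left; apply/eqP; congr (_ * _).
  by congr (_ `^ _); field; rewrite !gt_eqF.
rewrite -powRD; last first.
  apply/implyP => /eqP h; exfalso; move: r0; suff -> : r = 0 by rewrite ltxx.
  by rewrite -h; field; rewrite gt_eqF.
by congr (_ `^ _); field; rewrite gt_eqF.
Qed.

Lemma decay_rateE p r : 0 < r -> decay_rate n p r%:E = n%:R / 2 * (p^-1 - r^-1).
Proof. by move=> r0; rewrite /decay_rate inver gt_eqF. Qed.

Lemma decay_ratey p : decay_rate n p +oo%E = n%:R / 2 * p^-1.
Proof. by rewrite /decay_rate invey subr0. Qed.

Lemma Lnorm_powE v r : 0 < r ->
  ('N[mu]_(r%:E)[EFin \o v] = (\int[mu]_x (`|v x| `^ r)%:E) `^ r^-1)%E.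
Proof. by move=> r0; rewrite unlock. Qed.

Lemma Lnorm_le_pow v r A : 0 < r -> 0 <= A ->
  (\int[mu]_x (`|v x| `^ r)%:E <= (A `^ r)%:E)%E ->
  ('N[mu]_(r%:E)[EFin \o v] <= A%:E)%E.
Proof.
move=> r0 A0 vA; rewrite Lnorm_powE//.
apply: (@le_trans _ _ ((A `^ r)%:E `^ r^-1)%E).
  apply: le_poweR vA; first by rewrite invr_ge0 ltW.
  by apply: integral_ge0 => x _; rewrite lee_fin powR_ge0.
by rewrite poweR_EFin -powRrM divff ?gt_eqF// powRr1.
Qed.

(** One estimate for both uses: phi1 = 0 gives the plain decay, truncated data the o(.) statement.
    Jensen's inequality with exponent p / b lets phi2 be measured in L^p. The constant is 8 = 4 * 2,
    the 2 coming from the power of a sum. *)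
Lemma two_scale_decay t b p v phi phi1 phi2 A1 A2 (q : \bar R) :
  0 < t -> 1 <= b -> b <= p -> (p%:E <= q)%E ->
  measurable_fun setT v -> measurable_fun setT phi1 -> measurable_fun setT phi2 ->
  0 <= A1 -> 0 <= A2 ->
  (forall y, `|phi y| `^ b <= `|phi1 y| `^ b + `|phi2 y| `^ b) ->
  (\int[mu]_y (`|phi1 y| `^ b)%:E <= (A1 `^ b)%:E)%E ->
  (\int[mu]_y (`|phi2 y| `^ p)%:E <= (A2 `^ p)%:E)%E ->
  {ae mu, forall x, ((`|v x| `^ b)%:E <=
    4%:E * heat_semigroup t (fun y => (`|phi y| `^ b)%R) x)%E} ->
  ('N[mu]_q[EFin \o v] <= (8 * (t `^ (- decay_rate n b q) * A1 +
                                t `^ (- decay_rate n p q) * A2))%:E)%E.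
Proof.
move=> t0 b1 bp pq mv m1 m2 A10 A20 phi12 I1 I2 vphi.
have b0 : 0 < b by rewrite (lt_le_trans ltr01).
have p0 : 0 < p by rewrite (lt_le_trans b0).
have mb1 : measurable_fun setT (fun y => `|phi1 y| `^ b).
  by apply: measurable_powR_comp; exact: measurableT_comp.
have mb2 : measurable_fun setT (fun y => `|phi2 y| `^ b).
  by apply: measurable_powR_comp; exact: measurableT_comp.
have b10 y : 0 <= `|phi1 y| `^ b by exact: powR_ge0.
have b20 y : 0 <= `|phi2 y| `^ b by exact: powR_ge0.
pose h1 := heat_semigroup t (fun y => `|phi1 y| `^ b).
pose h2 := heat_semigroup t (fun y => `|phi2 y| `^ p).
have h10 x : (0 <= h1 x)%E by exact: heat_ge0.
have h20 x : (0 <= h2 x)%E by apply: heat_ge0 => y; exact: powR_ge0.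
have pb : 1 <= p / b by rewrite ler_pdivlMr// mul1r.
have {}vphi : {ae mu, forall x, ((`|v x| `^ b)%:E <= 4%:E * (h1 x + (h2 x) `^ (b / p)))%E}.
  apply: filterS vphi => x /le_trans; apply; apply: lee_wpmul2l => //.
  apply: (@le_trans _ _ (heat_semigroup t
      ((fun y => `|phi1 y| `^ b) \+ (fun y => `|phi2 y| `^ b)) x)).
    exact: le_heat.
  rewrite heatD//; apply: leeD2l; apply: le_trans (heat_jensen x t0 mb2 b20 pb) _.
  rewrite invf_div le_eqVlt; apply/orP; left; apply/eqP; congr (_ `^ _)%E.
  by apply: eq_heat => y; rewrite -powRrM mulrCA divff ?gt_eqF// mulr1.
case: q pq => [r|_|//]; last first.
  rewrite !decay_ratey.
  set X := t `^ _ * A1; set Y := t `^ _ * A2.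
  have X0 : 0 <= X by rewrite mulr_ge0 ?powR_ge0.
  have Y0 : 0 <= Y by rewrite mulr_ge0 ?powR_ge0.
  (* The norm for q = +oo is an essential supremum if the space has positive measure and 0 by
     default; the default case only needs a nonnegative bound. *)
  rewrite unlock /Lnorm; case: ifPn => [_|_]; last first.
    by rewrite lee_fin mulr_ge0 ?addr_ge0.
  apply/ess_supP; apply: filterS vphi => x vx /=; rewrite lee_fin.
  have h1X : (h1 x <= (X `^ b)%:E)%E.
    apply: le_trans (heat_pow_fin x t0 m1 I1) _; rewrite lee_fin /X powRM ?powR_ge0//.
    rewrite -powRrM le_eqVlt; apply/orP; left; apply/eqP; congr (_ `^ _ * _).
    by field; rewrite gt_eqF.
  have h2Y : (h2 x <= (Y `^ p)%:E)%E.
    apply: le_trans (heat_pow_fin x t0 m2 I2) _; rewrite lee_fin /Y powRM ?powR_ge0//.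
    rewrite -powRrM le_eqVlt; apply/orP; left; apply/eqP; congr (_ `^ _ * _).
    by field; rewrite gt_eqF.
  have h2Yb : ((h2 x) `^ (b / p) <= (Y `^ b)%:E)%E.
    apply: le_trans (le_poweR _ (h20 x) h2Y) _; first by rewrite divr_ge0 ?ltW.
    by rewrite poweR_EFin -powRrM mulrCA divff ?gt_eqF// mulr1.
  have vb : `|v x| `^ b <= (4 * (X + Y)) `^ b.
    rewrite -lee_fin; apply: le_trans vx _.
    rewrite powRM ?addr_ge0// EFinM; apply: lee_pmul => //.
    - by rewrite adde_ge0 ?poweR_ge0.
    - by rewrite lee_fin; apply: le1r_powR => //; rewrite ler1n.
    apply: le_trans (leeD h1X h2Yb) _; rewrite -EFinD lee_fin.
    exact: powR_superadd.
  apply: (@le_trans _ _ (4 * (X + Y))); last by rewrite ler_wpM2r ?addr_ge0//; lra.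
  rewrite leNgt; apply/negP => lt4; move: vb; apply/negP; rewrite -ltNge.
  by apply: gt0_ltr_powR; rewrite ?nnegrE ?mulr_ge0 ?addr_ge0.
rewrite lee_fin => pr; have r0 : 0 < r by rewrite (lt_le_trans p0).
have br : b <= r by rewrite (le_trans bp).
rewrite !decay_rateE//.
set X := t `^ _ * A1; set Y := t `^ _ * A2.
have X0 : 0 <= X by rewrite mulr_ge0 ?powR_ge0.
have Y0 : 0 <= Y by rewrite mulr_ge0 ?powR_ge0.
have rb0 : 0 <= r / b by rewrite divr_ge0// ltW.
have rb1 : r / b <= r by rewrite ler_pdivrMr// ler_peMr// ltW.
apply: Lnorm_le_pow => //; first by rewrite mulr_ge0 ?addr_ge0.
have mh1 : measurable_fun setT h1 by exact: measurable_heat.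
have mh2 : measurable_fun setT h2.
  apply: measurable_heat => [|y]; last exact: powR_ge0.
  by apply: measurable_powR_comp; exact: measurableT_comp.
have mP (h : E -> \bar R) c : measurable_fun setT h ->
    measurable_fun setT (fun x => (h x `^ c)%E).
  by move=> mh; exact: measurableT_comp (measurable_poweR c) mh.
apply: (@le_trans _ _ (\int[mu]_x ((8 `^ r)%:E *
    ((h1 x) `^ (r / b) + (h2 x) `^ (r / p))))%E).
  apply: ae_ge0_le_integral => //.
  - apply/measurable_EFinP; apply: measurable_powR_comp; exact: measurableT_comp.
  - by move=> x _; rewrite mule_ge0 ?lee_fin ?powR_ge0// adde_ge0 ?poweR_ge0.
  - by apply: emeasurable_funM => //; apply: emeasurable_funD; exact: mP.
  apply: filterS vphi => x vx _.
  have -> : `|v x| `^ r = (`|v x| `^ b) `^ (r / b).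
    by rewrite -powRrM mulrCA divff ?gt_eqF// mulr1.
  rewrite -poweR_EFin; apply: le_trans (le_poweR rb0 _ vx) _; first by rewrite lee_fin powR_ge0.
  have hh0 : (0 <= h1 x + h2 x `^ (b / p))%E by apply: adde_ge0 => //; exact: poweR_ge0.
  rewrite poweRM ?lee_fin//.
  apply: le_trans (lee_wpmul2l _ (poweR_add_le rb0 (h10 x) (poweR_ge0 _ _))) _.
    exact: poweR_ge0.
  rewrite muleA -(poweRrM (h2 x)).
  rewrite (_ : b / p * (r / b) = r / p); last by field; rewrite !gt_eqF.
  apply: lee_wpmul2r; first by rewrite adde_ge0 ?poweR_ge0.
  rewrite poweR_EFin -EFinM lee_fin -powRM//.
  rewrite (_ : 4 * 2 = 8); last by ring.
  by apply: ler_powR => //; rewrite ler1n.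
rewrite ge0_integralZl ?lee_fin ?powR_ge0//; last 2 first.
- by apply: emeasurable_funD; exact: mP.
- by move=> x _; rewrite adde_ge0 ?poweR_ge0.
rewrite powRM ?addr_ge0// EFinM; apply: lee_wpmul2l; first by rewrite lee_fin powR_ge0.
rewrite ge0_integralD//; last 4 first.
- by move=> x _; exact: poweR_ge0.
- exact: mP.
- by move=> x _; exact: poweR_ge0.
- exact: mP.
have J1 := integral_heat_poweR t0 b0 br A10 m1 I1.
have J2 := integral_heat_poweR t0 p0 pr A20 m2 I2.
apply: le_trans (leeD J1 J2) _; rewrite -EFinD lee_fin.
by apply: powR_superadd => //; rewrite (le_trans b1).
Qed.

End decay.

(** * From small data to the pointwise domination *)

Section small_data_bound.
Context (R : realType) (n : nat).
Local Notation E := (euclidean R n).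
Local Notation mu := (@lebesgue_measure_n R n).
Implicit Types (s t b p q r d : R) (x y : E) (phi : E -> R) (u : R -> E -> R).
Hypothesis n0 : (0 < n)%N.

Lemma expL2_norm_ge0 phi : (0 <= expL2_norm phi)%E.
Proof. by apply: le_ereal_inf_tmp => _ [l [l0 _] <-]; rewrite lee_fin ltW. Qed.

(** Positivity gives |u| = u, so the Duhamel equality becomes an upper bound for |u|; the strict
    smallness of the data makes the bound 2 d strict, as [modular_le1] requires. *)
Lemma small_data_mild_path d p phi u : 0 < d -> small_data d p phi u ->
  small_mild_path d phi u.
Proof.
move=> d0 [[[mphi _] _] _ [[um upos ub] _] _]; rewrite gt_max => /andP[phid _].
have und t : 0 < t -> (expL2_norm (u t) < (2 * d)%:E)%E.
  move=> t0; apply: (@le_lt_trans _ _ (2%:E * expL2_norm phi)%E).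
    by apply: le_trans ub; apply: ereal_sup_ubound; exists t.
  by rewrite EFinM lte_pmul2l// lte_fin.
split.
- exact: (mild_bounded_L2_path um und).
- by move=> t t0; have [] := modular_le1 (und _ t0).
- exact: mphi.
- by have [] := modular_le1 phid.
move=> t t0; apply: filterS2 (upos _ t0) (mild_duhamel um t0) => x u0 ux.
rewrite ger0_norm// ux; apply: leeD; first by apply: le_heat => y; exact: ler_norm.
apply: le_integral_nonmeasurable => s _; apply: le_heat => y; exact: ler_norm.
Qed.

Lemma integral_le_Lnorm p phi A : 0 < p ->
  ('N[mu]_(p%:E)[EFin \o phi] <= A%:E)%E ->
  (\int[mu]_y (`|phi y| `^ p)%:E <= (A `^ p)%:E)%E.
Proof.
move=> p0 phiA; rewrite (_ : (\int[mu]_y _)%E = ('N[mu]_(p%:E)[EFin \o phi] `^ p)%E).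
  by rewrite -poweR_EFin; apply: le_poweR => //; [exact: ltW|exact: Lnorm_ge0].
by rewrite poweR_Lnorm ?gt_eqF.
Qed.

(** Pointwise z^(3/2) <= z^p + z^2. Since d <= 1, both d^p and d^2 are at most d, so the smallness
    threshold does not depend on p. *)
Lemma integral_interpolate d p phi : 0 < d -> d <= 1 -> 1 <= p -> p <= 3 / 2 ->
  measurable_fun setT phi ->
  (\int[mu]_y (`|phi y| `^ p)%:E <= (d `^ p)%:E)%E ->
  (\int[mu]_y ((phi y) ^+ 2)%:E <= (d ^+ 2)%:E)%E ->
  (\int[mu]_y (`|phi y| `^ (3 / 2))%:E <= (2 * d)%:E)%E.
Proof.
move=> d0 d1 p1 p32 mphi Ip I2.
have p0 : 0 < p by rewrite (lt_le_trans ltr01).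
apply: (@le_trans _ _ (\int[mu]_y ((`|phi y| `^ p)%:E + ((phi y) ^+ 2)%:E))%E).
  apply: le_integral_nonmeasurable => y _; rewrite -EFinD lee_fin.
  have [->|y0] := eqVneq (phi y) 0.
    by rewrite normr0 powR0 ?addr_ge0 ?powR_ge0 ?sqr_ge0//; apply/eqP; lra.
  have ny0 : 0 < `|phi y| by rewrite normr_gt0.
  have [y1|y1] := leP `|phi y| 1.
    apply: (@le_trans _ _ (`|phi y| `^ p)); last by rewrite lerDl sqr_ge0.
    by apply: ger_powR; rewrite ?ny0.
  apply: (@le_trans _ _ ((phi y) ^+ 2)); last by rewrite lerDr powR_ge0.
  rewrite -[leRHS]real_normK ?num_real// -powR_mulrn//.
  by apply: ler_powR; [exact: ltW|lra].
have m1 : measurable_fun setT (fun y => (`|phi y| `^ p)%:E).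
  by apply/measurable_EFinP; apply: measurable_powR_comp; exact: measurableT_comp.
have m2 : measurable_fun setT (fun y => ((phi y) ^+ 2)%:E).
  by apply/measurable_EFinP; exact: measurable_funX.
have q1 y : (0 <= (`|phi y| `^ p)%:E)%E by rewrite lee_fin powR_ge0.
have q2 y : (0 <= ((phi y) ^+ 2)%:E)%E by rewrite lee_fin sqr_ge0.
rewrite ge0_integralD//; apply: le_trans (leeD Ip I2) _; rewrite -EFinD lee_fin.
have : d `^ p <= d by apply: ge1r_powR => //; rewrite d0.
by have : d ^+ 2 <= d by [rewrite expr2 ger_pMl]; lra.
Qed.

(** For p >= 3/2 the exponent b = 4/3 is already below p. For p < 3/2 the data lie in L^(3/2) by
    interpolation with L^2, and b = 1 is available, with b < p as soon as p > 1. *)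
Lemma pointwise_small_data : exists2 d : R, 0 < d & forall p, 1 <= p < 2 ->
  exists b : R, [/\ 1 <= b, b <= p, 1 < p -> b < p &
    forall phi u, small_data d p phi u ->
    [/\ measurable_fun setT phi, forall t, 0 < t -> measurable_fun setT (u t) &
      forall t, 0 < t -> {ae mu, forall x, ((`|u t x| `^ b)%:E <=
        4%:E * heat_semigroup t (fun y => (`|phi y| `^ b)%R) x)%E}]].
Proof.
have [dA dA0 HA] := critical_bound R n0.
have [dB dB0 HB] := subcritical_bound R n0.
pose d := Num.min 1 (Num.min dA dB).
have d0 : 0 < d by rewrite !lt_min ltr01 dA0.
have d1 : d <= 1 by rewrite ge_min lexx.
have dA1 : d <= dA by rewrite !ge_min lexx orbT.
have dB1 : d <= dB by rewrite !ge_min lexx !orbT.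
exists d => // p /andP[p1 p2]; have p0 : 0 < p by rewrite (lt_le_trans ltr01).
have [p32|p32] := leP (3 / 2) p.
  exists (4 / 3); split; [by lra|by lra|by move=> _; lra|].
  move=> phi u sd; have sm := small_data_mild_path d0 sd; split.
  - exact: smp_data_measurable sm.
  - by move=> t; exact: path_measurable (smp_path sm) t.
  - exact: (HA d).
exists 1; split => //.
move=> phi u sd; have sm := small_data_mild_path d0 sd; split.
- exact: smp_data_measurable sm.
- by move=> t; exact: path_measurable (smp_path sm) t.
apply: (HB d) => //; have mphi := smp_data_measurable sm.
apply: (integral_interpolate d0 d1 p1 (ltW p32) mphi).
  apply: integral_le_Lnorm => //; have := small_max sd.
  by rewrite gt_max => /andP[_ /ltW].
exact: modular_sqr mphi d0 (smp_data_modular sm).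
Qed.

End small_data_bound.

(** * Higher integrability and truncation of the data *)

Section data_estimates.
Context (R : realType) (n : nat).
Local Notation E := (euclidean R n).
Local Notation mu := (@lebesgue_measure_n R n).
Implicit Types (s t b p r A : R) (x y : E) (phi v : E -> R).

Lemma one_scale_decay t b p v phi A (q : \bar R) :
  0 < t -> 1 <= b -> b <= p -> (p%:E <= q)%E ->
  measurable_fun setT v -> measurable_fun setT phi -> 0 <= A ->
  (\int[mu]_y (`|phi y| `^ p)%:E <= (A `^ p)%:E)%E ->
  {ae mu, forall x, ((`|v x| `^ b)%:E <=
    4%:E * heat_semigroup t (fun y => (`|phi y| `^ b)%R) x)%E} ->
  ('N[mu]_q[EFin \o v] <= (8 * t `^ (- decay_rate n p q) * A)%:E)%E.
Proof.
move=> t0 b1 bp pq mv mphi A0 IA vphi.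
have b0 : b != 0 by rewrite gt_eqF// (lt_le_trans ltr01).
have := @two_scale_decay R n t b p v phi (cst 0) phi 0 A q t0 b1 bp pq mv _ mphi
  (lexx _) A0.
rewrite mulr0 add0r mulrA; apply => //.
- by move=> y; rewrite lerDr powR_ge0.
- under eq_integral do rewrite /= normr0 powR0//.
  by rewrite integral0 powR0.
Qed.

(** For z <= 1 the power p dominates; for z > 1 the power r is at most an even power, which one term
    of the exponential series dominates. It places the data in every L^r with r >= p. *)
Lemma powR_le_young p r : 1 <= p -> p <= r -> exists2 C : R, 0 <= C &
  forall z : R, 0 <= z -> z `^ r <= z `^ p + C * (expR (z ^+ 2) - 1).
Proof.
move=> p1 pr; pose k := Num.truncn r; exists (k.+1)`!%:R => // z z0.
have e0 : 0 <= (k.+1)`!%:R * (expR (z ^+ 2) - 1).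
  by rewrite mulr_ge0// subr_ge0 -expR0 ler_expR sqr_ge0.
have [->|zn0] := eqVneq z 0.
  have r0 : r != 0 by rewrite gt_eqF//; lra.
  by rewrite powR0.
have z_gt0 : 0 < z by rewrite lt_neqAle eq_sym zn0.
have [z1|z1] := leP z 1.
  apply: (@le_trans _ _ (z `^ p)); last by rewrite lerDl.
  by apply: ger_powR; rewrite ?z_gt0.
apply: (@le_trans _ _ (k.+1`!%:R * (expR (z ^+ 2) - 1))); last by rewrite lerDr powR_ge0.
apply: le_trans (exprS_le_expR_sub1 k (sqr_ge0 z)).
rewrite -exprM -powR_mulrn//; apply: ler_powR; first exact: ltW.
have := truncnS_gt r; rewrite -/k natrM => rk; apply: le_trans (ltW rk) _.
by rewrite ler_peMl// ler1n.
Qed.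

(** The inequality for [z] is applied to |phi| / l, so that the L^r bound is homogeneous in [l] and
    leads to an estimate linear in the norm. *)
Lemma integral_data_pow p r phi l C : 0 < l ->
  measurable_fun setT phi -> 0 <= C ->
  (forall z : R, 0 <= z -> z `^ r <= z `^ p + C * (expR (z ^+ 2) - 1)) ->
  (\int[mu]_y (`|phi y| `^ p)%:E <= (l `^ p)%:E)%E ->
  (orlicz_modular exp2_young phi l <= 1)%E ->
  (\int[mu]_y (`|phi y| `^ r)%:E <= ((1 + C) * l `^ r)%:E)%E.
Proof.
move=> l0 mphi C0 HC Ip Im.
have mnl : measurable_fun setT (fun y => `|phi y| / l).
  by apply: measurable_funM => //; exact: measurableT_comp.
have split_pow c y : `|phi y| `^ c = l `^ c * (`|phi y| / l) `^ c.
  by rewrite -powRM ?(ltW l0) ?divr_ge0 ?(ltW l0)// mulrC divfK ?gt_eqF.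
have mpow c : measurable_fun setT (fun y => (`|phi y| / l) `^ c).
  exact: measurable_powR_comp.
have me : measurable_fun setT (fun y => (expR ((`|phi y| / l) ^+ 2) - 1)%:E).
  apply/measurable_EFinP; apply: measurable_funB => //; apply: measurableT_comp => //.
  exact: measurable_funX.
have e0 y : 0 <= expR ((`|phi y| / l) ^+ 2) - 1.
  by rewrite subr_ge0 -expR0 ler_expR sqr_ge0.
have scale c : (\int[mu]_y (`|phi y| `^ c)%:E =
    (l `^ c)%:E * \int[mu]_y ((`|phi y| / l) `^ c)%:E)%E.
  rewrite -ge0_integralZl ?lee_fin ?powR_ge0//.
  - by apply: eq_integral => y _; rewrite split_pow EFinM.
  - exact/measurable_EFinP.
  - by move=> y _; rewrite lee_fin powR_ge0.
rewrite scale mulrC EFinM; apply: lee_wpmul2l; first by rewrite lee_fin powR_ge0.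
apply: (@le_trans _ _ (\int[mu]_y (((`|phi y| / l) `^ p)%:E +
    C%:E * (expR ((`|phi y| / l) ^+ 2) - 1)%:E))%E).
  apply: le_integral_nonmeasurable => y _; rewrite -EFinM -EFinD lee_fin.
  by apply: HC; rewrite divr_ge0 ?(ltW l0).
have m1 : measurable_fun setT (fun y => ((`|phi y| / l) `^ p)%:E).
  exact/measurable_EFinP.
have m2 : measurable_fun setT (fun y => C%:E * (expR ((`|phi y| / l) ^+ 2) - 1)%:E)%E.
  by apply: emeasurable_funM.
have q1 y : (0 <= ((`|phi y| / l) `^ p)%:E)%E by rewrite lee_fin powR_ge0.
have q2 y : (0 <= C%:E * (expR ((`|phi y| / l) ^+ 2) - 1)%:E)%E.
  by rewrite -EFinM lee_fin mulr_ge0.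
rewrite ge0_integralD// EFinD; apply: leeD.
  rewrite -(@lee_pmul2l _ (l `^ p)%:E) ?fin_numE// ?lte_fin ?powR_gt0//.
  by rewrite -scale mule1.
rewrite ge0_integralZl ?lee_fin//; last by move=> y _; rewrite lee_fin.
by rewrite -[leRHS]mule1; apply: lee_wpmul2l; rewrite ?lee_fin.
Qed.

(* Truncation of the data at a small level kappa: the part below kappa is small
   in L^p, the part above it is in L^b. *)
Lemma data_truncation b p e phi : 1 <= b -> b < p -> 0 < e ->
  measurable_fun setT phi -> (\int[mu]_y (`|phi y| `^ p)%:E < +oo)%E ->
  exists phi1 phi2 : E -> R, exists A : R,
  [/\ measurable_fun setT phi1 /\ measurable_fun setT phi2, 0 <= A,
    forall y, `|phi y| `^ b <= `|phi1 y| `^ b + `|phi2 y| `^ b,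
    (\int[mu]_y (`|phi1 y| `^ b)%:E <= (A `^ b)%:E)%E &
    (\int[mu]_y (`|phi2 y| `^ p)%:E <= (e `^ p)%:E)%E].
Proof.
move=> b1 bp e0 mphi Ip; have b0 : 0 < b by rewrite (lt_le_trans ltr01).
have p0 : 0 < p by rewrite (lt_trans b0).
have mnphi : measurable_fun setT (fun y => `|phi y|) by exact: measurableT_comp.
have mpow c : measurable_fun setT (fun y => `|phi y| `^ c) by exact: measurable_powR_comp.
pose low (k : R) y := if `|phi y| <= k then phi y else 0.
pose high (k : R) y := if `|phi y| <= k then 0 else phi y.
have mcut k : measurable_fun setT (fun y => `|phi y| <= k).
  by apply: measurable_fun_ler.
have mlow k : measurable_fun setT (low k) by apply: measurable_fun_ifT.
have mhigh k : measurable_fun setT (high k) by apply: measurable_fun_ifT.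
pose F k y := (`|low k.+1%:R^-1 y| `^ p)%:E.
have cvgF : (\int[mu]_y F k y)%E @[k --> \oo] --> (\int[mu]_y (cst 0%E : E -> \bar R) y)%E.
  apply: (@dominated_cvg _ _ _ mu setT measurableT F (cst 0%E)
    (fun y => (`|phi y| `^ p)%:E)).
  - move=> k; apply/measurable_EFinP; apply: measurable_powR_comp.
    by apply: (measurableT_comp _ (mlow k.+1%:R^-1)).
  - move=> y _; apply: cvg_near_cst.
    have [y0|y0] := eqVneq (phi y) 0.
      by apply: nearW => k; rewrite /F /low y0 if_same normr0 powR0 ?gt_eqF.
    near=> k; rewrite /F /low ifF ?normr0 ?powR0 ?gt_eqF//.
    apply/negbTE; rewrite -ltNge; near: k.
    apply: (cvgr_lt (0 : R)); first exact: cvg_harmonic.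
    by rewrite normr_gt0.
  - by [].
  - apply/integrableP; split; first exact/measurable_EFinP.
    by under eq_integral do rewrite gee0_abs ?lee_fin ?powR_ge0//.
  - move=> k y _; rewrite gee0_abs ?lee_fin ?powR_ge0// /low.
    by case: ifPn => // _; rewrite normr0 powR0 ?powR_ge0 ?gt_eqF.
rewrite integral0 in cvgF.
have ep0 : (0 < (e `^ p)%:E)%E by rewrite lte_fin powR_gt0.
have [k kF] : exists k, (\int[mu]_y F k y < (e `^ p)%:E)%E.
  by have [N _ HN] := cvgF _ (open_ereal_lt' ep0); exists N; apply: HN => /=.
pose kap : R := k.+1%:R^-1; have kap0 : 0 < kap by rewrite invr_gt0.
have [I IE] : exists I : R, (\int[mu]_y (`|phi y| `^ p)%:E)%E = I%:E.
  exists (fine (\int[mu]_y (`|phi y| `^ p)%:E)); rewrite fineK// ge0_fin_numE//.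
  by apply: integral_ge0 => y _; rewrite lee_fin powR_ge0.
have I0 : 0 <= I.
  by rewrite -lee_fin -IE; apply: integral_ge0 => y _; rewrite lee_fin powR_ge0.
(* Above the level [kap], |phi|^b = |phi|^(b-p) |phi|^p <= kap^(b-p) |phi|^p because b < p. *)
pose J := kap `^ (b - p) * I; have J0 : 0 <= J by rewrite mulr_ge0 ?powR_ge0.
exists (high kap), (low kap), (J `^ b^-1); split => //.
- exact: powR_ge0.
- move=> y; rewrite /high /low; case: ifPn => _; first by rewrite lerDr powR_ge0.
  by rewrite lerDl powR_ge0.
- rewrite -powRrM mulVf ?gt_eqF// powRr1// /J EFinM -IE -ge0_integralZl ?lee_fin ?powR_ge0//.
  + apply: le_integral_nonmeasurable => y _; rewrite -EFinM lee_fin /high.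
    case: ifPn => [_|]; first by rewrite normr0 powR0 ?mulr_ge0 ?powR_ge0 ?gt_eqF.
    rewrite -ltNge => ky; have y0 := lt_trans kap0 ky.
    have -> : `|phi y| `^ b = `|phi y| `^ (b - p) * `|phi y| `^ p.
      by rewrite -powRD ?subrK// gt_eqF// implybT.
    apply: ler_wpM2r; first exact: powR_ge0.
    rewrite -opprB !powRN lef_pV2 ?posrE ?powR_gt0//.
    by apply: ge0_ler_powR; rewrite ?nnegrE ?subr_ge0 ?(ltW bp) ?(ltW kap0) ?(ltW ky).
  + exact/measurable_EFinP.
- by apply: ltW; exact: kF.
Unshelve. all: by end_near. Qed.

End data_estimates.

(** * Decay at small and large times *)

Section decay_of_solutions.
Context (R : realType) (n : nat).
Local Notation E := (euclidean R n).
Local Notation mu := (@lebesgue_measure_n R n).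
Implicit Types (t b p r e d : R) (phi v : E -> R) (u : R -> E -> R) (q : \bar R).

Lemma decay_rate_ge0 p r : 0 < p -> p <= r -> 0 <= decay_rate n p r%:E.
Proof.
move=> p0 pr; have r0 := lt_le_trans p0 pr.
by rewrite decay_rateE// mulr_ge0// subr_ge0 lef_pV2.
Qed.

Lemma powR_max1_le t r : 0 < t -> 0 <= r ->
  (Num.max 1 t) `^ (- r) <= 2 `^ r * (1 + t) `^ (- r).
Proof.
move=> t0 r0; have m0 : 0 < Num.max 1 t by rewrite lt_max ltr01.
have t1 : 0 < 1 + t by rewrite addr_gt0.
rewrite !powRN ler_pdivlMr ?powR_gt0// mulrC ler_pdivrMr ?powR_gt0//.
rewrite -powRM ?(ltW m0)//; apply: ge0_ler_powR; rewrite ?nnegrE ?(ltW t1)//.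
  by rewrite mulr_ge0// ltW.
by rewrite mulr_natl mulr2n lerD// le_max lexx ?orbT.
Qed.

Lemma small_data_norms d p phi u : 0 < p -> small_data d p phi u ->
  exists a A : R, [/\ 0 <= a, 0 <= A, cap_norm p phi = (a + A)%:E &
    (\int[mu]_y (`|phi y| `^ p)%:E <= (A `^ p)%:E)%E].
Proof.
move=> p0 /small_max; rewrite gt_max => /andP[ad Ad].
have a0 := expL2_norm_ge0 phi.
have A0 : (0 <= 'N[mu]_(p%:E)[EFin \o phi])%E by exact: Lnorm_ge0.
have af : expL2_norm phi \is a fin_num.
  by rewrite ge0_fin_numE// (lt_trans ad (ltry _)).
have Af : ('N[mu]_(p%:E)[EFin \o phi] \is a fin_num)%E.
  by rewrite ge0_fin_numE// (lt_trans Ad (ltry _)).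
exists (fine (expL2_norm phi)), (fine ('N[mu]_(p%:E)[EFin \o phi])%E).
rewrite !fine_ge0// EFinD !fineK//; split => //.
by apply: integral_le_Lnorm; rewrite ?fineK.
Qed.

(** Measuring the data in L^r itself makes the decay rate zero, so there is no singularity at t =
    0. *)
Lemma small_time_Lnorm t b p r C v phi (c : R) :
  0 < t -> 1 <= b -> b <= p -> p <= r -> 0 <= C ->
  (forall z : R, 0 <= z -> z `^ r <= z `^ p + C * (expR (z ^+ 2) - 1)) ->
  measurable_fun setT v -> measurable_fun setT phi ->
  cap_norm p phi = c%:E ->
  {ae mu, forall x, ((`|v x| `^ b)%:E <=
    4%:E * heat_semigroup t (fun y => (`|phi y| `^ b)%R) x)%E} ->
  ('N[mu]_(r%:E)[EFin \o v] <= (8 * (1 + C) `^ r^-1 * c)%:E)%E.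
Proof.
move=> t0 b1 bp pr C0 HC mv mphi capc vphi.
have p0 : 0 < p by rewrite (lt_le_trans _ bp)// (lt_le_trans ltr01).
have r0 : 0 < r by rewrite (lt_le_trans p0).
have C1 : 0 <= 1 + C by rewrite addr_ge0.
have c0 : 0 <= c.
  by rewrite -lee_fin -capc; apply: adde_ge0; [exact: expL2_norm_ge0|exact: Lnorm_ge0].
have K0 : 0 < 8 * (1 + C) `^ r^-1 by rewrite mulr_gt0// powR_gt0// ltr_pwDl.
apply/lee_addgt0Pr => e e0.
(* The Luxemburg norm is an infimum, so a scale above [c] is used; the excess is chosen to
   contribute exactly [e] after multiplication by the constant. *)
pose l := c + e / (8 * (1 + C) `^ r^-1).
have cl : c < l by rewrite ltrDl divr_gt0.
have l0 : 0 < l by rewrite (le_lt_trans c0).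
have caple : (expL2_norm phi <= c%:E)%E /\ ('N[mu]_(p%:E)[EFin \o phi] <= c%:E)%E.
  by rewrite -capc; split; [rewrite leeDl ?Lnorm_ge0|rewrite leeDr ?expL2_norm_ge0].
have [_ ml] : 0 < l /\ (orlicz_modular exp2_young phi l <= 1)%E.
  by apply: modular_le1; rewrite (le_lt_trans caple.1)// lte_fin.
have Ip : (\int[mu]_y (`|phi y| `^ p)%:E <= (l `^ p)%:E)%E.
  by apply: integral_le_Lnorm => //; rewrite (le_trans caple.2)// lee_fin ltW.
have Ir := integral_data_pow l0 mphi C0 HC Ip ml.
have D0 : 0 <= (1 + C) `^ r^-1 * l by rewrite mulr_ge0 ?powR_ge0 ?ltW.
have := @one_scale_decay R n t b r v phi ((1 + C) `^ r^-1 * l) r%:E t0 b1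
  (le_trans bp pr) (lexx _) mv mphi D0.
rewrite decay_rateE// subrr mulr0 oppr0 powRr0 mulr1 => H.
apply: le_trans (H _ vphi) _.
  apply: le_trans Ir _; rewrite lee_fin powRM ?powR_ge0 ?(ltW l0)//.
  by rewrite -powRrM mulVf ?gt_eqF// powRr1.
rewrite -EFinD lee_fin /l mulrA mulrDr mulrCA divff ?mulr1//.
by rewrite gt_eqF.
Qed.

Lemma large_time_decay p b phi u q : 1 <= b -> b < p -> (p%:E <= q)%E ->
  measurable_fun setT phi -> (forall t, 0 < t -> measurable_fun setT (u t)) ->
  (\int[mu]_y (`|phi y| `^ p)%:E < +oo)%E -> (0 < n)%N ->
  (forall t, 0 < t -> {ae mu, forall x, ((`|u t x| `^ b)%:E <=
    4%:E * heat_semigroup t (fun y => (`|phi y| `^ b)%R) x)%E}) ->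
  forall e, 0 < e -> \forall t \near +oo,
    ('N[mu]_q[EFin \o u t] <= (e * t `^ (- decay_rate n p q))%:E)%E.
Proof.
move=> b1 bp pq mphi mu_u Ip n0 uphi e e0.
have b0 : 0 < b by rewrite (lt_le_trans ltr01).
(* Each of the two terms will be at most e / 16 times the expected power of t, and the factor 8 of
   [two_scale_decay] turns their sum into e. *)
have e16 : 0 < e / 16 by rewrite divr_gt0.
have [phi1 [phi2 [A [[m1 m2] A0 phi12 I1 I2]]]] := data_truncation b1 bp e16 mphi Ip.
(* The gain of rate from b < p is the same for every q, including +oo. *)
pose g : R := n%:R / 2 * (b^-1 - p^-1).
have g0 : 0 < g.
  by rewrite mulr_gt0 ?divr_gt0 ?ltr0n// subr_gt0 ltf_pV2// posrE (lt_trans b0).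
have rateE : decay_rate n b q = decay_rate n p q + g.
  by rewrite /decay_rate /g -mulrDr; congr (_ * _); ring.
near=> t.
have t0 : 0 < t by near: t; exact: nbhs_pinfty_gt.
apply: le_trans (two_scale_decay t0 b1 (ltW bp) pq (mu_u _ t0) m1 m2 A0 (ltW e16)
  phi12 I1 I2 (uphi _ t0)) _.
rewrite lee_fin rateE opprD powRD; last by rewrite (gt_eqF t0) implybT.
have tA : t `^ (- g) * A <= e / 16.
  have K0 : 0 < 16 * A / e + 1.
    by rewrite ltr_wpDl// divr_ge0 ?(ltW e0)// mulr_ge0.
  have tK : (16 * A / e + 1) `^ g^-1 <= t by near: t; exact: nbhs_pinfty_ge.
  have : 16 * A / e + 1 <= t `^ g.
    rewrite -[leLHS]powRr1 ?(ltW K0)// -(mulVf (lt0r_neq0 g0)) powRrM.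
    by apply: ge0_ler_powR; rewrite ?nnegrE ?powR_ge0 ?(ltW g0) ?(ltW t0).
  move=> tg; rewrite powRN mulrC ler_pdivrMr ?powR_gt0//.
  have : A <= e / 16 * (16 * A / e + 1).
    have -> : e / 16 * (16 * A / e + 1) = A + e / 16 by field; rewrite gt_eqF.
    by rewrite lerDl ltW.
  by move=> /le_trans; apply; rewrite ler_wpM2l// ltW.
set X := t `^ (- decay_rate n p q); have X0 : 0 <= X by exact: powR_ge0.
have : X * (t `^ (- g) * A) <= X * (e / 16) by rewrite ler_wpM2l.
set Y := t `^ (- g); nra.
Unshelve. all: by end_near. Qed.

End decay_of_solutions.

Theorem theorem2p3 (R : realType) (n : nat) (hn : (1 <= n)%N) :
  exists delta C : R, 0 < delta /\ 0 < C /\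
  forall p : R, 1 <= p < 2 ->
  [/\ forall (phi : euclidean R n -> R) (u : R -> euclidean R n -> R),
        small_data delta p phi u ->
        forall q : \bar R, (p%:E <= q)%E -> forall t : R, 0 < t ->
        ('N[lebesgue_measure_n n]_q[EFin \o u t]
          <= (C * t `^ (- decay_rate n p q))%:E * cap_norm p phi)%E,
      forall q : R, p <= q -> exists C' : R, 0 < C' /\
        forall (phi : euclidean R n -> R) (u : R -> euclidean R n -> R),
        small_data delta p phi u -> forall t : R, 0 < t ->
        ('N[lebesgue_measure_n n]_(q%:E)[EFin \o u t]
          <= (C' * (1 + t) `^ (- decay_rate n p q%:E))%:E * cap_norm p phi)%E
    & 1 < p ->
        forall (phi : euclidean R n -> R) (u : R -> euclidean R n -> R),
        small_data delta p phi u ->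
        forall q : \bar R, (p%:E <= q)%E ->
        forall e : R, 0 < e -> \forall t \near +oo,
        ('N[lebesgue_measure_n n]_q[EFin \o u t]
          <= (e * t `^ (- decay_rate n p q))%:E)%E ].
Proof.
have [d d0 Hd] := pointwise_small_data R hn.
exists d, 8; split => //; split => // p p12; have [b [b1 bp bp' Hb]] := Hd p p12.
have b0 : 0 < b by rewrite (lt_le_trans ltr01).
have p0 : 0 < p by rewrite (lt_le_trans b0).
have part1 : forall (phi : euclidean R n -> R) (u : R -> euclidean R n -> R),
    small_data d p phi u ->
    forall q : \bar R, (p%:E <= q)%E -> forall t : R, 0 < t ->
    ('N[lebesgue_measure_n n]_q[EFin \o u t]
      <= (8 * t `^ (- decay_rate n p q))%:E * cap_norm p phi)%E.
  move=> phi u sd q pq t t0; have [mphi mu_u uphi] := Hb _ _ sd.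
  have [a [A [a0 A0 capE IA]]] := small_data_norms p0 sd.
  apply: le_trans (one_scale_decay t0 b1 bp pq (mu_u _ t0) mphi A0 IA (uphi _ t0)) _.
  rewrite capE -EFinM lee_fin ler_wpM2l ?mulr_ge0 ?powR_ge0//.
  by rewrite lerDr.
split => //.
- move=> q pq; have [C C0 HC] := powR_le_young (le_trans b1 bp) pq.
  set r := decay_rate n p q%:E; have r0 : 0 <= r by exact: decay_rate_ge0.
  have q0 : 0 < q by rewrite (lt_le_trans p0).
  have K1 : 1 <= (1 + C) `^ q^-1.
    have C1 : 1 <= 1 + C by rewrite lerDl.
    by rewrite -[leLHS](powRr0 (1 + C)) ler_powR// invr_ge0 ltW.
  set K := (1 + C) `^ q^-1 in K1 *.
  have K0 : 0 < K := lt_le_trans ltr01 K1.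
  (* Since K >= 1, the factor 8 K covers the constants of both time regimes; 2^r is the cost of
     replacing max(1, t) by 1 + t. *)
  exists (8 * K * 2 `^ r); split; first by rewrite !mulr_gt0// powR_gt0.
  move=> phi u sd t t0; have [mphi mu_u uphi] := Hb _ _ sd.
  have [a [A [a0 A0 capE IA]]] := small_data_norms p0 sd.
  have c0 : 0 <= a + A by rewrite addr_ge0.
  have mr := powR_max1_le t0 r0.
  apply: (@le_trans _ _ (8 * K * (Num.max 1 t) `^ (- r) * (a + A))%:E); last first.
    rewrite capE -EFinM lee_fin ler_wpM2r// -[leRHS]mulrA ler_wpM2l//.
    by rewrite mulr_ge0// ltW.
  (* For t >= 1 the decay estimate applies as it stands; for t < 1 its singular power of t is
     avoided by [small_time_Lnorm]. *)
  have [t1|t1] := leP 1 t.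
    apply: le_trans (part1 _ _ sd q%:E pq t t0) _.
    rewrite capE -EFinM lee_fin ler_wpM2r// ler_wpM2r ?powR_ge0//.
    by rewrite ler_peMr.
  have := small_time_Lnorm t0 b1 bp pq C0 HC (mu_u _ t0) mphi capE (uphi _ t0).
  by rewrite powR1 mulr1.
- move=> p1 phi u sd q pq; have [mphi mu_u uphi] := Hb _ _ sd.
  have [a [A [a0 A0 capE IA]]] := small_data_norms p0 sd.
  apply: (large_time_decay b1 (bp' p1) pq mphi mu_u _ hn uphi).
  exact: le_lt_trans IA (ltry _).
Qed.
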